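(* Let $(M,g)$ be a nonempty, connected, compact Riemannian manifold without boundary, of dimension $d\geq 1$, and let $\Gamma:\operatorname{Borel}(\mathscr{D}'(M))\to[0,1]$ denote the Gaussian measure with covariance $(1+\triangle_g)^{-1}:\mathscr{D}(M)\to\mathscr{D}(M)$. If $d\geq 2$, then for $\Gamma$-almost all $B\in\mathscr{D}'(M)$ the following holds for every $\chi\in C^\infty(M)$: if $\chi B\in C^0(M)$, then $\chi=0$. That is, almost surely $B$ is nowhere locally equal to a continuous function.
   Context: $\triangle_g$ is the positive semidefinite Laplace-Beltrami operator of $g$. $\mathscr{D}(M)=C^\infty(M;\mathbb{C})$ is the Fréchet space of smooth complex-valued functions and $\mathscr{D}'(M)$ is its topological dual (distributions) with the weak-$*$ topology; functions are identified with distributions via integration against the Riemannian volume, and $C^0(M)$ denotes the continuous functions. $\Gamma$ is the centered Gaussian probability measure (the law of the real massive Gaussian free field with mass $1$), concentrated on real distributions, for which $\int e^{i B(\varphi)}\,d\Gamma(B)=\exp\!\big(-\tfrac12\langle\varphi,(1+\triangle_g)^{-1}\varphi\rangle_{L^2(M,g)}\big)$ for all real-valued $\varphi\in\mathscr{D}(M)$. ''Almost all'' means: the set of $B$ with the property contains a measurable set of full measure. *)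

(* Defs.v *)
From HB Require Import structures.
From mathcomp Require Import all_boot all_order all_algebra.
From mathcomp Require Import complex.
From mathcomp Require Import all_classical all_reals all_analysis.

Set Implicit Arguments.
Unset Strict Implicit.
Unset Printing Implicit Defensive.

Import Order.TTheory GRing.Theory Num.Theory numFieldNormedType.Exports.

Local Open Scope classical_set_scope.
Local Open Scope ring_scope.
Local Open Scope complex_scope.

Section LebesgueMeasureTuple.
Variable R : realType.

Let consp n (p : n.-tuple R * R) : n.+1.-tuple R := [tuple of p.2 :: p.1].

Let measurable_consp n : measurable_fun [set: n.-tuple R * R] (@consp n).
Proof. by apply: measurable_cons. Qed.

(* n-fold product of the Lebesgue measure of the line, the last factor becoming
   the head of the tuple. *)
Fixpoint lebesgue_tuple (n : nat) : {measure set (n.-tuple R) -> \bar R} :=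
  match n with
  | 0 => dirac [tuple]
  | n.+1 => measure_function_pushforward__canonical__measure_function_Measure
      (lebesgue_tuple n \x lebesgue_measure)%E (@measurable_consp n)
  end.

End LebesgueMeasureTuple.
Notation borel T := (g_sigma_algebraType (@open T)).

Section SmoothOn.
Variables (R : realType) (d : nat).
Implicit Types (U : set 'rV[R]_d) (f g : 'rV[R]_d -> R) (s : seq 'I_d).

Definition basis_vec (i : 'I_d) : 'rV[R]_d := delta_mx 0 i.

Definition partial (i : 'I_d) f : 'rV[R]_d -> R := 'D_(basis_vec i) f.

Definition partials s f : 'rV[R]_d -> R := foldl (fun h i => partial i h) f s.

(* Only meaningful for open U: all iterated partial derivatives exist and are
   continuous on U. Values of f outside U are irrelevant. *)
Definition smooth_on U f : Prop :=
  forall s x, U x ->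
    {for x, continuous (partials s f)} /\
    (forall i, derivable (partials s f) x (basis_vec i)).

Lemma smooth_on_partial U f i : smooth_on U f -> smooth_on U (partial i f).
Proof. by move=> sf s; exact: (sf (i :: s)). Qed.

Let near_on U (P : 'rV[R]_d -> Prop) x :
  open U -> U x -> (forall y, U y -> P y) -> \near x, P x.
Proof.
move=> oU Ux UP; have : nbhs x U by exact: open_nbhs_nbhs.
by apply: filterS => y; exact: UP.
Qed.

Let near_eq_regular f g x : (\near x, f x = g x) ->
  {for x, continuous f} /\ (forall i, derivable f x (basis_vec i)) ->
  {for x, continuous g} /\ (forall i, derivable g x (basis_vec i)).
Proof.
move=> e [cf df]; split.
  rewrite /prop_for /continuous_at -(nbhs_singleton e).
  exact: cvg_trans (@near_eq_cvg _ _ _ (nbhs_filter x) f g e) cf.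
by move=> i; apply: near_eq_derivable (df i).
Qed.

Lemma eq_partials U f g s : open U -> {in U, f =1 g} ->
  {in U, partials s f =1 partials s g}.
Proof.
move=> oU; elim: s f g => [//|i s IH] f g fg /=.
apply: IH => x /set_mem Ux; apply: near_eq_derive.
by apply: (near_on oU Ux) => y Uy; apply: fg; apply/mem_set.
Qed.

Lemma eq_smooth_on U f g : open U -> {in U, f =1 g} ->
  smooth_on U f -> smooth_on U g.
Proof.
move=> oU fg sf s x Ux; apply: near_eq_regular (sf s x Ux).
by apply: (near_on oU Ux) => y Uy; apply: (eq_partials s oU fg); apply/mem_set.
Qed.

Lemma smooth_onP U f (P : ('rV[R]_d -> R) -> Prop) : open U ->
    P f ->
    (forall h, P h -> forall x, U x -> {for x, continuous h} /\
      forall i, derivable h x (basis_vec i)) ->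
    (forall h i, P h -> exists2 h', P h' & {in U, partial i h =1 h'}) ->
  smooth_on U f.
Proof.
move=> oU Pf PU Pd s x Ux.
elim: s f Pf => [|i s IH] f Pf /=; first exact: PU Ux.
have [h Ph e] := Pd f i Pf; apply: near_eq_regular (IH h Ph).
by apply: (near_on oU Ux) => y Uy; apply/esym/(eq_partials s oU e)/mem_set.
Qed.

Lemma smooth_on_cst U (c : R) : open U -> smooth_on U (cst c).
Proof.
move=> oU; apply: (@smooth_onP U _ (fun h => exists c, h = cst c)) => //.
- by exists c.
- by move=> _ [k ->] x _; split=> [|i]; [exact: cst_continuous|exact: derivable_cst].
- move=> _ i [k ->]; exists (cst 0); first by exists 0.
  by move=> x _; rewrite /partial derive_cst.
Qed.

Lemma smooth_onD U f g : open U -> smooth_on U f -> smooth_on U g ->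
  smooth_on U (f + g).
Proof.
move=> oU sf sg.
apply: (@smooth_onP U _ (fun h => exists f' g',
  [/\ smooth_on U f', smooth_on U g' & h = f' + g'])) => //.
- by exists f, g.
- move=> _ [f' [g' [sf' sg' ->]]] x Ux.
  have [cf df] := sf' [::] x Ux; have [cg dg] := sg' [::] x Ux.
  by split=> [|i]; [exact: continuousD|apply: derivableD].
- move=> _ i [f' [g' [sf' sg' ->]]].
  exists (partial i f' + partial i g').
    exists (partial i f'), (partial i g').
    by split; [exact (smooth_on_partial i sf')|exact (smooth_on_partial i sg')|].
  move=> x /set_mem Ux; have [cf df] := sf' [::] x Ux.
  by have [cg dg] := sg' [::] x Ux; rewrite /partial deriveD.
Qed.

Inductive sum_of_products U : ('rV[R]_d -> R) -> Prop :=
| SumProd1 f g of smooth_on U f & smooth_on U g : sum_of_products U (f * g)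
| SumProdD f g of sum_of_products U f & sum_of_products U g :
    sum_of_products U (f + g).

Lemma smooth_onM U f g : open U -> smooth_on U f -> smooth_on U g ->
  smooth_on U (f * g).
Proof.
move=> oU sf sg; apply: (@smooth_onP U _ (sum_of_products U)) => //.
- exact: SumProd1.
- move=> h; elim=> {h} [f' g' sf' sg'|f' g' _ IHf _ IHg] x Ux.
    have [cf df] := sf' [::] x Ux; have [cg dg] := sg' [::] x Ux.
    by split=> [|i]; [exact: continuousM|apply: derivableM].
  have [cf df] := IHf x Ux; have [cg dg] := IHg x Ux.
  by split=> [|i]; [exact: continuousD|apply: derivableD].
- move=> h i Ph.
  have dP k x : sum_of_products U k -> U x -> derivable k x (basis_vec i).
    elim=> {k} [f' g' sf' sg'|f' g' _ IHf _ IHg] Ux.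
      have [_ df] := sf' [::] x Ux; have [_ dg] := sg' [::] x Ux.
      exact: derivableM.
    by apply: derivableD; [exact: IHf|exact: IHg].
  elim: Ph => {h} [f' g' sf' sg'|f' g' Pf [f'' Pf'' ef] Pg [g'' Pg'' eg]].
    exists (f' * partial i g' + g' * partial i f').
      exact (SumProdD (SumProd1 sf' (smooth_on_partial i sg'))
                      (SumProd1 sg' (smooth_on_partial i sf'))).
    move=> x /set_mem Ux; have [_ df] := sf' [::] x Ux.
    by have [_ dg] := sg' [::] x Ux; rewrite /partial deriveM.
  exists (f'' + g''); first exact: SumProdD.
  move=> x Ux; rewrite /partial deriveD; last 2 first.
  - exact: dP (set_mem Ux).
  - exact: dP (set_mem Ux).
  by congr (_ + _); [exact: ef|exact: eg].
Qed.

End SmoothOn.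

(* chart_map i is a homeomorphism from chart_dom i onto chart_cod i with inverse
   chart_inv i; both are junk outside of these sets. *)
Record smooth_atlas (R : realType) (M : topologicalType) (d : nat) := SmoothAtlas {
  chart : Type ;
  chart_dom : chart -> set M ;
  chart_cod : chart -> set 'rV[R]_d ;
  chart_map : chart -> M -> 'rV[R]_d ;
  chart_inv : chart -> 'rV[R]_d -> M ;
  chart_dom_open : forall i, open (chart_dom i) ;
  chart_cod_open : forall i, open (chart_cod i) ;
  chart_mapP : forall i m, chart_dom i m -> chart_cod i (chart_map i m) ;
  chart_invP : forall i x, chart_cod i x -> chart_dom i (chart_inv i x) ;
  chart_mapK : forall i m, chart_dom i m -> chart_inv i (chart_map i m) = m ;
  chart_invK : forall i x, chart_cod i x -> chart_map i (chart_inv i x) = x ;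
  chart_map_continuous : forall i m,
    chart_dom i m -> {for m, continuous (chart_map i)} ;
  chart_inv_continuous : forall i x,
    chart_cod i x -> {for x, continuous (chart_inv i)} ;
  chart_cover : forall m, exists i, chart_dom i m ;
  chart_smooth : forall i j k,
    smooth_on (chart_cod i `&` chart_inv i @^-1` chart_dom j)
      (fun x => chart_map j (chart_inv i x) 0 k) }.

Section Manifold.
Variables (R : realType) (M : ptopologicalType) (d : nat).
Variable A : smooth_atlas R M d.
Local Notation C := R[i]^o.
Implicit Types (f u v : M -> C).

Definition chart_re (i : chart A) f : 'rV[R]_d -> R :=
  fun x => complex.Re (f (chart_inv i x)).

Definition chart_im (i : chart A) f : 'rV[R]_d -> R :=
  fun x => complex.Im (f (chart_inv i x)).

Definition smooth f : Prop :=
  forall i, smooth_on (chart_cod i) (chart_re i f) /\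
            smooth_on (chart_cod i) (chart_im i f).

Definition smooth_pred : {pred M -> C} := fun f => `[< smooth f >].

Lemma smoothP f : reflect (smooth f) (f \in smooth_pred).
Proof. exact: asboolP. Qed.

Lemma smooth_cst (c : C) : smooth (cst c).
Proof. by move=> i; split; apply: smooth_on_cst; exact: chart_cod_open. Qed.

Lemma smoothD u v : smooth u -> smooth v -> smooth (u + v).
Proof.
move=> su sv i; have [sur sui] := su i; have [svr svi] := sv i.
have oU := @chart_cod_open _ _ _ A i; split.
  apply: eq_smooth_on (smooth_onD oU sur svr) => // x _.
  by rewrite /chart_re !fctE; case: (u _) (v _) => [? ?] [? ?].
apply: eq_smooth_on (smooth_onD oU sui svi) => // x _.
by rewrite /chart_im !fctE; case: (u _) (v _) => [? ?] [? ?].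
Qed.

Lemma smoothM u v : smooth u -> smooth v -> smooth (u * v).
Proof.
move=> su sv i; have [sur sui] := su i; have [svr svi] := sv i.
have oU := @chart_cod_open _ _ _ A i.
have sN h : smooth_on (chart_cod i) h -> smooth_on (chart_cod i) (cst (-1) * h).
  exact: (smooth_onM oU (smooth_on_cst (-1) oU)).
split.
  apply: eq_smooth_on
    (smooth_onD oU (smooth_onM oU sur svr) (sN _ (smooth_onM oU sui svi))) => //.
  move=> x _; rewrite /chart_re /chart_im !fctE /cst.
  by case: (u _) (v _) => [? ?] [? ?] /=; rewrite mulN1r.
apply: eq_smooth_on
  (smooth_onD oU (smooth_onM oU sur svi) (smooth_onM oU sui svr)) => //.
move=> x _; rewrite /chart_re /chart_im !fctE.
by case: (u _) (v _) => [? ?] [? ?].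
Qed.

Fact smooth_pred_submod : submod_closed smooth_pred.
Proof.
split; first exact/smoothP/(smooth_cst 0).
move=> a u v /smoothP su /smoothP sv; apply/smoothP.
exact: (smoothD (smoothM (smooth_cst a) su) sv).
Qed.

Fact smooth_pred_mulr : mulr_closed smooth_pred.
Proof.
split; first exact/smoothP/(smooth_cst 1).
by move=> u v /smoothP su /smoothP sv; apply/smoothP/smoothM.
Qed.

HB.instance Definition _ :=
  GRing.isSubmodClosed.Build C (M -> C) smooth_pred smooth_pred_submod.
HB.instance Definition _ :=
  GRing.isMulClosed.Build (M -> C) smooth_pred smooth_pred_mulr.

Record testfun := Testfun {
  testfun_val :> M -> C ;
  testfun_smooth : testfun_val \in smooth_pred }.

HB.instance Definition _ := [isSub for testfun_val].
HB.instance Definition _ := [Choice of testfun by <:].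
HB.instance Definition _ := [SubChoice_isSubComNzRing of testfun by <:].
HB.instance Definition _ := [SubZmodule_isSubLmodule of testfun by <:].

End Manifold.

Section Distributions.
Variables (R : realType) (M : ptopologicalType) (d : nat).
Variable A : smooth_atlas R M d.
Local Notation C := R[i]^o.

Definition chart_partials (i : chart A) (s : seq 'I_d) (f : M -> C) :
    'rV[R]_d -> C :=
  fun x => partials s (chart_re i f) x +i* partials s (chart_im i f) x.

Definition compact_in (U : set 'rV[R]_d) : set (set 'rV[R]_d) :=
  [set K | compact K /\ K `<=` U].

(* The Frechet topology of the smooth functions: uniform convergence of every
   partial derivative on the compact subsets of every chart. *)
HB.instance Definition _ := Topological.copy (testfun A)
  (sup_topology (fun k : chart A * seq 'I_d => Topological.on
    (initial_topology (fun f : testfun A => chart_partials k.1 k.2 f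
       : {family compact_in (chart_cod k.1), 'rV[R]_d -> C})))).

Record schwartz_dist := SchwartzDist {
  schwartz_dist_val :> {linear testfun A -> C} ;
  schwartz_dist_continuous : continuous (schwartz_dist_val : testfun A -> C) }.

HB.instance Definition _ := gen_eqMixin schwartz_dist.
HB.instance Definition _ := gen_choiceMixin schwartz_dist.

Definition schwartz_dist0 : schwartz_dist :=
  @SchwartzDist \0 (@cst_continuous (testfun A) C 0).

HB.instance Definition _ := isPointed.Build schwartz_dist schwartz_dist0.

(* The weak-* topology is that of pointwise convergence on test functions. *)
HB.instance Definition _ := Topological.copy schwartz_dist
  (initial_topology
    (fun B : schwartz_dist => (B : testfun A -> C) : {ptws testfun A -> C})).

(* The product chi B, as a functional. *)
Definition dist_scale (chi : testfun A) (B : schwartz_dist) : testfun A -> C :=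
  fun phi => B (chi * phi).

Definition real_testfun (phi : testfun A) : Prop :=
  forall m, complex.Im (phi m) = 0.

Definition real_distribution (B : schwartz_dist) : Prop :=
  forall phi, real_testfun phi -> complex.Im (B phi) = 0.

End Distributions.

Section ComplexIntegral.
Variable R : realType.

Definition cexp (z : R[i]) : R[i] :=
  (expR (complex.Re z))%:C * (cos (complex.Im z) +i* sin (complex.Im z)).

Definition cintegral disp (T : measurableType disp)
    (mu : {measure set T -> \bar R}) (f : T -> R[i]) : R[i] :=
  (\int[mu]_x complex.Re (f x)) +i* (\int[mu]_x complex.Im (f x)).

End ComplexIntegral.

(* A metric tensor is given by its matrices in the charts. Tangent vectors are
   row vectors, so the differential of the transition map at x is
   v |-> v *m 'J tau x. *)
Record riemannian_metric (R : realType) (M : topologicalType) (d : nat)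
    (A : smooth_atlas R M d) := RiemannianMetric {
  metric_mx :> chart A -> 'rV[R]_d -> 'M[R]_d ;
  metric_smooth : forall i a b,
    smooth_on (chart_cod i) (fun x => metric_mx i x a b) ;
  metric_symmetric : forall i x, chart_cod i x -> (metric_mx i x)^T = metric_mx i x ;
  metric_posdef : forall i x (v : 'rV[R]_d),
    chart_cod i x -> v != 0 -> 0 < (v *m metric_mx i x *m v^T) 0 0 ;
  metric_compat : forall i j x,
    chart_cod i x -> chart_dom j (chart_inv i x) ->
    let tau := chart_map j \o chart_inv i in
    metric_mx i x = 'J tau x *m metric_mx j (tau x) *m ('J tau x)^T }.

Section RiemannianGeometry.
Variables (R : realType) (M : ptopologicalType) (d : nat).
Variables (A : smooth_atlas R M d) (g : riemannian_metric A).
Local Notation C := R[i]^o.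

Definition volume_density (i : chart A) (x : 'rV[R]_d) : R :=
  Num.sqrt (\det (g i x)).

(* Charts cover M, so this determines the Borel measure vol. Integration over
   the tuples t stands for integration over the row vectors. *)
Definition is_riemannian_volume (vol : {measure set (borel M) -> \bar R}) :=
  forall (i : chart A) (S : set (borel M)),
    measurable S -> S `<=` chart_dom i ->
    vol S = (\int[lebesgue_tuple R d]_(t in
      [set t | chart_cod i (\row_k tnth t k) /\
               S (chart_inv i (\row_k tnth t k))])
      (volume_density i (\row_k tnth t k))%:E)%E.

Definition laplacian_chart (i : chart A) (h : 'rV[R]_d -> R) : 'rV[R]_d -> R :=
  fun x => - ((volume_density i x)^-1 * \sum_a partial a (fun y =>
    volume_density i y * \sum_b invmx (g i y) a b * partial b h y) x).

Definition chart_at (m : M) : chart A := projT1 (cid (chart_cover A m)).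

(* The positive semidefinite Laplace-Beltrami operator; on smooth functions the
   value does not depend on the chart around m. *)
Definition laplacian (u : M -> C) : M -> C := fun m =>
  let i := chart_at m in
  laplacian_chart i (chart_re i u) (chart_map i m) +i*
  laplacian_chart i (chart_im i u) (chart_map i m).

Definition one_plus_laplacian (u : testfun A) : M -> C := (u : M -> C) + laplacian u.

(* 1 + laplacian is a bijection of the smooth functions, so that the default
   value 0 is not used on them. *)
Definition covariance : (M -> C) -> testfun A :=
  'pinv_(fun=> 0) [set: testfun A] one_plus_laplacian.

Variable vol : {measure set (borel M) -> \bar R}.

Definition l2_inner (u v : M -> C) : R[i] :=
  cintegral vol (fun m => u m * conjc (v m)).

(* A function h is identified with the functional phi |-> \int h phi dvol. *)
Definition is_function (T : testfun A -> C) (h : M -> C) : Prop :=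
  forall phi : testfun A, T phi = cintegral vol (fun m => h m * phi m).

Definition is_continuous_function (T : testfun A -> C) : Prop :=
  exists2 h : M -> C, continuous h & is_function T h.

(* B phi is almost surely real, but cexp ('i * B phi) is written for every B. *)
Definition is_gaussian_free_field
    (Gamma : probability (borel (schwartz_dist A)) R) : Prop :=
  {ae Gamma, forall B : schwartz_dist A, real_distribution B} /\
  forall phi : testfun A, real_testfun phi ->
    cintegral Gamma (fun B : schwartz_dist A => cexp ('i * B phi)) =
    cexp (- (2^-1 * l2_inner phi (covariance phi))).

End RiemannianGeometry.

(* Main.v *)
Require Import Defs.
From HB Require Import structures.
From mathcomp Require Import all_boot all_order all_algebra.
From mathcomp Require Import complex ring lra.
From mathcomp Require Import all_classical all_reals all_analysis.
From mathcomp Require Import measurable_realfun.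
Set Implicit Arguments.
Unset Strict Implicit.
Unset Printing Implicit Defensive.
Import Order.TTheory GRing.Theory Num.Theory numFieldNormedType.Exports.
Local Open Scope classical_set_scope.
Local Open Scope ring_scope.

(** For a test function p supported in a chart write V(p) for its variance under
    the field. If w is a smooth function with w + Lw = p, L the Laplacian, then
    V(p) is the integral of p w. The characteristic function of a probability
    measure is bounded by 1, so V(p + t(1 + L)u) >= 0 for all t; this bounds V(p)
    from below by (4e)^-1 as soon as some u has energy
    \int u^2 + |grad u|^2 <= e and \int p u >= 1/2. In dimension at least 2 points
    have zero capacity: there are u of arbitrarily small energy with u = 1 at a
    given point. Hence every small box carries probability densities p_k with
    V(p_k) >= k. A Gaussian variable of large variance is rarely in a fixed
    bounded set, so almost surely the values B(p_k) are unbounded, simultaneously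
    for countably many boxes forming a basis. But if chi B = h is continuous and
    chi does not vanish on a box, then B(p_k) is the integral of (h / chi) p_k,
    which is bounded.

    No elliptic theory is needed. Injectivity of 1 + L is the maximum principle.
    Surjectivity is read off the field itself: [covariance] takes the value 0
    outside of the range of 1 + L, so a function p outside of the range would give
    B(p) = 0 and B(p + (1 + L)u) = 0 almost surely, hence B((1 + L)u) = 0 for
    every u, although this variable has positive variance. *)

(** * Linear algebra and calculus on open sets *)

(** The law of the field is known only through its characteristic function, and integrals over the
    manifold only through charts. No density of B(p) is at hand, so laws are compared by integrating
    inequalities between cosines. Integrals are manipulated only for functions supported in one
    chart, where Green's formula is integration by parts. The Laplacian is computed in a chart
    chosen anew at each point, so even its smoothness rests on independence of the chart. A bump of
    width 1/l has gradient energy of order l^2 l^-d, which in dimension 2 is bounded but not small.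
    Hence the cutoffs average N + 1 dyadic scales: as gradients grow geometrically with the scale,
    the cross terms cost only a constant, and the energy drops to order 1/N. The exceptional set may
    depend neither on chi nor on the bound of h / chi. It is therefore a countable union, over
    finitely many charts, rational boxes and integer bounds. Since chi is complex, the division
    reads p = chi phi with phi = p conj(chi) / |chi|^2. *)

Section PositiveDefinite.
Variable R : rcfType.

Definition posdef n (g : 'M[R]_n) : Prop :=
  forall v : 'rV[R]_n, v != 0 -> 0 < (v *m g *m v^T) 0 0.

(** Cholesky factorisation by induction on the size: the Schur complement [S] of the corner entry is
    again symmetric and positive definite. The factor turns quadratic forms into sums of squares
    without any spectral theory. *)
Lemma posdef_factor n (g : 'M[R]_n) :
  g^T = g -> posdef g -> exists B : 'M[R]_n, g = B *m B^T.
Proof.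
elim: n g => [g _ _|n IH]; first by exists 0; apply/matrixP => -[].
rewrite -[n.+1]/(1 + n)%N => g gs gp.
pose a := g 0 0; pose b : 'rV[R]_n := ursubmx g; pose D := drsubmx g.
have gE : g = block_mx a%:M b b^T D.
  rewrite -[LHS]submxK; congr block_mx.
    by rewrite [LHS]mx11_scalar; congr _%:M; rewrite !mxE; congr (g _ _);
       apply: val_inj.
  by rewrite -{1}gs -[in LHS](submxK g) tr_block_mx block_mxKdl.
have Ds : D^T = D.
  by rewrite /D -{2}gs -[in RHS](submxK g) tr_block_mx block_mxKdr.
have quad (s : R) (w : 'rV[R]_n) :
    (row_mx s%:M w *m g *m (row_mx s%:M w)^T) 0 0 =
    s ^+ 2 * a + 2 * s * (w *m b^T) 0 0 + (w *m D *m w^T) 0 0.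
  rewrite gE mul_row_block tr_row_mx mul_row_col tr_scalar_mx.
  rewrite !mulmxDl -!scalar_mxM !mul_scalar_mx !mul_mx_scalar !mxE.
  rewrite eqxx mulr1n (_ : \sum_j (s *: b) 0 j * _ = s * \sum_j w 0 j * b^T j 0).
    by ring.
  by rewrite mulr_sumr; apply: eq_bigr => j _; rewrite !mxE; ring.
have a0 : 0 < a.
  have := quad 1 0; rewrite !mul0mx.
  rewrite (_ : (0 : 'M[R]_1) 0 0 = 0); last by rewrite mxE.
  rewrite mulr0 !addr0 expr1n mul1r.
  move=> <-; apply: gp; apply/eqP => /rowP /(_ (lshift n 0)).
  by rewrite row_mxEl !mxE eqxx => /eqP; rewrite oner_eq0.
pose S := D - a^-1 *: (b^T *m b).
have [||B' B'E] := IH S.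
- by rewrite /S linearB /= linearZ /= trmx_mul trmxK Ds.
- move=> w w0; pose c := (w *m b^T) 0 0.
  (* The head [- (c / a)] minimises the form over all vectors with tail [w]; the minimum is the form
     of the Schur complement at [w]. *)
  have : row_mx (- (c / a))%:M w != 0 :> 'rV_(1 + n).
    apply: contraNneq w0 => /(congr1 rsubmx).
    by rewrite row_mxKr => ->; rewrite linear0.
  move=> /gp; rewrite quad -/c.
  suff -> : (w *m S *m w^T) 0 0 = (w *m D *m w^T) 0 0 - c ^+ 2 / a.
    by congr (_ < _); field; rewrite gt_eqF.
  have cc : (w *m (b^T *m b) *m w^T) 0 0 = c * c.
    rewrite mulmxA -[_ *m b *m _]mulmxA mxE big_ord1; congr (_ * _).
    transitivity ((b *m w^T)^T 0 0); last by rewrite trmx_mul trmxK.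
    by rewrite [RHS]mxE !ord1.
  rewrite /S mulmxBr mulmxBl -scalemxAr -scalemxAl [LHS]mxE [X in _ + X]mxE.
  by rewrite [X in _ - X]mxE cc expr2 mulrC.
pose r := Num.sqrt a.
have r0 : 0 < r by rewrite sqrtr_gt0.
have rr : r * r = a by rewrite -expr2 sqr_sqrtr// ltW.
exists (block_mx r%:M 0 (r^-1 *: b^T) B').
rewrite (tr_block_mx (r%:M : 'M[R]_1)) mulmx_block tr_scalar_mx trmx0.
rewrite linearZ /= trmxK !mulmx0 mul0mx !addr0 -scalar_mxM rr.
rewrite !mul_scalar_mx !mul_mx_scalar !scalerA divff ?gt_eqF// !scale1r.
rewrite {1}gE -B'E /S -scalemxAl -scalemxAr scalerA -invfM rr.
by rewrite addrC subrK.
Qed.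

(** A row vector in the kernel of the factor [B] would annihilate the form of [g], so [B] is
    invertible and the determinant is a nonzero square. *)
Lemma posdef_det_gt0 n (g : 'M[R]_n) : g^T = g -> posdef g -> 0 < \det g.
Proof.
move=> gs gp; have [B gE] := posdef_factor gs gp.
have Bu : B \in unitmx.
  rewrite -row_free_unit -kermx_eq0; apply/eqP/row_matrixP => i.
  rewrite row0; apply/eqP/negPn/negP => /gp.
  by rewrite gE mulmxA -row_mul mulmx_ker row0 !mul0mx mxE ltxx.
rewrite gE det_mulmx det_tr -expr2 exprn_even_gt0//=.
by rewrite -unitfE -unitmxE.
Qed.

Lemma posdef_unit n (g : 'M[R]_n) : g^T = g -> posdef g -> g \in unitmx.
Proof.
by move=> gs gp; rewrite unitmxE unitfE gt_eqF// posdef_det_gt0.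
Qed.

Lemma invmx_sym n (g : 'M[R]_n) : g^T = g -> (invmx g)^T = invmx g.
Proof. by move=> gs; rewrite trmx_inv gs. Qed.

(** The form of the inverse at [v] is the form of [g] at [v *m invmx g]. This factor is what makes
    the gradient form nonnegative and the Hessian term signed at a maximum. *)
Lemma posdef_inv_factor n (g : 'M[R]_n) :
  g^T = g -> posdef g -> exists B : 'M[R]_n, invmx g = B *m B^T.
Proof.
move=> gs gp; have gu := posdef_unit gs gp.
apply: posdef_factor; first exact: invmx_sym.
move=> v v0; pose w := v *m invmx g.
have vE : v = w *m g by rewrite /w mulmxKV.
have w0 : w != 0 by apply: contraNneq v0 => w0; rewrite vE w0 mul0mx.
suff -> : v *m invmx g *m v^T = w *m g *m w^T by exact: gp.
by rewrite -/w {1}vE trmx_mul gs mulmxA.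
Qed.

End PositiveDefinite.

(** * Continuous partial derivatives yield a total differential *)

Section C1.
Variables (R : realType) (d : nat).
Implicit Types (U : set 'rV[R]_d) (f : 'rV[R]_d -> R).

Lemma is_derive_line (V W : normedModType R) (f : V -> W) (y v : V) (s : R) :
  derivable f (y + s *: v) v ->
  is_derive s 1 (fun t : R => f (y + t *: v)) ('D_v f (y + s *: v)).
Proof.
move=> df.
have e : (fun h : R => h^-1 *: (((fun t : R => f (y + t *: v)) \o shift s) (h *: 1)
    - f (y + s *: v))) =
    (fun h => h^-1 *: ((f \o shift (y + s *: v)) (h *: v) - f (y + s *: v))).
  apply/funext => h /=; congr (_ *: (f _ - _)).
  by rewrite [h%:A]mulr1 scalerDl addrCA.
by split; rewrite /derivable /derive e.
Qed.

Lemma increment_bound f (x y : 'rV[R]_d) (i : 'I_d) (t e : R) :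
  (forall s : R, 0 <= s <= 1 -> derivable f (y + (s * t) *: basis_vec R i) (basis_vec R i) /\
     `|partial i f (y + (s * t) *: basis_vec R i) - partial i f x| <= e) ->
  `|f (y + t *: basis_vec R i) - f y - t * partial i f x| <= e * `|t|.
Proof.
move=> H; set v := basis_vec R i.
pose g s := f (y + (s * t) *: v).
have dg (s : R) : 0 <= s <= 1 -> is_derive s 1 g (partial i f (y + (s * t) *: v) * t).
  move=> /H [df _].
  have h1 : is_derive s 1 (fun s : R => s * t) t.
    have -> : (fun s : R => s * t) = (fun s : R => t *: id s).
      by apply/funext => u; rewrite mulrC.
    by apply: is_derive_eq; rewrite /GRing.scale/= mulr1.
  have h2 := is_derive_line df.
  exact: (@is_derive1_comp R (fun u => f (y + u *: v)) (fun s => s * t)).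
have [c c01] : exists2 c, c \in `[0, 1]%R &
    g 1 - g 0 = partial i f (y + (c * t) *: v) * t * (1 - 0).
  apply: (@MVT_segment R g (fun s => partial i f (y + (s * t) *: v) * t)) => //.
    by move=> s; rewrite in_itv/= => /andP[s0 s1]; apply: dg; rewrite !ltW.
  apply/continuous_in_subspaceT => s; rewrite inE/= in_itv/= => /dg ds.
  exact/differentiable_continuous/derivable1_diffP.
rewrite /g mul1r mul0r scale0r addr0 subr0 mulr1 => ->.
rewrite mulrC -mulrBr normrM mulrC ler_wpM2r//.
by apply: (H c _).2; move: c01; rewrite in_itv.
Qed.

(** The point [x] is joined to [x + h] by moving one coordinate at a time; each of the [d] moves is
    an instance of the mean value theorem and costs at most [e * |h|]. *)
Lemma C1_increment f (x h : 'rV[R]_d) (e r : R) : `|h| < r ->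
  (forall y i, ball x r y -> derivable f y (basis_vec R i) /\
     `|partial i f y - partial i f x| <= e) ->
  `|f (x + h) - f x - \sum_i h 0 i * partial i f x| <= e * d%:R * `|h|.
Proof.
move=> hr H; have e0 : forall i : 'I_d, 0 <= e.
  move=> i; have [_] := H x i (ballxx _ (le_lt_trans (normr_ge0 _) hr)).
  exact: le_trans.
(* [T k] keeps the first [k] coordinates of [h]. Truncation does not increase the sup norm, so the
   whole path stays in the ball. *)
pose T k : 'rV[R]_d := \row_j (if (j < k)%N then h 0 j else 0).
have key k : (k <= d)%N ->
  `|f (x + T k) - f x - \sum_(i < d | (i < k)%N) h 0 i * partial i f x|
    <= e * k%:R * `|h|.
  elim: k => [_|k IH kd].
    have -> : T 0 = 0 by apply/rowP => j; rewrite !mxE.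
    by rewrite addr0 subrr big_pred0// subr0 normr0 mulr0 mul0r.
  pose i : 'I_d := Ordinal kd.
  have TS : T k.+1 = T k + h 0 i *: basis_vec R i.
    apply/rowP => j; rewrite !mxE/= ltnS leq_eqVlt.
    have [ji|ji] := eqVneq j i.
      by rewrite ji/= eqxx ltnn/= mulr1 add0r.
    rewrite mulr0 addr0; have -> // : (j == k :> nat) = false.
    by apply: contra_neqF ji => /eqP jk; apply: val_inj.
  rewrite TS (bigD1 i)//= (eq_bigl (fun j : 'I_d => (j < k)%N)); last first.
    move=> j; rewrite ltnS leq_eqVlt; have [->|ji] := eqVneq j i.
      by rewrite /= eqxx ltnn.
    rewrite andbT; have -> // : (j == k :> nat) = false.
    by apply: contra_neqF ji => /eqP jk; apply: val_inj.
  have -> : f (x + (T k + h 0 i *: basis_vec R i)) - f x -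
     (h 0 i * partial i f x + \sum_(j < d | (j < k)%N) h 0 j * partial j f x) =
     (f (x + T k + h 0 i *: basis_vec R i) - f (x + T k) - h 0 i * partial i f x)
     + (f (x + T k) - f x - \sum_(j < d | (j < k)%N) h 0 j * partial j f x).
    by rewrite addrA; ring.
  apply: (le_trans (ler_normD _ _)); rewrite -natr1 mulrDr mulr1 mulrDl addrC.
  apply: lerD; first exact: IH (ltnW kd).
  apply: (@le_trans _ _ (e * `|h 0 i|)); last first.
    rewrite ler_wpM2l ?(e0 i)//.
    by rewrite [leRHS]/Num.Def.normr/= mx_normrE (le_bigmax _ _ (0, i)).
  apply: increment_bound => s /andP[s0 s1]; apply: H.
  rewrite -ball_normE/= -addrA opprD addNKr normrN.
  apply: le_lt_trans hr.
  rewrite [leLHS]/Num.Def.normr/= mx_normrE (bigmax_le)// => -[u j] _ /=.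
  rewrite ord1 !mxE/=; have hj : `|h 0 j| <= `|h|.
    by rewrite [leRHS]/Num.Def.normr/= mx_normrE (le_bigmax _ _ (0, j)).
  have [ji|ji] := eqVneq j i.
    rewrite ji /= ltnn add0r mulr1 -ji normrM ger0_norm//.
    by apply: le_trans hj; rewrite ler_piMl.
  by rewrite mulr0 addr0; case: ifP; rewrite ?normr0.
have := key d (leqnn d).
have -> : T d = h by apply/rowP => j; rewrite !mxE ltn_ord.
by under eq_bigl do rewrite ltn_ord.
Qed.

Definition grad f (x : 'rV[R]_d) : 'cV[R]_d := \col_i partial i f x.

(** [smooth_on] speaks of iterated partial derivatives only, whereas the chain rule for transition
    maps and derivatives along arbitrary vectors require the total differential. *)
Lemma smooth_on_is_diff U f x : open U -> smooth_on U f -> U x ->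
  differentiable f x /\ forall v, 'd f x v = (v *m grad f x) 0 0.
Proof.
move=> oU sf Ux.
pose df (v : 'rV[R]_d) : R := \sum_i v 0 i * partial i f x.
have dflin : linear df.
  move=> a u v; rewrite /df scaler_sumr -big_split/=; apply: eq_bigr => i _.
  by rewrite !mxE mulrDl /GRing.scale/= mulrA.
pose dfL := GRing.isLinear.Build R 'rV[R]_d R^o *:%R df dflin.
pose L : {linear 'rV[R]_d -> R^o} := HB.pack df dfL.
have cL : continuous (L : 'rV[R]_d -> R^o).
  have -> : (L : _ -> _) = \sum_i ((fun v : 'rV[R]_d => v 0 i * partial i f x) : 'rV[R]_d -> R^o).
    by apply/funext => v; rewrite fct_sumE.
  move=> v; apply/differentiable_continuous/differentiable_sum => i.
  by apply: differentiableM => //; exact: differentiable_coord.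
have fL : (f : 'rV[R]_d -> R^o) \o shift x = cst (f x) + L +o_ (0 : 'rV[R]_d) id.
  (* The [d] coordinate errors must sum to at most [e]; dividing by [d.+1] rather than [d] also
     covers dimension zero. *)
  apply/eqaddoP => e e0; have [r r0 rU] : exists2 r, 0 < r &
      forall y i, ball x r y -> derivable f y (basis_vec R i) /\
        `|partial i f y - partial i f x| <= e / (d.+1)%:R.
    have e'0 : 0 < e / (d.+1)%:R by rewrite divr_gt0.
    have N i : \forall y \near x, `|partial i f x - partial i f y| <= e / (d.+1)%:R.
      have [c _] := sf [:: i] x Ux.
      exact: (@cvgr_dist_le _ _ _ _ _ _ (partial i f x) c _ e'0).
    have NU : \forall y \near x, U y by exact: open_nbhs_nbhs.
    have /nbhs_ballP[r r0 rP] : \forall y \near x, U y /\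
        forall i, `|partial i f x - partial i f y| <= e / (d.+1)%:R.
      near=> y; split; first by near: y.
      by move=> i; move: i; near: y; apply: filter_forall => i; exact: N.
    exists r => // y i /rP[Uy yP]; split; last by rewrite distrC.
    by have [_] := sf [::] y Uy.
  apply/nbhs_ballP; exists r => //= h; rewrite -ball_normE/= sub0r normrN => hr.
  have := C1_increment hr rU; rewrite /= addrC => H.
  have -> : (f \o shift x - (cst (f x) + df)) h =
      - (\sum_(i < d) h 0 i * partial i f x) + (f (x + h) - f x).
    transitivity (f (h + x) - (f x + df h)) => //.
    by rewrite [h + x]addrC /df; ring.
  apply: (le_trans H).
  rewrite ler_wpM2r// mulrAC ler_pdivrMr// ler_pM2l// ler_nat//.
have dL : 'd (f : 'rV[R]_d -> R^o) x = L :> (_ -> _) by exact: diff_unique.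
split.
  by apply/diff_locallyP; rewrite dL.
by move=> v; rewrite dL mxE/= /df; apply: eq_bigr => i _; rewrite mxE.
Unshelve. all: by end_near. Qed.

End C1.

(** * Smoothness of compositions, inverses and square roots *)

Section SmoothCalculus.
Variables (R : realType) (d : nat).
Implicit Types (U V : set 'rV[R]_d) (f g : 'rV[R]_d -> R).

Lemma is_derive_comp1 (h : R -> R) f (x v : 'rV[R]_d) (dh df : R) :
  is_derive (f x) 1 h dh -> is_derive x v f df ->
  is_derive x v (h \o f) (dh * df).
Proof.
move=> hd [fd fE].
have e0 : x + 0 *: v = x by rewrite scale0r addr0.
have l1 : is_derive (0 : R) 1 (fun s : R => f (x + s *: v)) df.
  by have := @is_derive_line R _ _ f x v 0; rewrite e0 fE; exact.
have l2 : is_derive (0 : R) 1 (fun s : R => h (f (x + s *: v))) (dh * df).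
  by apply: (@is_derive1_comp R h (fun s : R => f (x + s *: v))); rewrite ?e0.
have [l3 l4] := l2.
have e : (fun k : R => k^-1 *: (((fun s : R => h (f (x + s *: v))) \o shift 0) (k *: 1)
    - h (f (x + 0 *: v)))) =
    (fun k : R => k^-1 *: (((h \o f) \o shift x) (k *: v) - (h \o f) x)).
  apply/funext => k /=; rewrite e0; congr (_ *: (h (f _) - _)).
  by rewrite [k%:A]mulr1 addr0 addrC.
by split; [move: l3; rewrite /derivable e|move: l4; rewrite /derive e].
Qed.

Lemma smooth_on_sub U V f : V `<=` U -> smooth_on U f -> smooth_on V f.
Proof. by move=> VU sf s x /VU; exact: sf. Qed.

Lemma smooth_on_local U f :
  (forall x, U x -> exists2 V, V x & smooth_on V f) -> smooth_on U f.
Proof. by move=> H s x /H [V Vx sf]; exact: sf. Qed.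

Lemma smooth_onZ U (c : R) f : open U -> smooth_on U f ->
  smooth_on U (fun x => c * f x).
Proof. by move=> oU; exact: (smooth_onM oU (smooth_on_cst c oU)). Qed.

Lemma partial_coord (i k : 'I_d) x :
  partial i (fun y : 'rV[R]_d => y 0 k) x = (i == k)%:R.
Proof.
rewrite /partial; apply/cvg_lim => //; apply: cvg_near_cst.
near=> h; have h0 : h != 0 by near: h; exact: nbhs_dnbhs_neq.
by rewrite /= !mxE eqxx addrK /GRing.scale/= mulrA mulVf// mul1r eq_sym.
Unshelve. all: by end_near. Qed.

Lemma smooth_on_coord U (k : 'I_d) : open U -> smooth_on U (fun x => x 0 k).
Proof.
move=> oU; apply: (@smooth_onP _ _ U _
    (fun h => h = (fun x => x 0 k) \/ exists c, h = cst c)) => //.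
- by left.
- move=> h [->|[c ->]] x _.
    split=> [|i]; first exact: coord_continuous.
    exact/diff_derivable/differentiable_coord.
  by split=> [|i]; [exact: cst_continuous|exact: derivable_cst].
- move=> h i [->|[c ->]].
    exists (cst (i == k)%:R); first by right; exists (i == k)%:R.
    by move=> x _; rewrite partial_coord.
  exists (cst 0); first by right; exists 0.
  by move=> x _; rewrite /partial derive_cst.
Qed.

(** By the chain and product rules a partial derivative of such a sum is again such a sum, which is
    the invariant that [smooth_onP] asks for. *)
Inductive comp_terms (H : (R -> R) -> Prop) U f : ('rV[R]_d -> R) -> Prop :=
| CompTerm k g of H k & smooth_on U g : comp_terms H U f ((k \o f) * g)
| CompTermD g g' of comp_terms H U f g & comp_terms H U f g' :
    comp_terms H U f (g + g').

(* H is a class of functions of one variable closed under differentiation on V;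
   it replaces the smoothness of h. *)
Lemma smooth_on_comp1 (H : (R -> R) -> Prop) (V : set R) (h : R -> R) U f :
    (forall k, H k -> exists2 k', H k' & forall t, V t -> is_derive t 1 k (k' t)) ->
    H h -> open U -> (forall x, U x -> V (f x)) -> smooth_on U f ->
  smooth_on U (h \o f).
Proof.
move=> Hd Hh oU UV sf.
have dk k x i : H k -> U x -> derivable (k \o f) x (basis_vec R i).
  move=> /Hd [k' _ kk'] Ux; have [_ df] := sf [::] x Ux.
  by have [] := is_derive_comp1 (kk' _ (UV _ Ux)) (derivableP (df i)).
have ck k x : H k -> U x -> {for x, continuous (k \o f)}.
  move=> /Hd [k' _ kk'] Ux; have [cf _] := sf [::] x Ux.
  apply: continuous_comp => //.
  by apply/differentiable_continuous/derivable1_diffP; have [] := kk' _ (UV _ Ux).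
have dP k x i : comp_terms H U f k -> U x -> derivable k x (basis_vec R i).
  elim=> {k} [k g Hk sg|g g' _ IH _ IH'] Ux.
    by have [_ dg] := sg [::] x Ux; apply: derivableM => //; exact: dk.
  by apply: derivableD; [exact: IH|exact: IH'].
have : smooth_on U ((h \o f) * cst 1).
  apply: (@smooth_onP _ _ U _ (comp_terms H U f) oU).
  - by apply: CompTerm; [exact: Hh|exact: smooth_on_cst].
  - move=> k Pk x Ux; split=> [|i]; last exact: dP.
    elim: Pk => {k} [k g Hk sg|g g' _ IH _ IH'].
      by have [cg _] := sg [::] x Ux; apply: continuousM => //; exact: ck.
    exact: continuousD.
  - move=> k i; elim=> {k} [k g Hk sg|g g' Pg [t Pt et] Pg' [t' Pt' et']].
      have [k' Hk' kk'] := Hd k Hk.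
      exists ((k \o f) * partial i g + (k' \o f) * (partial i f * g)).
        apply: CompTermD; apply: CompTerm.
      - exact: Hk.
      - exact: smooth_on_partial.
      - exact: Hk'.
      - by apply: smooth_onM; [exact: oU|exact: smooth_on_partial|exact: sg].
      move=> x /set_mem Ux; have [_ dg] := sg [::] x Ux.
      have [_ df] := sf [::] x Ux.
      rewrite /partial deriveM//; last exact: dk.
      have [_ ->] := is_derive_comp1 (kk' _ (UV _ Ux)) (derivableP (df i)).
      by rewrite !fctE /GRing.scale/=; ring.
    exists (t + t'); first exact: CompTermD.
    move=> x Ux; rewrite /partial deriveD; last 2 first.
    - exact: dP (set_mem Ux).
    - exact: dP (set_mem Ux).
    by congr (_ + _); [exact: et|exact: et'].
by apply: eq_smooth_on; [exact: oU|move=> x _; rewrite !fctE mulr1].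
Qed.

Lemma smooth_on_inv U f : open U -> (forall x, U x -> f x != 0) ->
  smooth_on U f -> smooth_on U (fun x => (f x)^-1).
Proof.
move=> oU f0; apply: (@smooth_on_comp1
  (fun h => exists c n, h = fun t => c * (t^-1) ^+ n.+1)
  [set t | t != 0] (fun t => t^-1)) => //; last first.
  by exists 1, 0; apply/funext => t; rewrite mul1r expr1.
move=> _ [c [n ->]]; exists (fun t => - c * n.+1%:R * t^-1 ^+ n.+2).
  by exists (- c * n.+1%:R), n.+1.
move=> t /= t0.
have dV : is_derive t 1 (fun t : R => t^-1) (- t ^- 2).
  have := @is_deriveV R id t 1 1 t0 (is_derive_id t 1).
  by rewrite /GRing.scale/= mulr1.
have -> : (fun t : R => c * t^-1 ^+ n.+1) = c \*: (fun t : R => t^-1) ^+ n.+1.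
  by apply/funext => u; rewrite !exprfctE.
apply: is_derive_eq.
change (c * (n.+1%:R * t^-1 ^+ n * - t ^- 2) = - c * n.+1%:R * t^-1 ^+ n.+2).
by rewrite -exprVn !exprS expr0; ring.
Qed.

(** The class is that of the functions c t^(1/2 - n) on t > 0, written with [Num.sqrt];
    differentiation multiplies the coefficient by 1/2 - n and raises n by one. *)
Lemma smooth_on_sqrt U f : open U -> (forall x, U x -> 0 < f x) ->
  smooth_on U f -> smooth_on U (fun x => Num.sqrt (f x)).
Proof.
move=> oU f0; apply: (@smooth_on_comp1
  (fun h => exists c n, h = fun t => c * (t^-1) ^+ n * Num.sqrt t)
  [set t | 0 < t] (fun t => Num.sqrt t)) => //; last first.
  by exists 1, 0; apply/funext => t; rewrite expr0 !mul1r.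
move=> _ [c [n ->]].
exists (fun t => c * (2^-1 - n%:R) * t^-1 ^+ n.+1 * Num.sqrt t).
  by exists (c * (2^-1 - n%:R)), n.+1.
move=> t /= t0; have t1 : t != 0 by rewrite gt_eqF.
have dV : is_derive t 1 (fun t : R => t^-1) (- t ^- 2).
  have := @is_deriveV R id t 1 1 t1 (is_derive_id t 1).
  by rewrite /GRing.scale/= mulr1.
have dS := is_derive1_sqrt t0.
have -> : (fun t : R => c * t^-1 ^+ n * Num.sqrt t) =
    (c \*: (fun t : R => t^-1) ^+ n) * Num.sqrt.
  by apply/funext => u; rewrite !exprfctE.
apply: is_derive_eq.
have s0 : Num.sqrt t != 0 by rewrite gt_eqF// sqrtr_gt0.
have tE : t = Num.sqrt t ^+ 2 by rewrite sqr_sqrtr// ltW.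
rewrite exprfctE; change (c * t^-1 ^+ n * (2 * Num.sqrt t)^-1 +
  Num.sqrt t * (c * (n%:R * t^-1 ^+ n.-1 * - t ^- 2)) =
  c * (2^-1 - n%:R) * t^-1 ^+ n.+1 * Num.sqrt t).
have -> : (2 * Num.sqrt t)^-1 = 2^-1 * t^-1 * Num.sqrt t.
  by rewrite {2}tE; field.
case: n => [|n] /=; first by rewrite expr0 expr1; ring.
by rewrite -!exprVn !exprS expr0; ring.
Qed.

End SmoothCalculus.

(** * Integration over boxes and tuples *)

Section Boxes.
Variable R : realType.

(** The Lebesgue measure lives on tuples, the differential calculus on row vectors; every integral
    passes through this map. *)
Definition rowt n (t : n.-tuple R) : 'rV[R]_n := \row_k tnth t k.

(** The closed ball of the sup norm, written by coordinates so that its compactness and its measure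
    reduce to those of an interval. *)
Definition box n (q : 'rV[R]_n) (r : R) : set 'rV[R]_n :=
  [set x | forall k, `|x 0 k - q 0 k| <= r].

Lemma box_center n (q : 'rV[R]_n) r : 0 <= r -> box q r q.
Proof. by move=> r0 k; rewrite subrr normr0. Qed.

Lemma box_norm n (q : 'rV[R]_n) r x : 0 <= r -> box q r x <-> `|x - q| <= r.
Proof.
move=> r0; split=> [H|H k].
  rewrite [leLHS]/Num.Def.normr/= mx_normrE bigmax_le// => -[i j] _ /=.
  by rewrite ord1 !mxE; exact: H.
apply: le_trans H; rewrite [leRHS]/Num.Def.normr/= mx_normrE.
by have := le_bigmax 0 (fun i => `|(x - q) i.1 i.2|) (0, k); rewrite /= !mxE; exact.
Qed.

Lemma compact_box n (q : 'rV[R]_n) r : compact (box q r).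
Proof.
have := @rV_compact R n (fun k => `[q 0 k - r, q 0 k + r]%classic).
move=> /(_ (fun k => @segment_compact _ _ _)).
congr compact; apply/seteqP; split => x H k; have := H k;
  by rewrite /= in_itv/= ler_distl.
Qed.

Lemma box_nbhs n (q : 'rV[R]_n) r : 0 < r -> nbhs q (box q r).
Proof.
move=> r0; apply/nbhs_ballP; exists r => // y; rewrite -ball_normE/= => yr.
by apply/box_norm; [exact: ltW|rewrite distrC ltW].
Qed.

Lemma open_box n (O : set 'rV[R]_n) x : open O -> O x ->
  exists2 r, 0 < r & box x r `<=` O.
Proof.
move=> oO Ox; have /nbhs_ballP[e /= e0 eO] : nbhs x O by exact: open_nbhs_nbhs.
exists (e / 2); rewrite ?divr_gt0// => y /box_norm H; apply: eO.
rewrite -ball_normE/= distrC; apply: le_lt_trans (H _) _.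
  by rewrite divr_ge0// ltW.
by rewrite ltr_pdivrMr// ltr_pMr// ltr1n.
Qed.

(** Closed rational boxes act as a countable base. They serve twice: open sets become measurable for
    tuples, and the almost sure statement is reduced to countably many boxes. *)
Lemma rat_box n (O : set 'rV[R]_n) x : open O -> O x ->
  exists (q : 'rV[rat]_n) (m : nat),
    box (map_mx ratr q) m.+1%:R^-1 x /\ box (map_mx ratr q) m.+1%:R^-1 `<=` O.
Proof.
move=> oO Ox; have [r r0 rO] := open_box oO Ox.
have [m mr] : exists m : nat, m.+1%:R^-1 < r / 2.
  have [m _ /(_ m (leqnn m)) H] := near_infty_natSinv_lt (PosNum (divr_gt0 r0 (ltr0n R 2))).
  by exists m.
have m0 : 0 < m.+1%:R^-1 :> R by rewrite invr_gt0.
have Hq k : exists q : rat, `|x 0 k - ratr q| <= m.+1%:R^-1.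
  have : x 0 k < x 0 k + m.+1%:R^-1 by rewrite ltrDl.
  move=> /rat_in_itvoo[q]; rewrite in_itv/= => /andP[q1 q2].
  exists q; rewrite ler_distl; apply/andP; split; first by rewrite lerBlDr ltW.
  by apply: le_trans (ltW q1) _; rewrite lerDl ltW.
pose q : 'rV[rat]_n := \row_k sval (cid (Hq k)).
exists q, m.
have qx : box (map_mx ratr q) m.+1%:R^-1 x.
  by move=> k; rewrite !mxE; exact: (svalP (cid (Hq k))).
split => // y yq; apply: rO => k.
rewrite -(subrKA (map_mx ratr q 0 k)) (le_trans (ler_normD _ _))//.
rewrite (le_trans (lerD (yq k) _) (_ : _ + m.+1%:R^-1 <= _))//.
  by rewrite distrC; exact: qx.
by rewrite (splitr r) lerD// ltW.
Qed.

Lemma measurable_box n (q : 'rV[R]_n) r : measurable (@rowt n @^-1` box q r).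
Proof.
have -> : @rowt n @^-1` box q r =
    \bigcap_(k in [set: 'I_n]) ((fun t => tnth t k) @^-1` `[q 0 k - r, q 0 k + r]%classic).
  apply/seteqP; split => [t H k _|t H k]; have := H k; rewrite /= ?mxE ?in_itv/= ler_distl//.
  exact.
apply: fin_bigcap_measurable => [|k _]; first exact: finite_finset.
by rewrite -[X in measurable X]setTI; apply: measurable_tnth.
Qed.

(** A box is a finite intersection of conditions on coordinates, and an open set is the countable
    union of the rational boxes that it contains. *)
Lemma measurable_rowt n (O : set 'rV[R]_n) : open O -> measurable (@rowt n @^-1` O).
Proof.
move=> oO.
have -> : @rowt n @^-1` O = \bigcup_(p in [set: 'rV[rat]_n * nat])
    (if `[< box (map_mx ratr p.1) p.2.+1%:R^-1 `<=` O >]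
     then @rowt n @^-1` box (map_mx ratr p.1) p.2.+1%:R^-1 else set0).
  apply/seteqP; split => [t Ot|t [[q m] _]].
    have [q [m [qt qO]]] := rat_box oO Ot.
    by exists (q, m) => //=; case: asboolP.
  by case: asboolP => //= H /H.
apply: countable_bigcupT_measurable => // -[q m].
by case: ifP => // _; exact: measurable_box.
Qed.

Lemma continuous_measurable_rowt n (F : 'rV[R]_n -> R) : continuous F ->
  measurable_fun setT (F \o @rowt n).
Proof.
move=> /continuousP cF; apply: (measurability _ (RGenOpens.measurableE R)).
move=> _ [_ [a [b ->] <-]]; rewrite setTI.
by apply: (@measurable_rowt n (F @^-1` `]a, b[%classic)); exact/cF/interval_open.
Qed.

End Boxes.

Section TupleLebesgue.
Variable R : realType.
Local Notation mu n := (lebesgue_tuple R n).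

Lemma rowt_cons n (x : R) (t : n.-tuple R) :
  rowt [tuple of x :: t] = row_mx (\row__ x) (rowt t) :> 'rV_(1 + n).
Proof.
apply/rowP => k; rewrite !mxE; case: splitP => j kj.
  by rewrite mxE (_ : k = ord0)//; apply: val_inj; rewrite /= kj ord1.
rewrite mxE (_ : k = lift ord0 j) ?tnthS//.
by apply: val_inj; rewrite /= kj.
Qed.

Lemma lebesgue_tuple_box n (q : 'rV[R]_n) r : 0 <= r ->
  mu n (@rowt R n @^-1` box q r) = ((2 * r) ^+ n)%:E.
Proof.
move=> r0; elim: n q => [|n IH] q.
  rewrite /= diracE mem_set ?expr0// => -[].
  by [].
have -> : mu n.+1 (@rowt R n.+1 @^-1` box q r) = (mu n \x lebesgue_measure)%E
   ((@rowt R n @^-1` box (\row_k q 0 (lift ord0 k)) r) `*`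
     `[q 0 0 - r, q 0 0 + r]%classic).
  rewrite /= /pushforward; congr (_ _); apply/seteqP; split => -[t x] /= H.
    split => [k|]; first by have := H (lift ord0 k); rewrite !mxE tnthS.
    by have := H 0; rewrite !mxE in_itv/= ler_distl.
  case: H => H1; rewrite in_itv/= -ler_distl => H2 k; rewrite !mxE.
  case: (unliftP 0 k) => [j|] ->; last exact: H2.
  by have := H1 j; rewrite !mxE tnthS.
rewrite product_measure1E//; last exact: measurable_box.
rewrite [X in (X * _)%E = _]IH.
rewrite [X in (_ * X)%E](_ : _ = (2 * r)%:E); last first.
  apply: etrans (lebesgue_measure_itv `[q 0 0 - r, q 0 0 + r]) _ => /=; rewrite lte_fin.
  case: ifPn => h; first by rewrite -EFinB; congr _%:E; ring.
  move: h; rewrite -leNgt => h; congr _%:E.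
  have : r = 0 by lra.
  by move=> ->; rewrite mulr0.
by rewrite -EFinM exprSr.
Qed.

Lemma lebesgue_tuple_sigma_finite n : sigma_finite [set: n.-tuple R] (mu n).
Proof.
exists (fun i => @rowt R n @^-1` box 0 i%:R).
  apply/seteqP; split => // t _.
  exists (Num.truncn `|rowt t|).+1 => //=; apply/box_norm => //.
  by rewrite subr0 ltW// truncnS_gt.
move=> i; split; first exact: measurable_box.
by rewrite lebesgue_tuple_box// ltry.
Qed.

(* An alias to carry the sigma-finite structure that Fubini's theorem requires. *)
Definition sf_lebesgue_tuple n : set (n.-tuple R) -> \bar R := lebesgue_tuple R n.
Arguments sf_lebesgue_tuple n _ : clear implicits.

HB.instance Definition _ n :=
  Measure.copy (sf_lebesgue_tuple n) (lebesgue_tuple R n).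

HB.instance Definition _ n := Measure_isSigmaFinite.Build _ _ _
  (sf_lebesgue_tuple n) (lebesgue_tuple_sigma_finite n).

(** Compact support, witnessed by a box. Integrals in coordinates are taken in this class, where
    integrability is automatic. *)
Definition ccont n (F : 'rV[R]_n -> R) :=
  continuous F /\ exists r, forall x, ~ box 0 r x -> F x = 0.

Lemma continuous_bounded (T : topologicalType) (K : set T) (F : T -> R) :
  compact K -> {within K, continuous F} ->
  exists2 C, 0 <= C & forall x, K x -> `|F x| <= C.
Proof.
move=> cK cF; have [->|/set0P K0] := eqVneq K set0; first by exists 0.
have [c _ H] := @compact_EVT_max T R F K K0 cK cF.
have [c' _ H'] := @compact_EVT_min T R F K K0 cK cF.
exists (`|F c| + `|F c'|); first by rewrite addr_ge0.
move=> x Kx; have := H x (mem_set Kx); have := H' x (mem_set Kx).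
have := ler_norm (F c); have := ler_norm (- F c'); rewrite normrN.
have := normr_ge0 (F c); have := normr_ge0 (F c').
by rewrite ler_norml; move=> *; apply/andP; split; lra.
Qed.

Lemma bounded_integrable n (F : n.-tuple R -> R) (C r : R) (q : 'rV[R]_n) :
  0 <= r -> measurable_fun setT F -> (forall t, `|F t| <= C) ->
  (forall t, ~ box q r (rowt t) -> F t = 0) ->
  (mu n).-integrable setT (EFin \o F).
Proof.
move=> r0 mF FC F0.
have ib : (mu n).-integrable setT
    (EFin \o (\1_(@rowt R n @^-1` box q r) : n.-tuple R -> R)).
  apply/integrableP; split.
    by apply/measurable_EFinP; apply: measurable_indic; exact: measurable_box.
  rewrite (eq_integral (EFin \o (\1_(@rowt R n @^-1` box q r) : n.-tuple R -> R))).
    by rewrite integral_indic// ?setIT ?lebesgue_tuple_box ?ltry//; exact: measurable_box.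
  by move=> t _; rewrite gee0_abs// lee_fin.
have := integrableZl measurableT C ib; apply: le_integrable => //.
  exact/measurable_EFinP.
move=> t _ /=; rewrite lee_fin; have [tb|/F0 ->] := pselect (box q r (rowt t)).
  by rewrite indicE mem_set//= mulr1; apply: le_trans (FC t) (ler_norm _).
by rewrite normr0.
Qed.

Lemma ccont_bounded n (F : 'rV[R]_n -> R) : ccont F ->
  exists2 C, 0 <= C & forall x, `|F x| <= C.
Proof.
move=> [cF [r Fr]].
have [C C0 HC] := continuous_bounded (@compact_box R n 0 r)
  (continuous_subspaceT cF).
exists C => // x; have [/HC//|/Fr ->] := pselect (box 0 r x).
by rewrite normr0.
Qed.

Lemma ccont_integrable n (F : 'rV[R]_n -> R) : ccont F ->
  (mu n).-integrable setT (EFin \o (F \o @rowt R n)).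
Proof.
move=> Fc; have [C C0 HC] := ccont_bounded Fc.
have [cF [r Fr]] := Fc.
apply: (@bounded_integrable n _ C `|r| 0) => //.
  exact: continuous_measurable_rowt.
  by move=> t; exact: HC.
move=> t tr; apply: Fr => tr'; apply: tr => k.
by apply: le_trans (tr' k) (ler_norm _).
Qed.

Definition Jint n (F : 'rV[R]_n -> R) : R := (\int[mu n]_t F (rowt t))%R.

(** Fubini's theorem in both orders, since [Jint_partial] takes as inner integral the one that
    contains the direction of differentiation. *)
Lemma Jint_S n (F : 'rV[R]_(1 + n) -> R) : ccont F ->
  ((Jint F)%:E = \int[mu n]_t \int[lebesgue_measure]_x (F (row_mx (\row__ x) (rowt t)))%:E)%E
  /\
  ((Jint F)%:E = \int[lebesgue_measure]_x \int[mu n]_t (F (row_mx (\row__ x) (rowt t)))%:E)%E.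
Proof.
move=> Fc; have intF := ccont_integrable Fc.
pose h (p : n.-tuple R * R) : \bar R := (F (rowt [tuple of p.2 :: p.1]))%:E.
have mc : measurable_fun [set: n.-tuple R * measurableTypeR R]
    (fun p => [tuple of (p.2 : R) :: p.1] : n.+1.-tuple R).
  exact: (@measurable_cons _ _ (n.-tuple R * R)%type R snd n fst).
pose pm : {measure set _ -> \bar R} :=
  (sf_lebesgue_tuple n \x (@lebesgue_measure R))%E.
have ih : (sf_lebesgue_tuple n \x lebesgue_measure)%E.-integrable setT h.
  have [mF fF] := integrableP _ _ _ intF.
  apply/integrableP; split; first exact: (measurableT_comp mF mc).
  apply: le_lt_trans fF; rewrite le_eqVlt; apply/orP; left; apply/eqP.
  apply/esym.
  have := @ge0_integral_pushforward _ _ _ _ R _ mc pm setT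
    (abse \o (EFin \o (F \o @rowt R n.+1))) measurableT.
  rewrite preimage_setT; apply; last by move=> *; exact: abse_ge0.
  exact: measurableT_comp.
have JE : (Jint F)%:E = (\int[sf_lebesgue_tuple n \x lebesgue_measure]_p h p)%E.
  rewrite /Jint /Rintegral fineK; last exact: integrable_fin_num.
  have := @integral_pushforward _ _ _ _ R _ mc pm setT (EFin \o (F \o @rowt R n.+1)).
  rewrite preimage_setT; apply => //.
  by have [] := integrableP _ _ _ intF.
split; rewrite JE.
  rewrite -integral12_prod_meas1//.
  by apply: eq_integral => t _; apply: eq_integral => x _; rewrite /h rowt_cons.
rewrite -integral21_prod_meas1//.
by apply: eq_integral => t _; apply: eq_integral => x _; rewrite /h rowt_cons.
Qed.

End TupleLebesgue.

(** * Compactly supported integrands and the divergence theorem *)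

Section JintTheory.
Variable R : realType.
Local Notation mu n := (lebesgue_tuple R n).

Lemma ccontD n (F G : 'rV[R]_n -> R) : ccont F -> ccont G -> ccont (fun x => F x + G x).
Proof.
move=> [cF [r Fr]] [cG [r' Gr']]; split.
  by move=> x; exact: (continuousD (cF x) (cG x)).
exists (`|r| + `|r'|) => x H; rewrite Fr ?Gr' ?addr0// => Hx; apply: H => k.
  by apply: le_trans (Hx k) (le_trans (ler_norm _) _); rewrite lerDr.
by apply: le_trans (Hx k) (le_trans (ler_norm _) _); rewrite lerDl.
Qed.

Lemma ccontM n (F G : 'rV[R]_n -> R) : continuous F -> ccont G -> ccont (fun x => F x * G x).
Proof.
move=> cF [cG [r Gr]]; split; last by exists r => x /Gr ->; rewrite mulr0.
by move=> x; exact: (continuousM (cF x) (cG x)).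
Qed.

Lemma ccontZ n (c : R) (F : 'rV[R]_n -> R) : ccont F -> ccont (fun x => c * F x).
Proof. by apply: ccontM; exact: cst_continuous. Qed.

Lemma ccont0 n : ccont (fun _ : 'rV[R]_n => 0).
Proof. by split; [exact: cst_continuous|exists 0]. Qed.

Lemma ccont_sum n (I : Type) (s : seq I) (F : I -> 'rV[R]_n -> R) :
  (forall i, ccont (F i)) -> ccont (fun x => \sum_(i <- s) F i x).
Proof.
move=> cF; elim: s => [|i s IH].
  by under eq_fun do rewrite big_nil; exact: ccont0.
by under eq_fun do rewrite big_cons; exact: ccontD.
Qed.

Lemma JintD n (F G : 'rV[R]_n -> R) : ccont F -> ccont G ->
  Jint (fun x => F x + G x) = Jint F + Jint G.
Proof. by move=> /ccont_integrable iF /ccont_integrable iG; exact: RintegralD. Qed.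

Lemma JintZ n (c : R) (F : 'rV[R]_n -> R) : ccont F ->
  Jint (fun x => c * F x) = c * Jint F.
Proof. by move=> /ccont_integrable iF; exact: RintegralZl. Qed.

Lemma Jint_sum n (I : Type) (s : seq I) (F : I -> 'rV[R]_n -> R) :
  (forall i, ccont (F i)) ->
  Jint (fun x => \sum_(i <- s) F i x) = \sum_(i <- s) Jint (F i).
Proof.
move=> cF; elim: s => [|i s IH].
  rewrite big_nil /Jint; under eq_Rintegral do rewrite big_nil.
  by rewrite Rintegral_cst//= mul0r.
rewrite big_cons -IH -JintD//; last exact: ccont_sum.
by congr Jint; apply/funext => x; rewrite big_cons.
Qed.

Lemma integrable_box n (q : 'rV[R]_n) r C : 0 <= r ->
  (mu n).-integrable setT
   (EFin \o (fun t => C * (\1_(@rowt R n @^-1` box q r) t : R))) /\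
  (\int[mu n]_t (C * (\1_(@rowt R n @^-1` box q r) t : R)))%R = C * (2 * r) ^+ n.
Proof.
move=> r0; have mb := measurable_box q r.
have i1 : (mu n).-integrable setT
    (EFin \o (\1_(@rowt R n @^-1` box q r) : n.-tuple R -> R)).
  apply: (@bounded_integrable R n _ 1 r q) => //.
  - by move=> t; rewrite indicE ger0_norm// lern1 leq_b1.
  - by move=> t tb; rewrite indicE memNset.
split.
  have := integrableZl measurableT C i1; exact.
rewrite RintegralZl//; congr (_ * _).
by rewrite /Rintegral integral_indic// setIT lebesgue_tuple_box.
Qed.

Lemma Jint_le_boxes n (I : finType) (q : I -> 'rV[R]_n) (r C : I -> R) (F : 'rV[R]_n -> R) :
  (forall i, 0 <= r i) -> ccont F ->
  (forall x, F x <= \sum_i C i * \1_(box (q i) (r i)) x) ->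
  Jint F <= \sum_i C i * (2 * r i) ^+ n.
Proof.
move=> r0 Fc H.
pose G i t := C i * (\1_(@rowt R n @^-1` box (q i) (r i)) t : R).
have key (s : seq I) : (mu n).-integrable setT (EFin \o (fun t => \sum_(i <- s) G i t)) /\
  (\int[mu n]_t \sum_(i <- s) G i t)%R = \sum_(i <- s) C i * (2 * r i) ^+ n.
  elim: s => [|i s [IH1 IH2]].
    split; last first.
      under eq_Rintegral do rewrite big_nil.
      by rewrite Rintegral_cst//= mul0r big_nil.
    have := @integrable0 _ (n.-tuple R) R (mu n) setT; congr (integrable _ _).
    by apply/funext => t /=; rewrite big_nil.
  have [i1 i2] := @integrable_box n (q i) (r i) (C i) (r0 i).
  split.
    have := integrableD measurableT i1 IH1; congr (integrable _ _).
    by apply/funext => t /=; rewrite big_cons EFinD.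
  rewrite big_cons -IH2 -i2 -RintegralD//.
  by apply: eq_Rintegral => t _; rewrite big_cons.
have [k1 k2] := key (index_enum I).
rewrite -k2; apply: le_Rintegral => //; exact: ccont_integrable.
Qed.

Lemma Jint_gt0 n (F : 'rV[R]_n -> R) x : ccont F -> (forall y, 0 <= F y) ->
  0 < F x -> 0 < Jint F.
Proof.
move=> Fc F0 Fx.
have : \forall y \near x, F x / 2 < F y.
  apply: (cvgr_gt (F x) (Fc.1 x)).
  by rewrite ltr_pdivrMr// ltr_pMr// ltr1n.
move=> /nbhs_interior/nbhs_singleton H.
have [r r0 rP] := open_box (@open_interior _ _) H.
have c0 : 0 < F x / 2 by rewrite divr_gt0.
have [i1 i2] := @integrable_box n x r (F x / 2) (ltW r0).
apply: (@lt_le_trans _ _ (F x / 2 * (2 * r) ^+ n)).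
  by rewrite mulr_gt0// exprn_gt0// mulr_gt0.
rewrite -i2; apply: le_Rintegral => //; first exact: ccont_integrable.
move=> t _; rewrite indicE; have [tb|tb] := pselect (box x r (rowt t)).
  rewrite mem_set// mulr1 ltW//.
  by have /interior_subset := rP _ tb.
by rewrite memNset// mulr0.
Qed.

Definition C1c n (F : 'rV[R]_n -> R) := ccont F /\
  forall i, (forall x, derivable F x (basis_vec R i)) /\ ccont (partial i F).

Lemma integral_derivative_eq0 (f g : R -> R) (r : R) : continuous g ->
  (forall x : R, is_derive x 1 f (g x)) ->
  (forall x : R, r < `|x| -> f x = 0 /\ g x = 0) ->
  (\int[lebesgue_measure]_x (g x)%:E = 0)%E.
Proof.
move=> cg df fg0.
pose s := `|r| + 1.
have rs : r < s by rewrite (le_lt_trans (ler_norm r))// ltrDl.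
have s0 : 0 < s by rewrite ltr_wpDl.
have -> : (\int[lebesgue_measure]_x (g x)%:E = 
    \int[lebesgue_measure]_(x in `[(- s)%R, s%R]%classic) (g x)%:E)%E.
  rewrite [RHS]integral_mkcond; apply: eq_integral => x _; rewrite patchE.
  case: ifPn => // xs; suff -> : g x = 0 by [].
  apply: (fg0 x _).2; apply: lt_le_trans rs _; rewrite leNgt; apply: contra xs.
  by rewrite inE/= in_itv/= ltr_norml => /andP[/ltW-> /ltW->].
have cf : continuous f.
  by move=> x; have [? _] := df x; exact/differentiable_continuous/derivable1_diffP.
rewrite (@continuous_FTC2 R g f (- s) s).
- have [-> _] := fg0 s (lt_le_trans rs (ler_norm _)).
  have fs : r < `|- s| by rewrite normrN (lt_le_trans rs (ler_norm _)).
  by have [-> _] := fg0 _ fs; rewrite subee.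
- by rewrite gtrN.
- exact: continuous_subspaceT.
- split.
  + by move=> x _; have [] := df x.
  + exact/cvg_at_right_filter/cf.
  + exact/cvg_at_left_filter/cf.
- by move=> x _; have [? <-] := df x; rewrite derive1E.
Qed.

Lemma row_mx_continuous m n (c : 'rV[R]_m) :
  continuous (fun y : 'rV[R]_n => row_mx c y : 'rV[R]_(m + n)).
Proof.
move=> y A /nbhs_ballP[e /= e0 eA]; apply/nbhs_ballP; exists e => //= z yz.
apply: eA; split => // i k; rewrite !mxE; case: splitP => j _; first exact: ballxx.
by rewrite (ord1 i); exact: (yz.2 0 j).
Qed.

Lemma ccont_row_mx n (F : 'rV[R]_(1 + n) -> R) (c : 'rV[R]_1) : ccont F ->
  ccont (fun y : 'rV[R]_n => F (row_mx c y)).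
Proof.
move=> [cF [r Fr]]; split.
  by move=> y; apply: (@continuous_comp _ _ _ (row_mx c) F);
    [exact: (@row_mx_continuous 1 n c y)|exact: cF].
exists r => y H; apply: Fr => H'; apply: H => k.
by have := H' (rshift 1 k); rewrite !mxE; case: splitP => j; [rewrite ord1|move=> /= /eqP; rewrite eqn_add2l => /eqP /val_inj ->].
Qed.

(** Along the head coordinate this is the fundamental theorem of calculus on an interval larger than
    the support. Along any other coordinate the head is frozen and the induction hypothesis applies
    to the slice. *)
Lemma Jint_partial n (F : 'rV[R]_n -> R) a : C1c F -> Jint (partial a F) = 0.
Proof.
elim: n F a => [F []//|n IH] F a [Fc FC1].
have [dF cdF] := FC1 a.
apply: EFin_inj; have [E1 E2] := @Jint_S R n _ cdF.
case: (unliftP 0 a) => [j aj|a0].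
  rewrite E2 integral0_eq// => x _.
  pose c : 'rV[R]_1 := \row__ x.
  pose Fx (y : 'rV[R]_n) : R := F (row_mx c y : 'rV[R]_(1 + n)).
  have lim_eq (i : 'I_n) (y : 'rV[R]_n) : (fun h : R => h^-1 *: ((Fx \o shift y) (h *: basis_vec R i) - Fx y)) =
     (fun h : R => h^-1 *: ((F \o shift (row_mx c y : 'rV[R]_(1 + n))) (h *: basis_vec R (lift 0 i)) - F (row_mx c y : 'rV[R]_(1 + n)))).
    apply/funext => h /=; rewrite /Fx; congr (_ *: (F _ - _)).
    apply/rowP => k; rewrite !mxE; case: splitP => u ku.
      have -> : k = 0 by apply: val_inj; rewrite /= ku ord1.
      by rewrite (_ : (0 == lift 0 i) = false)// andbF mulr0 add0r.
    have -> : k = lift 0 u by apply: val_inj; rewrite /= ku.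
    by rewrite !mxE (inj_eq lift_inj).
  have dE i y : partial i Fx y = partial (lift 0 i) F (row_mx c y).
    by rewrite /partial /derive lim_eq.
  have C1x : C1c Fx.
    split; first exact: (ccont_row_mx c Fc).
    move=> i; have [d1 d2] := FC1 (lift 0 i); split.
      by move=> y; rewrite /derivable lim_eq; exact: d1.
    have -> : partial i Fx = fun y => partial (lift 0 i) F (row_mx c y : 'rV[R]_(1 + n)).
      by apply/funext => y; exact: dE.
    exact: (ccont_row_mx c d2).
  transitivity ((Jint (partial j Fx))%:E); last by rewrite IH.
  rewrite /Jint /Rintegral fineK.
    by apply: eq_integral => t _; rewrite dE aj.
  apply: integrable_fin_num => //.
  exact: (ccont_integrable (C1x.2 j).2).
rewrite E1 integral0_eq// => t _.
pose b : 'rV[R]_(1 + n) := row_mx 0 (rowt t).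
have bE x : row_mx (\row__ x) (rowt t) = b + x *: basis_vec R (0 : 'I_(1 + n)) :> 'rV[R]_(1 + n).
  apply/rowP => k; rewrite !mxE; case: splitP => u ku.
    have -> : k = 0 by apply: val_inj; rewrite /= ku ord1.
    by rewrite !mxE add0r mulr1.
  have -> : k = lift 0 u by apply: val_inj; rewrite /= ku.
  by rewrite andbF mulr0 addr0.
have [r Fr] := Fc.2; have [r' Fr'] := cdF.2.
apply: (@integral_derivative_eq0
  (fun x => F (b + x *: basis_vec R (0 : 'I_(1 + n)))) _ (`|r| + `|r'|)).
- under eq_fun do rewrite bE.
  have ch : continuous (fun x : R => b + x *: basis_vec R (0 : 'I_(1 + n))).
    by move=> x; apply: cvgD; [exact: cvg_cst|exact: scalel_continuous].
  by move=> x; exact: (@continuous_comp _ _ _ _ (partial a F) x (ch x) (cdF.1 _)).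
- move=> x; rewrite bE a0; apply: is_derive_line.
  by rewrite -a0; exact: dF.
- move=> x xr; have H s : s <= `|r| + `|r'| -> ~ box 0 s (b + x *: basis_vec R (0 : 'I_(1 + n))).
    move=> sr /(_ 0); rewrite -bE !mxE; case: splitP => // u _.
    rewrite mxE subr0 => /le_trans /(_ sr); rewrite leNgt xr.
    by [].
  split; first by apply/Fr/H; rewrite (le_trans (ler_norm _))// lerDl.
  by rewrite bE; apply/Fr'/H; rewrite (le_trans (ler_norm _))// lerDr.
Qed.

End JintTheory.

(** * Extension by zero of functions supported in an open set *)

Section Extension.
Variables (R : realType) (d : nat).
Implicit Types (U K : set 'rV[R]_d) (f g : 'rV[R]_d -> R).

(** Functions read in a chart carry junk values outside of its codomain; the extension by zero makes
    them integrable over the whole space. *)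
Definition ext U f x : R := if `[< U x >] then f x else 0.

Lemma extE U f x : U x -> ext U f x = f x.
Proof. by rewrite /ext => Ux; case: asboolP. Qed.

Lemma ext_out U f x : ~ U x -> ext U f x = 0.
Proof. by rewrite /ext => Ux; case: asboolP. Qed.

Definition csup U f := exists K, [/\ compact K, K `<=` U &
  forall x, U x -> ~ K x -> f x = 0].

(** The space is covered by two open sets: on [U] the extension is [f], off the compact support it
    is zero. Local properties of the extension are checked on each of them separately. *)
Lemma csup_ext U f : open U -> csup U f ->
  exists K, [/\ open (~` K), U `|` ~` K = setT & forall x, (~` K) x -> ext U f x = 0].
Proof.
move=> oU [K [cK KU fK]]; exists K; split.
- by rewrite openC; apply: compact_closed.
- by apply/seteqP; split => // x _; have [/KU|] := pselect (K x); [left|right].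
- move=> x nK; have [Ux|nU] := pselect (U x); first by rewrite extE// fK.
  by rewrite ext_out.
Qed.

Lemma csup_bounded U f : csup U f ->
  exists r, forall x, ~ box 0 r x -> ext U f x = 0.
Proof.
move=> [K [cK KU fK]]; have [r [_ rK]] := compact_bounded cK.
exists (`|r| + 1) => x H; have [Kx|Kx] := pselect (K x).
  exfalso; apply: H; apply/box_norm; first by rewrite addr_ge0.
  by rewrite subr0; apply: rK => //; rewrite (le_lt_trans (ler_norm r))// ltrDl.
by have [Ux|Ux] := pselect (U x); [rewrite extE// fK|rewrite ext_out].
Qed.

Lemma near_ext U f x : open U -> U x -> \forall y \near x, f y = ext U f y.
Proof.
move=> oU Ux; have : nbhs x U by exact: open_nbhs_nbhs.
by apply: filterS => y Uy; rewrite extE.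
Qed.

Lemma near_open U x : open U -> U x -> \forall y \near x, U y.
Proof. by move=> oU Ux; exact: open_nbhs_nbhs. Qed.

Lemma near_continuous f g x : (\forall y \near x, f y = g y) ->
  {for x, continuous f} -> {for x, continuous g}.
Proof.
move=> e cf; rewrite /prop_for /continuous_at -(nbhs_singleton e).
exact: cvg_trans (@near_eq_cvg _ _ _ (nbhs_filter x) f g e) cf.
Qed.

Lemma ext_ccont U f : open U -> csup U f ->
  (forall x, U x -> {for x, continuous f}) -> ccont (ext U f).
Proof.
move=> oU sf cf; split; last exact: csup_bounded.
have [K [oK UK fK]] := csup_ext oU sf.
move=> x; have : (U `|` ~` K) x by rewrite UK.
case=> [Ux|Kx]; first exact: near_continuous (near_ext f oU Ux) (cf x Ux).
apply: near_continuous (@cst_continuous _ _ 0 x).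
by apply: filterS (near_open oK Kx) => y /fK ->.
Qed.

Lemma smooth_ext U f : open U -> csup U f -> smooth_on U f ->
  smooth_on setT (ext U f).
Proof.
move=> oU sf cf; have [K [oK UK fK]] := csup_ext oU sf.
apply: smooth_on_local => x _; have : (U `|` ~` K) x by rewrite UK.
case=> [Ux|Kx].
  by exists U => //; apply: eq_smooth_on cf => // y /set_mem Uy; rewrite extE.
exists (~` K) => //; apply: eq_smooth_on (smooth_on_cst 0 oK) => //.
by move=> y /set_mem /fK ->.
Qed.

Lemma partial_ext U f i : open U -> csup U f ->
  partial i (ext U f) = ext U (partial i f).
Proof.
move=> oU sf; have [K [oK UK fK]] := csup_ext oU sf.
apply/funext => x; have [Ux|nU] := pselect (U x).
  by rewrite extE//; apply/esym/near_eq_derive; exact: near_ext.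
rewrite ext_out//; have : (U `|` ~` K) x by rewrite UK.
case=> // Kx; rewrite -(derive_cst (0 : R) x (basis_vec R i)).
by apply: near_eq_derive; apply: filterS (near_open oK Kx) => y /fK ->.
Qed.

Lemma csup_partial U f i : open U -> csup U f -> csup U (partial i f).
Proof.
move=> oU [K [cK KU fK]]; exists K; split => // x Ux Kx.
rewrite -(derive_cst (0 : R) x (basis_vec R i)).
apply: near_eq_derive.
have oK : open (~` K) by rewrite openC; apply: compact_closed.
by apply: filterS (near_open (openI oU oK) (conj Ux Kx)) => y [Uy /fK ->].
Qed.

Lemma csupMl U f g : csup U f -> csup U (fun x => f x * g x).
Proof. by move=> [K [cK KU fK]]; exists K; split => // x Ux /fK ->//; rewrite mul0r. Qed.

Lemma csupMr U f g : csup U g -> csup U (fun x => f x * g x).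
Proof. by move=> [K [cK KU fK]]; exists K; split => // x Ux /fK ->//; rewrite mulr0. Qed.

Lemma csupD U f g : csup U f -> csup U g -> csup U (fun x => f x + g x).
Proof.
move=> [K [cK KU fK]] [K' [cK' KU' fK']]; exists (K `|` K'); split.
- exact: compactU.
- by move=> x []; [exact: KU|exact: KU'].
- by move=> x Ux /not_orP[/fK -> // /fK' ->//]; rewrite addr0.
Qed.

Lemma csup_sum U (I : Type) (s : seq I) (F : I -> 'rV[R]_d -> R) :
  (forall i, csup U (F i)) -> csup U (fun x => \sum_(i <- s) F i x).
Proof.
move=> sF; elim: s => [|i s IH].
  by exists set0; split => // [|x _ _]; [exact: compact0|rewrite big_nil].
by under eq_fun do rewrite big_cons; exact: csupD.
Qed.

Lemma Jint_div U f i : open U -> csup U f -> smooth_on U f ->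
  Jint (ext U (partial i f)) = 0.
Proof.
move=> oU sf sm; rewrite -partial_ext//; apply: Jint_partial.
have sE := smooth_ext oU sf sm.
split; first by apply: ext_ccont => // x Ux; have [] := sm [::] x Ux.
move=> j; split; first by move=> x; have [_] := sE [::] x I; exact.
rewrite partial_ext//; apply: ext_ccont => //; first exact: csup_partial.
by move=> x Ux; have [] := sm [:: j] x Ux.
Qed.

End Extension.

Section PointwiseCalculus.
Variables (R : realType) (d : nat) (U : set 'rV[R]_d).
Hypothesis oU : open U.
Implicit Types (f g : 'rV[R]_d -> R).

Lemma smooth_continuous f x : smooth_on U f -> U x -> {for x, continuous f}.
Proof. by move=> sf Ux; have [] := sf [::] x Ux. Qed.

Lemma smooth_derivable f x i : smooth_on U f -> U x -> derivable f x (basis_vec R i).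
Proof. by move=> sf Ux; have [] := sf [::] x Ux. Qed.

Lemma smooth_on_mul f g : smooth_on U f -> smooth_on U g ->
  smooth_on U (fun x => f x * g x).
Proof. exact: smooth_onM. Qed.

Lemma smooth_on_add f g : smooth_on U f -> smooth_on U g ->
  smooth_on U (fun x => f x + g x).
Proof. exact: smooth_onD. Qed.

Lemma partialM f g i x : smooth_on U f -> smooth_on U g -> U x ->
  partial i (fun y => f y * g y) x = f x * partial i g x + g x * partial i f x.
Proof.
move=> sf sg Ux; rewrite /partial (@deriveM _ _ f g)//; exact: smooth_derivable.
Qed.

Lemma partialD f g i x : smooth_on U f -> smooth_on U g -> U x ->
  partial i (fun y => f y + g y) x = partial i f x + partial i g x.
Proof.
move=> sf sg Ux; rewrite /partial (@deriveD _ _ _ f g)//; exact: smooth_derivable.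
Qed.

Lemma smooth_on_bigsum (I : Type) (s : seq I) (F : I -> 'rV[R]_d -> R) :
  (forall i, smooth_on U (F i)) -> smooth_on U (fun x => \sum_(i <- s) F i x).
Proof.
move=> sF; elim: s => [|i s IH].
  by under eq_fun do rewrite big_nil; exact: smooth_on_cst.
by under eq_fun do rewrite big_cons; exact: smooth_on_add.
Qed.

Lemma smooth_on_bigprod (I : Type) (s : seq I) (F : I -> 'rV[R]_d -> R) :
  (forall i, smooth_on U (F i)) -> smooth_on U (fun x => \prod_(i <- s) F i x).
Proof.
move=> sF; elim: s => [|i s IH].
  by under eq_fun do rewrite big_nil; exact: smooth_on_cst.
by under eq_fun do rewrite big_cons; exact: smooth_on_mul.
Qed.

Lemma partial_bigsum (I : Type) (s : seq I) (F : I -> 'rV[R]_d -> R) i x :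
  (forall j, smooth_on U (F j)) -> U x ->
  partial i (fun x => \sum_(j <- s) F j x) x = \sum_(j <- s) partial i (F j) x.
Proof.
move=> sF Ux; elim: s => [|j s IH].
  by under eq_fun do rewrite big_nil; rewrite big_nil /partial derive_cst.
under eq_fun do rewrite big_cons.
by rewrite big_cons partialD ?IH//; exact: smooth_on_bigsum.
Qed.

Lemma smooth_on_det n (A : 'rV[R]_d -> 'M[R]_n) :
  (forall a b, smooth_on U (fun x => A x a b)) -> smooth_on U (fun x => \det (A x)).
Proof.
move=> sA; apply: smooth_on_bigsum => s; apply: smooth_onZ => //.
exact: smooth_on_bigprod.
Qed.

Lemma smooth_on_invmx n (A : 'rV[R]_d -> 'M[R]_n) :
  (forall a b, smooth_on U (fun x => A x a b)) ->
  (forall x, U x -> A x \in unitmx) ->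
  forall a b, smooth_on U (fun x => invmx (A x) a b).
Proof.
move=> sA uA a b.
have : smooth_on U (fun x => (\det (A x))^-1 * cofactor (A x) b a).
  apply: smooth_on_mul.
    apply: smooth_on_inv => //; last exact: smooth_on_det.
    by move=> x /uA; rewrite unitmxE unitfE.
  apply: smooth_onZ => //; apply: smooth_on_det => i j.
  by under eq_fun do rewrite !mxE; exact: sA.
apply: eq_smooth_on => // x /set_mem /uA Ax.
by rewrite /invmx Ax !mxE.
Qed.

End PointwiseCalculus.

(** * The Laplacian of a metric on an open set *)

Section LocalMetric.
Variables (R : realType) (d : nat) (U : set 'rV[R]_d) (G : 'rV[R]_d -> 'M[R]_d).
Hypothesis oU : open U.
Hypothesis sG : forall a b, smooth_on U (fun x => G x a b).
Hypothesis symG : forall x, U x -> (G x)^T = G x.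
Hypothesis posG : forall x, U x -> posdef (G x).
Implicit Types (f p u : 'rV[R]_d -> R).

Definition dens (x : 'rV[R]_d) : R := Num.sqrt (\det (G x)).

(** A component of the gradient of [u] weighted by the volume density; the Laplacian is minus its
    coordinate divergence, divided by the density. *)
Definition flux u a : 'rV[R]_d -> R :=
  fun y => dens y * \sum_b invmx (G y) a b * partial b u y.

Definition lap u : 'rV[R]_d -> R :=
  fun x => - ((dens x)^-1 * \sum_a partial a (flux u a) x).

(* The inner product of the gradients of p and u. *)
Definition Gam p u : 'rV[R]_d -> R :=
  fun x => \sum_a \sum_b invmx (G x) a b * partial a p x * partial b u x.

Lemma dens_gt0 x : U x -> 0 < dens x.
Proof. by move=> Ux; rewrite sqrtr_gt0; apply: posdef_det_gt0; [exact: symG|exact: posG]. Qed.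

Lemma dens_ge0 x : 0 <= dens x.
Proof. exact: sqrtr_ge0. Qed.

Lemma smooth_dens : smooth_on U dens.
Proof.
apply: smooth_on_sqrt => //; last exact: smooth_on_det.
by move=> x Ux; apply: posdef_det_gt0; [exact: symG|exact: posG].
Qed.

Lemma smooth_metric_inv a b : smooth_on U (fun x => invmx (G x) a b).
Proof.
by apply: smooth_on_invmx => // x Ux; apply: posdef_unit; [exact: symG|exact: posG].
Qed.

Lemma smooth_flux u a : smooth_on U u -> smooth_on U (flux u a).
Proof.
move=> su; apply: (smooth_on_mul oU); first exact: smooth_dens.
apply: (smooth_on_bigsum oU) => b; apply: (smooth_on_mul oU).
  exact: smooth_metric_inv.
exact: smooth_on_partial.
Qed.

Lemma smooth_lap u : smooth_on U u -> smooth_on U (lap u).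
Proof.
move=> su; have : smooth_on U (fun x => (-1) * ((dens x)^-1 * \sum_a partial a (flux u a) x)).
  apply: (smooth_onZ _ oU); apply: (smooth_on_mul oU).
    apply: (smooth_on_inv oU _ smooth_dens).
    by move=> x Ux; rewrite gt_eqF// dens_gt0.
  by apply: (smooth_on_bigsum oU) => a; apply: smooth_on_partial; exact: smooth_flux.
by apply: eq_smooth_on => // x _; rewrite mulN1r.
Qed.

Lemma smooth_Gam p u : smooth_on U p -> smooth_on U u -> smooth_on U (Gam p u).
Proof.
move=> sp su; apply: (smooth_on_bigsum oU) => a; apply: (smooth_on_bigsum oU) => b.
apply: (smooth_on_mul oU); last exact: smooth_on_partial.
apply: (smooth_on_mul oU); last exact: smooth_on_partial.
exact: smooth_metric_inv.
Qed.

Lemma Gam_sym p u x : U x -> Gam p u x = Gam u p x.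
Proof.
move=> Ux; rewrite /Gam exchange_big/=; apply: eq_bigr => a _.
apply: eq_bigr => b _; rewrite mulrAC; congr (_ * _ * _).
by rewrite -[in LHS](invmx_sym (symG Ux)) mxE.
Qed.

Lemma Gam_ge0 p x : U x -> 0 <= Gam p p x.
Proof.
move=> Ux; have [B BE] := posdef_inv_factor (symG Ux) (posG Ux).
rewrite /Gam BE.
have -> : \sum_a \sum_b (B *m B^T) a b * partial a p x * partial b p x =
    \sum_k (\sum_a B a k * partial a p x) ^+ 2.
  under [RHS]eq_bigr do rewrite expr2 mulr_suml.
  rewrite [RHS]exchange_big/=; apply: eq_bigr => a _.
  under [RHS]eq_bigr do rewrite mulr_sumr.
  rewrite [RHS]exchange_big/=; apply: eq_bigr => b _.
  rewrite mxE !mulr_suml; apply: eq_bigr => k _; rewrite mxE; ring.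
by apply: sumr_ge0 => k _; exact: sqr_ge0.
Qed.

Lemma divergence_product p u x : smooth_on U p -> smooth_on U u -> U x ->
  \sum_a partial a (fun y => p y * flux u a y) x =
  dens x * Gam p u x - dens x * (p x * lap u x).
Proof.
move=> sp su Ux.
under eq_bigr => a _ do rewrite (partialM a sp (smooth_flux a su) Ux).
rewrite big_split/= addrC; congr (_ + _).
  rewrite /Gam mulr_sumr; apply: eq_bigr => a _.
  rewrite /flux -mulrA; congr (_ * _); rewrite mulr_suml.
  by apply: eq_bigr => b _; rewrite mulrAC.
rewrite -mulr_sumr /lap; field.
by rewrite gt_eqF// dens_gt0.
Qed.

(** The integral of [divergence_product]: the field [p * flux u] is compactly supported as soon as
    one of the two functions is. The other one may then be a global solution of the resolvent
    equation. *)
Lemma green p u : smooth_on U p -> smooth_on U u -> csup U p \/ csup U u ->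
  Jint (ext U (fun x => p x * lap u x * dens x)) =
  Jint (ext U (fun x => Gam p u x * dens x)).
Proof.
move=> sp su cpu.
have cflux a : csup U (fun y => p y * flux u a y).
  case: cpu => [cp|cu]; first exact: csupMl.
  apply: csupMr; apply: csupMr.
  by apply: csup_sum => b; apply: csupMr; exact: csup_partial.
have sflux a : smooth_on U (fun y => p y * flux u a y).
  by apply: (smooth_on_mul oU); [exact: sp|exact: smooth_flux].
have c1 : csup U (fun x => p x * lap u x * dens x).
  apply: csupMl; case: cpu => [cp|cu]; first exact: csupMl.
  apply: csupMr.
  have H : csup U (fun x => (-1) * ((dens x)^-1 * \sum_a partial a (flux u a) x)).
    apply: csupMr; apply: csupMr; apply: csup_sum => a; apply: csup_partial => //.
    apply: csupMr; apply: csup_sum => b; apply: csupMr; exact: csup_partial.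
  by move: H; congr csup; apply/funext => x; rewrite mulN1r.
have c2 : csup U (fun x => Gam p u x * dens x).
  apply: csupMl; apply: csup_sum => a; apply: csup_sum => b.
  case: cpu => [cp|cu]; last by apply: csupMr; exact: csup_partial.
  by apply: csupMl; apply: csupMr; exact: csup_partial.
have s1 : smooth_on U (fun x => p x * lap u x * dens x).
  apply: (smooth_on_mul oU); last exact: smooth_dens.
  by apply: (smooth_on_mul oU); [exact: sp|exact: smooth_lap].
have s2 : smooth_on U (fun x => Gam p u x * dens x).
  by apply: (smooth_on_mul oU); [exact: smooth_Gam|exact: smooth_dens].
have e1 : ccont (ext U (fun x => p x * lap u x * dens x)).
  by apply: ext_ccont => // x; exact: smooth_continuous.
have e2 : ccont (ext U (fun x => Gam p u x * dens x)).
  by apply: ext_ccont => // x; exact: smooth_continuous.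
have e3 a : ccont (ext U (partial a (fun y => p y * flux u a y))).
  apply: ext_ccont => //; first exact: csup_partial.
  by move=> x; exact: (smooth_continuous (smooth_on_partial a (sflux a))).
have : Jint (fun x => \sum_a ext U (partial a (fun y => p y * flux u a y)) x) = 0.
  rewrite Jint_sum//; apply: big1 => a _; exact: (Jint_div a oU (cflux a) (sflux a)).
have -> : (fun x => \sum_a ext U (partial a (fun y => p y * flux u a y)) x) =
   (fun x => ext U (fun x => Gam p u x * dens x) x +
     (-1) * ext U (fun x => p x * lap u x * dens x) x).
  apply/funext => x; have [Ux|nU] := pselect (U x); last first.
    by rewrite !ext_out// mulr0 addr0; apply: big1 => a _; rewrite ext_out.
  rewrite !extE//; under eq_bigr do rewrite extE//.
  by rewrite divergence_product//; ring.
rewrite JintD//; last exact: ccontZ.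
by rewrite JintZ// mulN1r => /subr0_eq ->.
Qed.

Lemma derive_grad f x v : smooth_on U f -> U x ->
  derivable f x v /\ 'D_v f x = \sum_i v 0 i * partial i f x.
Proof.
move=> sf Ux; have [df dE] := smooth_on_is_diff oU sf Ux.
split; first exact: diff_derivable.
by rewrite deriveE// dE mxE; apply: eq_bigr => i _; rewrite mxE.
Qed.

(** If [c] was positive, [dh] would be positive just to the right of 0, and the mean value theorem
    would produce a value of [h] above [h 0]. *)
Lemma second_derivative_max (h dh : R -> R) (c e : R) : 0 < e ->
  (forall t : R, `|t| < e -> is_derive t 1 h (dh t)) ->
  dh 0 = 0 -> is_derive (0 : R) 1 dh c ->
  (forall t : R, `|t| < e -> h t <= h 0) -> c <= 0.
Proof.
move=> e0 hd dh0 [ddh dhc] hmax; rewrite leNgt; apply/negP => c0.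
have : \forall t \near (0 : R)^', c / 2 < t^-1 * dh t.
  have : (fun t : R => t^-1 *: ((dh \o shift 0) (t *: 1) - dh 0)) t @[t --> 0^'] --> c.
    by rewrite -dhc.
  move=> /cvgr_gt /(_ (c / 2)); have -> : c / 2 < c by rewrite ltr_pdivrMr// ltr_pMr// ltr1n.
  move=> /(_ isT); apply: filterS => t.
  by rewrite /= dh0 subr0 [t%:A]mulr1 addr0.
rewrite /dnbhs /within/= => /nbhs_ballP[r /= r0 rP].
pose t := Num.min e r / 2.
have m0 : 0 < Num.min e r by rewrite lt_min e0 r0.
have t0 : 0 < t by rewrite divr_gt0.
have tm : t < Num.min e r by rewrite ltr_pdivrMr// ltr_pMr// ltr1n.
have [te tr] : t < e /\ t < r by move: tm; rewrite lt_min => /andP[].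
have hd' s : 0 <= s <= t -> is_derive s 1 h (dh s).
  by move=> /andP[s0 st]; apply: hd; rewrite ger0_norm// (le_lt_trans st).
have [s /andP[s0 st] hs] : exists2 s, 0 < s < t & h t - h 0 = dh s * (t - 0).
  have [||s sI hs] := @MVT R h dh 0 t t0.
  - by move=> s; rewrite in_itv/= => /andP[s0 st]; apply: hd'; rewrite !ltW.
  - apply: continuous_in_subspaceT => s; rewrite inE/= in_itv/= => /hd' [ds _].
    exact/differentiable_continuous/derivable1_diffP.
  - by exists s => //; move: sI; rewrite in_itv.
have : 0 < dh s.
  have := rP s; rewrite -ball_normE/= sub0r normrN gtr0_norm// => /(_ (lt_trans st tr)).
  rewrite gt_eqF// => /(_ isT) H.
  have := lt_trans (divr_gt0 c0 (ltr0n R 2)) H.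
  by rewrite pmulr_rgt0// invr_gt0.
have := hmax t; rewrite gtr0_norm// => /(_ te).
rewrite -subr_le0 hs subr0 pmulr_lle0// => H1 H2.
by have := lt_le_trans H2 H1; rewrite ltxx.
Qed.

(* The inverse metric is a sum of squares of vectors, and the second derivatives
   along each of them are nonpositive at a maximum. *)
Lemma lap_max u x : smooth_on U u -> U x -> (forall y, U y -> u y <= u x) ->
  0 <= lap u x.
Proof.
move=> su Ux umax.
have [r r0 rU] : exists2 r, 0 < r & ball x r `<=` U.
  by have /nbhs_ballP[r r0 rU] := near_open oU Ux; exists r.
pose H a b := partial a (partial b u) x.
have lineU v : exists2 e, 0 < e & forall t : R, `|t| < e -> U (x + t *: v).
  exists (r / (`|v| + 1)); first by rewrite divr_gt0// ltr_wpDl.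
  move=> t; rewrite ltr_pdivlMr ?ltr_wpDl// => tv; apply: rU.
  rewrite -ball_normE/= opprD addNKr normrN normrZ.
  by apply: le_lt_trans tv; rewrite ler_wpM2l// lerDl.
have key v : 'D_v u x = 0 /\ \sum_a \sum_b v 0 a * v 0 b * H a b <= 0.
  have [e e0 eU] := lineU v.
  pose D y := \sum_b v 0 b * partial b u y.
  have sD : smooth_on U D.
    by apply: (smooth_on_bigsum oU) => b; apply: (smooth_onZ _ oU); exact: smooth_on_partial.
  have dl (t : R) : `|t| < e -> is_derive t 1 (fun t : R => u (x + t *: v)) (D (x + t *: v)).
    move=> /eU Ut; have [dv dE] := derive_grad v su Ut.
    by rewrite /D -dE; exact: is_derive_line.
  have x0 : x + 0 *: v = x by rewrite scale0r addr0.
  have umax' t : `|t| < e -> u (x + t *: v) <= u (x + 0 *: v).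
    by move=> /eU Ut; rewrite x0; exact: umax.
  have D0 : D (x + 0 *: v) = 0.
    have tI (t : R) : (t \in `]- e, e[) = (`|t| < e) by rewrite in_itv/= ltr_norml.
    have [|t|||] := @derive1_at_max R (fun t : R => u (x + t *: v)) (- e) e 0.
    - by rewrite ge0_cp// ltW.
    - by rewrite tI => /dl[].
    - by rewrite tI normr0.
    - by move=> t; rewrite tI; exact: umax'.
    - by move=> _ M0; have [|_ ME] := dl 0; [rewrite normr0|rewrite -ME M0].
  have ux0 : 'D_v u x = 0 by have [_ ->] := derive_grad v su Ux; move: D0; rewrite x0.
  split=> //.
  have -> : \sum_a \sum_b v 0 a * v 0 b * H a b = 'D_v D x.
    have [_ ->] := derive_grad v sD Ux; apply: eq_bigr => a _.
    have sZ b : smooth_on U (fun y => v 0 b * partial b u y).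
      by apply: (smooth_onZ _ oU); exact: smooth_on_partial.
    rewrite /D (partial_bigsum oU _ a sZ Ux) mulr_sumr.
    apply: eq_bigr => b _; rewrite -mulrA; congr (_ * _).
    rewrite (partialM a (smooth_on_cst (v 0 b) oU) (smooth_on_partial b su) Ux).
    by rewrite /partial derive_cst mulr0 addr0.
  have [dv dvE] := derive_grad v sD Ux.
  have d0 : is_derive (0 : R) 1 (fun t : R => D (x + t *: v)) ('D_v D x).
    by have := @is_derive_line R _ _ D x v 0; rewrite x0; apply.
  exact: (@second_derivative_max (fun t : R => u (x + t *: v))
    (fun t : R => D (x + t *: v)) _ e e0 dl D0 d0 umax').
have crit a : partial a u x = 0 by have [] := key (basis_vec R a).
(* At a critical point every term that differentiates the density or the inverse metric contains a
   first derivative of [u], so only the Hessian survives. *)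
have fluxE a : partial a (flux u a) x = dens x * \sum_b invmx (G x) a b * H a b.
  have sM b : smooth_on U (fun y => invmx (G y) a b * partial b u y).
    by apply: (smooth_on_mul oU); [exact: smooth_metric_inv|exact: smooth_on_partial].
  rewrite /flux (partialM a smooth_dens (smooth_on_bigsum oU _ sM) Ux).
  rewrite [X in _ + X * _]big1 ?mul0r ?addr0; last by move=> b _; rewrite crit mulr0.
  congr (_ * _); rewrite (partial_bigsum oU _ a sM Ux); apply: eq_bigr => b _.
  rewrite (partialM a (smooth_metric_inv a b) (smooth_on_partial b su) Ux).
  by rewrite crit mul0r addr0.
have [B BE] := posdef_inv_factor (symG Ux) (posG Ux).
have -> : lap u x = - \sum_a \sum_b invmx (G x) a b * H a b.
  rewrite /lap; congr (- _); under eq_bigr do rewrite fluxE.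
  by rewrite -mulr_sumr mulKf// gt_eqF// dens_gt0.
have -> : \sum_a \sum_b invmx (G x) a b * H a b =
    \sum_k \sum_a \sum_b (\row_a B a k) 0 a * (\row_a B a k) 0 b * H a b.
  rewrite BE [RHS]exchange_big/=; apply: eq_bigr => a _.
  rewrite [RHS]exchange_big/=; apply: eq_bigr => b _.
  by rewrite mxE mulr_suml; apply: eq_bigr => k _; rewrite !mxE.
rewrite oppr_ge0; apply: sumr_le0 => k _.
by have [] := key (\row_a B a k).
Qed.

Lemma lap_linear (c : R) u p x : smooth_on U u -> smooth_on U p -> U x ->
  lap (fun y => c * u y + p y) x = c * lap u x + lap p x.
Proof.
move=> su sp Ux.
have sZ : smooth_on U (fun y => c * u y) by exact: smooth_onZ.
have pE b y : U y ->
    partial b (fun y => c * u y + p y) y = c * partial b u y + partial b p y.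
  move=> Uy; rewrite (partialD b sZ sp Uy); congr (_ + _).
  rewrite (partialM b (smooth_on_cst c oU) su Uy).
  by rewrite /partial derive_cst mulr0 addr0.
have fE a y : U y ->
    flux (fun y => c * u y + p y) a y = c * flux u a y + flux p a y.
  move=> Uy; rewrite /flux; under eq_bigr do rewrite pE// mulrDr.
  rewrite big_split/= mulrDr; congr (_ + _).
  rewrite [RHS]mulrCA; congr (_ * _); rewrite mulr_sumr.
  by apply: eq_bigr => b _; rewrite mulrCA.
have -> : lap (fun y => c * u y + p y) x =
    - ((dens x)^-1 * (c * \sum_a partial a (flux u a) x + \sum_a partial a (flux p a) x)).
  rewrite /lap; congr (- (_ * _)); rewrite mulr_sumr -big_split/=; apply: eq_bigr => a _.
  have sf := smooth_flux a su.
  have -> : c * partial a (flux u a) x = partial a (fun y => c * flux u a y) x.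
    rewrite (partialM a (smooth_on_cst c oU) sf Ux).
    by rewrite /partial derive_cst mulr0 addr0.
  rewrite -(partialD a (smooth_onZ c oU sf) (smooth_flux a sp) Ux).
  by apply: near_eq_derive; apply: filterS (near_open oU Ux) => y; exact: fE.
by rewrite /lap mulrDr opprD mulrN mulrCA.
Qed.

End LocalMetric.

(** * Integration against a measure given by a density in coordinates *)

Section DensityTransfer.
Import HBNNSimple.
Local Open Scope ereal_scope.
Context d1 d2 (T1 : measurableType d1) (T2 : measurableType d2) (R : realType).
Variables (m1 : {measure set T1 -> \bar R}) (nu : {measure set T2 -> \bar R}).
Variables (P : set T1) (D : set T2) (k : T1 -> T2) (w : T1 -> R).
Hypotheses (mP : measurable P) (mD : measurable D) (mk : measurable_fun P k).
Hypotheses (mw : measurable_fun P w) (w0 : forall t, (0 <= w t)%R).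
Hypothesis (PD : forall t, P t -> D (k t)).
Hypothesis nuE : forall S, measurable S -> S `<=` D ->
  nu S = \int[m1]_(t in P `&` k @^-1` S) (w t)%:E.

Let meas_comp (f : T2 -> \bar R) : measurable_fun setT f ->
  measurable_fun P (fun t => f (k t) * (w t)%:E).
Proof.
move=> mf; apply: emeasurable_funM; last exact/measurable_EFinP.
exact: (measurable_comp measurableT).
Qed.

Let indic_case (B : set T2) : measurable B ->
  \int[nu]_(x in D) (\1_B x)%:E = \int[m1]_(t in P) ((\1_B (k t))%:E * (w t)%:E).
Proof.
move=> mB; rewrite integral_indic// nuE; last 2 first.
- exact: measurableI.
- by move=> x [].
have -> : P `&` k @^-1` (B `&` D) = P `&` (P `&` k @^-1` B).
  by apply/seteqP; split=> t; [move=> [Pt [Bt _]]|move=> [Pt [_ Bt]]; split=> //; split=> //; exact: PD].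
rewrite integral_mkcondr; apply: eq_integral => t /set_mem Pt; rewrite patchE indicE.
have [Bt|Bt] := pselect (B (k t)).
  by rewrite !mem_set// mul1e.
by rewrite memNset ?memNset ?mul0e// => -[].
Qed.

Let nnsfun_case (h : {nnsfun T2 >-> R}) :
  \int[nu]_(x in D) (h x)%:E = \int[m1]_(t in P) ((h (k t))%:E * (w t)%:E).
Proof.
have hE x : (h x)%:E = \sum_(y \in range h) (y%:E * (\1_(h @^-1` [set y]) x)%:E).
  by rewrite fimfunE -fsumEFin.
have y0 y x : 0 <= y%:E * (\1_(h @^-1` [set y]) x)%:E.
  by rewrite -EFinM; exact: nnfun_muleindic_ge0.
under eq_integral do rewrite hE.
rewrite ge0_integral_fsum//; last first.
  by move=> y; apply: measurable_funeM; apply/measurable_EFinP; exact: measurable_indic.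
under [RHS]eq_integral.
  move=> t _; rewrite hE ge0_mule_fsuml//; over.
rewrite [RHS]ge0_integral_fsum//; last 2 first.
- move=> y; apply: (@meas_comp (fun x => y%:E * (\1_(h @^-1` [set y]) x)%:E)).
  by apply: measurable_funeM; apply/measurable_EFinP; exact: measurable_indic.
- by move=> y t _; apply: mule_ge0 => //; rewrite lee_fin.
apply: eq_fsbigr => y /set_mem [x _ <-].
have hx : (0 <= h x)%R by [].
rewrite ge0_integralZl//; last first.
  by apply/measurable_EFinP; exact: measurable_indic.
under [RHS]eq_integral do rewrite -muleA.
rewrite [RHS]ge0_integralZl//; last 2 first.
- apply: (@meas_comp (fun z => (\1_(h @^-1` [set h x]) z)%:E)).
  by apply/measurable_EFinP; exact: measurable_indic.
- by move=> z _; apply: mule_ge0; rewrite lee_fin.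
by rewrite indic_case.
Qed.

(** [nuE] is a statement on sets, which is all that [is_riemannian_volume] provides. It is extended
    to indicators, then to simple functions, then to nonnegative functions by monotone
    convergence. *)
Lemma ge0_integral_density (f : T2 -> \bar R) :
  measurable_fun setT f -> (forall x, 0 <= f x) ->
  \int[nu]_(x in D) f x = \int[m1]_(t in P) (f (k t) * (w t)%:E).
Proof.
move=> mf f0; pose h := nnsfun_approx measurableT mf.
transitivity (limn (fun n => \int[nu]_(x in D) (h n x)%:E)).
  rewrite -monotone_convergence//=.
  - apply: eq_integral => x _; apply/esym/cvg_lim => //.
    by apply: cvg_nnsfun_approx.
  - by move=> n; exact/measurable_EFinP/measurable_funTS.
  - by move=> n x _; rewrite lee_fin.
  - by move=> x _ a b ab; rewrite lee_fin; exact/lefP/nd_nnsfun_approx.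
under eq_fun do rewrite nnsfun_case.
rewrite -monotone_convergence//=.
- apply: eq_integral => t _; apply/cvg_lim => //.
  apply: cvgeZr => //; exact: cvg_nnsfun_approx.
- by move=> n; apply: (@meas_comp (EFin \o h n)); exact/measurable_EFinP.
- by move=> n x _; apply: mule_ge0; rewrite lee_fin.
- move=> t _ a b ab; apply: lee_wpmul2r; first by rewrite lee_fin.
  by rewrite lee_fin; exact/lefP/nd_nnsfun_approx.
Qed.

End DensityTransfer.

(** * Bump functions *)

Section ChainRule.
Variable R : realType.

Lemma chain_rule n d (U : set 'rV[R]_n) (V : set 'rV[R]_d) (tau : 'rV[R]_n -> 'rV[R]_d)
    (f : 'rV[R]_d -> R) x a :
  open U -> open V -> (forall c, smooth_on U (fun y => tau y 0 c)) -> smooth_on V f ->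
  U x -> V (tau x) ->
  partial a (f \o tau) x = \sum_c 'J tau x a c * partial c f (tau x).
Proof.
move=> oU oV st sf Ux Vx.
have dt : differentiable tau x.
  have -> : tau = \sum_c (fun y => tau y 0 c *: (delta_mx 0 c : 'rV[R]_d)).
    apply/funext => y; rewrite fct_sumE; apply/rowP => c.
    rewrite summxE (bigD1 c)//= !mxE !eqxx mulr1 big1 ?addr0// => e ec.
    by rewrite !mxE (eq_sym c) (negbTE ec) andbF mulr0.
  apply: differentiable_sum => c; apply: differentiableZl.
  by have [] := smooth_on_is_diff oU (st c) Ux.
have [df dfE] := smooth_on_is_diff oV sf Vx.
rewrite /partial deriveE; last exact: differentiable_comp.
rewrite diff_comp//= dfE mxE; apply: eq_bigr => c _.
rewrite [grad f (tau x) c 0]mxE; congr (_ * _).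
by rewrite -deriveE// deriveEjacobian// -rowE mxE.
Qed.

End ChainRule.

Section BumpFunction.
Variable R : realType.

(* These functions form a class closed under differentiation, see
   [is_derive_flat]; [flat 1] is the usual smooth function exp(-1/t). *)
Definition flat (p : {poly R}) (t : R) : R :=
  if 0 < t then p.[t^-1] * expR (- t^-1) else 0.

Lemma poly_bound (p : {poly R}) : exists C n, forall s, 1 <= s -> `|p.[s]| <= C * s ^+ n.
Proof.
elim/poly_ind: p => [|p c [C [n Cn]]].
  by exists 0, 0 => s _; rewrite horner0 normr0 mul0r.
exists (C + `|c|), n.+1 => s s1; rewrite hornerMXaddC.
apply: le_trans (ler_normD _ _) _; rewrite mulrDl lerD//.
  by rewrite normrM exprSr mulrA (ger0_norm (le_trans ler01 s1)) ler_wpM2r// ?Cn// (le_trans ler01 s1).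
by rewrite ler_peMr// exprn_ege1.
Qed.

(** The exponential is the [n.+1]-th power of exp(s / (n + 1)), which is at least s / (n + 1). *)
Lemma expR_ge_pow (n : nat) (s : R) : 0 <= s -> (s / n.+1%:R) ^+ n.+1 <= expR s.
Proof.
move=> s0; have sE : s = n.+1%:R * (s / n.+1%:R) by rewrite mulrC divfK.
rewrite [in leRHS]sE expRM_natl ler_pXn2r// ?nnegrE ?divr_ge0 ?expR_ge0//.
by apply: le_trans (expR_ge1Dx _); rewrite lerDr.
Qed.

(** The exponential beats every polynomial in 1/t. The exponent 2 is what differentiability at 0
    requires: one power pays for the difference quotient, the other makes it tend to zero. *)
Lemma flat_small (p : {poly R}) :
  exists2 C, 0 <= C & forall t, 0 < t -> t <= 1 -> `|flat p t| <= C * t ^+ 2.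
Proof.
have [C [n Cn]] := poly_bound p.
have [N N0 NP] : exists2 N : R, 0 <= N & forall s, 0 <= s -> s ^+ n.+3 <= N * expR s.
  exists (n.+3%:R ^+ n.+3); first exact: exprn_ge0.
  move=> s s0; have := expR_ge_pow n.+2 s0.
  by rewrite expr_div_n ler_pdivrMr ?exprn_gt0// mulrC.
exists (`|C| * N); first by rewrite mulr_ge0.
move=> t t0 t1; rewrite /flat t0 normrM (ger0_norm (expR_ge0 _)).
pose s := t^-1; have s1 : 1 <= s by rewrite invf_ge1.
have s0 : 0 < s by rewrite invr_gt0.
have tE : t = s^-1 by rewrite invrK.
rewrite -/s tE expRN exprVn ler_pdivrMr ?expR_gt0// mulrAC ler_pdivlMr ?exprn_gt0//.
apply: (@le_trans _ _ (`|C| * s ^+ n * s ^+ 2)).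
  apply: ler_wpM2r; first by rewrite exprn_ge0// ltW.
  apply: (le_trans (Cn s s1)); apply: ler_wpM2r; first by rewrite exprn_ge0// ltW.
  exact: ler_norm.
rewrite -mulrA -exprD -mulrA; apply: ler_wpM2l => //.
apply: le_trans (NP s (ltW s0)).
by rewrite ler_weXn2l// addn2.
Qed.

(** The derivative of p(1/t) exp(-1/t) is t^-2 (p - p')(1/t) exp(-1/t), hence the new polynomial. At
    0 the left side is constant and the right side is controlled by [flat_small]. *)
Lemma is_derive_flat (p : {poly R}) (t : R) :
  is_derive t 1 (flat p) (flat ('X ^+ 2 * (p - p^`())) t).
Proof.
have [t0|t0|->] := ltgtP t 0.
- have -> : flat ('X ^+ 2 * (p - p^`())) t = 0 by rewrite /flat ltNge ltW.
  apply: (@near_eq_is_derive _ _ _ (cst 0)).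
  have : \forall u \near t, u < 0 by exact: lt_nbhsl.
  by apply: filterS => u u0; rewrite /flat ltNge ltW.
- pose h u : R := p.[u^-1] * expR (- u^-1).
  apply: (@near_eq_is_derive _ _ _ h).
    have : \forall u \near t, 0 < u by exact: lt_nbhsr.
    by apply: filterS => u u0; rewrite /flat u0.
  have tn : t != 0 by rewrite gt_eqF.
  have dV : is_derive t 1 (fun u : R => u^-1) (- t ^- 2).
    have := @is_deriveV R id t 1 1 tn (is_derive_id t 1).
    by rewrite [_ *: _]mulr1.
  have dN : is_derive t 1 (fun u : R => - u^-1) (t ^- 2).
    by have := @is_deriveN _ _ _ (fun u : R => u^-1) t 1 _ dV; rewrite opprK.
  have dp : is_derive t 1 (fun u : R => p.[u^-1]) (p^`().[t^-1] * - t ^- 2).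
    exact: (@is_derive1_comp R (horner p) (fun u => u^-1)).
  have de : is_derive t 1 (fun u : R => expR (- u^-1)) (expR (- t^-1) * t ^- 2).
    exact: (@is_derive1_comp R expR (fun u => - u^-1)).
  have := is_deriveM dp de; rewrite /flat t0 => H.
  apply: (is_derive_eq (H : is_derive t (1 : R) h _)).
  change (p.[t^-1] * (expR (- t^-1) * t ^- 2) + expR (- t^-1) * (p^`().[t^-1] * - t ^- 2)
    = ('X^2 * (p - p^`())).[t^-1] * expR (- t^-1)).
  rewrite hornerM hornerXn hornerD hornerN -exprVn; ring.
- have f0 q : flat q 0 = 0 by rewrite /flat ltxx.
  have [C C0 HC] := flat_small p.
  have L : (fun k : R => k^-1 *: ((flat p \o shift 0) (k *: 1) - flat p 0)) k @[k --> 0^'] --> (0 : R).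
    apply/cvgrPdist_le => e e0.
    near=> k; rewrite /= f0 subr0 [k%:A]mulr1 addr0 sub0r normrN normrZ.
    have k0 : k != 0 by near: k; exact: nbhs_dnbhs_neq.
    have k1 : `|k| <= 1 by near: k; apply: dnbhs0_le.
    have kC : `|k| <= e / (C + 1) by near: k; apply: dnbhs0_le; rewrite divr_gt0// ltr_wpDl.
    have [kp|kn] := ltP 0 k; last by rewrite /flat ltNge kn normr0 mulr0 ltW.
    move: k1 kC; rewrite (gtr0_norm kp) => k1 kC.
    rewrite normfV (gtr0_norm kp) mulrC ler_pdivrMr//.
    apply: (le_trans (HC k kp k1)); rewrite expr2 mulrA.
    apply: ler_wpM2r; first exact: ltW.
    apply: (@le_trans _ _ ((C + 1) * k)).
      by apply: ler_wpM2r; [exact: ltW|rewrite lerDl].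
    by rewrite mulrC -ler_pdivlMr// ltr_wpDl.
  rewrite f0; split; first by apply/cvg_ex; exists 0.
  by apply/cvg_lim.
Unshelve. all: by end_near. Qed.

Lemma smooth_on_flat d (U : set 'rV[R]_d) (f : 'rV[R]_d -> R) :
  open U -> smooth_on U f -> smooth_on U (fun x => flat 1 (f x)).
Proof.
move=> oU sf; apply: (@smooth_on_comp1 R d (fun h => exists p, h = flat p) setT) => //.
  move=> _ [p ->]; exists (flat ('X ^+ 2 * (p - p^`()))) => [|t _].
    by exists ('X ^+ 2 * (p - p^`())).
  exact: is_derive_flat.
by exists 1.
Qed.

Lemma flat1_gt0 t : 0 < t -> 0 < flat 1 t.
Proof. by move=> t0; rewrite /flat t0 hornerC mul1r expR_gt0. Qed.

Lemma flat1_ge0 t : 0 <= flat 1 t.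
Proof. by have [/flat1_gt0/ltW//|t0] := ltP 0 t; rewrite /flat ltNge t0. Qed.

Lemma flat1_le0 t : t <= 0 -> flat 1 t = 0.
Proof. by move=> t0; rewrite /flat ltNge t0. Qed.

Definition bump1 (t : R) : R := flat 1 (1 + t) * flat 1 (1 - t) / (flat 1 1) ^+ 2.

Lemma bump1_0 : bump1 0 = 1.
Proof. by rewrite /bump1 addr0 subr0 -expr2 divff// expf_eq0/= gt_eqF// flat1_gt0. Qed.

Lemma bump1_ge0 t : 0 <= bump1 t.
Proof. by rewrite /bump1 divr_ge0 ?exprn_ge0 ?mulr_ge0 ?flat1_ge0. Qed.

Lemma bump1_out t : 1 <= `|t| -> bump1 t = 0.
Proof.
rewrite ler_normr => /orP[t1|t1]; rewrite /bump1.
  by rewrite (@flat1_le0 (1 - t)) ?mulr0 ?mul0r// subr_le0.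
by rewrite (@flat1_le0 (1 + t)) ?mul0r//; lra.
Qed.

Lemma smooth_on_bump1 d (U : set 'rV[R]_d) (f : 'rV[R]_d -> R) :
  open U -> smooth_on U f -> smooth_on U (fun x => bump1 (f x)).
Proof.
move=> oU sf; apply: (smooth_on_mul oU); last exact: (smooth_on_cst _ oU).
apply: (smooth_on_mul oU); apply: (smooth_on_flat oU).
  by apply: (smooth_on_add oU); [exact: (smooth_on_cst 1 oU)|exact: sf].
apply: (smooth_on_add oU); first exact: (smooth_on_cst 1 oU).
have : smooth_on U (fun x => (-1) * f x) by exact: smooth_onZ.
by apply: eq_smooth_on => // x _; rewrite mulN1r.
Qed.

Definition bump d (x : 'rV[R]_d) : R := \prod_k bump1 (x 0 k).

Lemma bump_ge0 d (x : 'rV[R]_d) : 0 <= bump x.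
Proof. by apply: prodr_ge0 => k _; exact: bump1_ge0. Qed.

Lemma bump_0 d : bump (0 : 'rV[R]_d) = 1.
Proof. by apply: big1 => k _; rewrite mxE bump1_0. Qed.

Lemma bump_out d (x : 'rV[R]_d) : ~ box 0 1 x -> bump x = 0.
Proof.
move=> H; have [k xk] : exists k, 1 < `|x 0 k|.
  apply: contrapT => N; apply: H => k; rewrite mxE subr0 leNgt.
  by apply/negP => xk; apply: N; exists k.
by rewrite /bump (bigD1 k)//= bump1_out ?mul0r// ltW.
Qed.

Lemma smooth_on_bump d n (U : set 'rV[R]_n) (f : 'rV[R]_n -> 'rV[R]_d) :
  open U -> (forall k, smooth_on U (fun x => f x 0 k)) ->
  smooth_on U (fun x => bump (f x)).
Proof.
by move=> oU sf; apply: (smooth_on_bigprod oU) => k; exact: (smooth_on_bump1 oU).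
Qed.

(** The parameter [l] is an inverse width: the support lies in [box q l^-1], while the gradient
    grows like [l]. *)
Definition sbump d (q : 'rV[R]_d) (l : R) (x : 'rV[R]_d) : R := bump (l *: (x - q)).

Lemma sbump_ge0 d (q : 'rV[R]_d) l x : 0 <= sbump q l x.
Proof. exact: bump_ge0. Qed.

Lemma sbump_center d (q : 'rV[R]_d) l : sbump q l q = 1.
Proof. by rewrite /sbump subrr scaler0 bump_0. Qed.

Lemma sbump_out d (q : 'rV[R]_d) l x : 0 < l -> ~ box q l^-1 x -> sbump q l x = 0.
Proof.
move=> l0 H; apply: bump_out => H'; apply: H => k; have := H' k.
by rewrite !mxE subr0 normrM gtr0_norm// mulrC -ler_pdivlMr// mul1r.
Qed.

Lemma smooth_on_sbump d n (U : set 'rV[R]_n) (f : 'rV[R]_n -> 'rV[R]_d) q l :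
  open U -> (forall k, smooth_on U (fun x => f x 0 k)) ->
  smooth_on U (fun x => sbump q l (f x)).
Proof.
move=> oU sf; apply: (smooth_on_bump oU) => k.
have : smooth_on U (fun x => l * (f x 0 k + - q 0 k)).
  apply: (smooth_onZ _ oU); apply: (smooth_on_add oU) => //.
  exact: (smooth_on_cst _ oU).
by apply: eq_smooth_on => // x _; rewrite !mxE.
Qed.

(** By scaling, one constant serves all centres and widths, and a derivative costs a factor [l]. The
    indicators are kept because the energy estimate records which scales contain a given point. *)
Lemma sbump_bounds d : exists2 C, 0 <= C & forall (q : 'rV[R]_d) l x, 0 < l ->
  `|sbump q l x| <= C * \1_(box q l^-1) x /\
  forall i, `|partial i (sbump q l) x| <= C * l * \1_(box q l^-1) x.
Proof.
have s1 : smooth_on setT (@bump d).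
  apply: (@smooth_on_bump d d setT id openT) => k; exact: (smooth_on_coord k openT).
have c0 : csup setT (@bump d).
  by exists (box 0 1); split => // [|x _]; [exact: compact_box|exact: bump_out].
have extT (f : 'rV[R]_d -> R) : ext setT f = f.
  by apply/funext => x; rewrite extE.
have [C0 C00 HC0] : exists2 C, 0 <= C & forall x : 'rV[R]_d, `|bump x| <= C.
  apply: ccont_bounded; rewrite -[@bump d]extT; apply: (ext_ccont openT c0) => x.
  exact: (smooth_continuous s1).
have Ci i : exists C, 0 <= C /\ forall x : 'rV[R]_d, `|partial i (@bump d) x| <= C.
  have [C ? ?] : exists2 C, 0 <= C & forall x : 'rV[R]_d, `|partial i (@bump d) x| <= C.
    apply: ccont_bounded; rewrite -[partial _ _]extT; 
    apply: (ext_ccont openT (csup_partial i openT c0)).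
    by move=> x Ux; exact: (smooth_continuous (smooth_on_partial i s1)).
  by exists C.
have Cs i : 0 <= sval (cid (Ci i)) by have [] := svalP (cid (Ci i)).
pose C := C0 + \sum_i sval (cid (Ci i)).
have CC0 : C0 <= C by rewrite lerDl sumr_ge0.
exists C => [|q l x l0]; first by rewrite addr_ge0// sumr_ge0.
have pE i : partial i (sbump q l) x = l * partial i (@bump d) (l *: (x - q)).
  have saff c : smooth_on setT (fun y : 'rV[R]_d => (l *: (y - q)) 0 c).
    have : smooth_on setT (fun y : 'rV[R]_d => l * (y 0 c + - q 0 c)).
      apply: (smooth_onZ _ openT); apply: (smooth_on_add openT).
        exact: (smooth_on_coord c openT).
      exact: (smooth_on_cst _ openT).
    by apply: (eq_smooth_on openT) => y _; rewrite !mxE.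
  have dlin : 'J (fun y : 'rV[R]_d => l *: (y - q)) x = l%:M.
    have D : is_diff x (l \*: (id - cst q)) (l \*: (id - 0)) by exact: _.
    have DE : 'd (fun y : 'rV[R]_d => l *: (y - q)) x = (l \*: (id - 0)) :> (_ -> _).
      exact: (@diff_val _ _ _ _ _ _ _ D).
    apply/matrixP => a b; rewrite mxE DE !mxE.
    by rewrite subr0 eqxx /= eq_sym mulr_natr.
  have := @chain_rule R d d setT setT (fun y => l *: (y - q)) (@bump d) x i
    openT openT saff s1 I I.
  rewrite dlin => E; rewrite [LHS]E (bigD1 i)//= mxE eqxx mulr1n big1 ?addr0// => c ci.
  by rewrite mxE eq_sym (negbTE ci) mulr0n mul0r.
have [xb|xb] := pselect (box q l^-1 x).
  rewrite indicE mem_set// !mulr1; split=> [|i]; first exact: le_trans (HC0 _) CC0.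
  rewrite pE normrM gtr0_norm// mulrC; apply: ler_wpM2r; first exact: ltW.
  have [_ /(_ (l *: (x - q))) H] := svalP (cid (Ci i)); apply: le_trans H _.
  by rewrite /C (bigD1 i)//= addrCA lerDl addr_ge0// sumr_ge0.
rewrite indicE memNset// !mulr0; split=> [|i]; first by rewrite sbump_out// normr0.
suff -> : partial i (sbump q l) x = 0 by rewrite normr0.
rewrite -(derive_cst (0 : R) x (basis_vec R i)); apply: near_eq_derive.
have oB : open (~` box q l^-1) by rewrite openC; apply: compact_closed => //; exact: compact_box.
by apply: filterS (near_open oB xb) => y; exact: sbump_out.
Qed.

End BumpFunction.

(** * The Laplace-Beltrami operator *)

Section RealManifold.
Variables (R : realType) (M : ptopologicalType) (d : nat).
Variables (A : smooth_atlas R M d) (g : riemannian_metric A).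
Hypothesis hM : hausdorff_space M.
Implicit Types (i j : chart A) (u v F : M -> R) (m : M).

Definition pull i u : 'rV[R]_d -> R := fun x => u (chart_inv i x).

(** Test functions are complex, but the calculus is done on real functions; a test function is
    handled through its real and imaginary parts. *)
Definition rsmooth u := forall i, smooth_on (chart_cod i) (pull i u).

Definition msup i F := exists K, [/\ compact K, K `<=` chart_dom i &
  forall m, ~ K m -> F m = 0].

Let oD i : open (chart_dom i) := @chart_dom_open R M d A i.
Let oC i : open (chart_cod i) := @chart_cod_open R M d A i.

Lemma metric_pos i x : chart_cod i x -> posdef (g i x).
Proof. by move=> ix v v0; exact: metric_posdef. Qed.

Let sG i := @metric_smooth R M d A g i.
Let symG i := @metric_symmetric R M d A g i.
Let posG i := @metric_pos i.

Lemma pullK i u m : chart_dom i m -> pull i u (chart_map i m) = u m.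
Proof. by move=> im; rewrite /pull chart_mapK. Qed.

Lemma rsmooth_cst (c : R) : rsmooth (fun=> c).
Proof. by move=> i; exact: (smooth_on_cst c (@oC i)). Qed.

Lemma rsmoothD u v : rsmooth u -> rsmooth v -> rsmooth (fun m => u m + v m).
Proof. by move=> su sv i; exact: (smooth_on_add (@oC i) (su i) (sv i)). Qed.

Lemma rsmoothM u v : rsmooth u -> rsmooth v -> rsmooth (fun m => u m * v m).
Proof. by move=> su sv i; exact: (smooth_on_mul (@oC i) (su i) (sv i)). Qed.

Lemma rsmoothZ (c : R) u : rsmooth u -> rsmooth (fun m => c * u m).
Proof. by move=> su; exact: (rsmoothM (rsmooth_cst c) su). Qed.

Lemma rsmooth_sum (I : Type) (s : seq I) (u : I -> M -> R) :
  (forall k, rsmooth (u k)) -> rsmooth (fun m => \sum_(k <- s) u k m).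
Proof.
move=> su; elim: s => [|k s IH].
  by under eq_fun do rewrite big_nil; exact: rsmooth_cst.
by under eq_fun do rewrite big_cons; exact: rsmoothD.
Qed.

Lemma msupMl i F F' : msup i F -> msup i (fun m => F m * F' m).
Proof. by move=> [K [cK KD FK]]; exists K; split => // m /FK ->; rewrite mul0r. Qed.

Lemma msupMr i F F' : msup i F' -> msup i (fun m => F m * F' m).
Proof. by move=> [K [cK KD FK]]; exists K; split => // m /FK ->; rewrite mulr0. Qed.

Lemma msupD i F F' : msup i F -> msup i F' -> msup i (fun m => F m + F' m).
Proof.
move=> [K [cK KD FK]] [K' [cK' KD' FK']]; exists (K `|` K'); split.
- exact: compactU.
- by move=> m [/KD|/KD'].
- by move=> m /not_orP[/FK -> /FK' ->]; rewrite addr0.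
Qed.

Lemma msup_sum i (I : Type) (s : seq I) (F : I -> M -> R) :
  (forall k, msup i (F k)) -> msup i (fun m => \sum_(k <- s) F k m).
Proof.
move=> sF; elim: s => [|k s IH].
  by exists set0; split => // [|m _]; [exact: compact0|rewrite big_nil].
by under eq_fun do rewrite big_cons; exact: msupD.
Qed.

Lemma near_pull i u m : chart_dom i m ->
  \forall m' \near m, pull i u (chart_map i m') = u m'.
Proof.
move=> im; have : nbhs m (chart_dom i) by exact: open_nbhs_nbhs.
by apply: filterS => m'; exact: pullK.
Qed.

Lemma continuous_unpull i u m : chart_dom i m ->
  {for chart_map i m, continuous (pull i u)} -> {for m, continuous u}.
Proof.
move=> im cu; rewrite /prop_for /continuous_at -(pullK u im).
apply: cvg_trans (@near_eq_cvg _ _ _ (nbhs_filter m) _ _ (near_pull u im)) _.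
by apply: (@continuous_comp _ _ _ (chart_map i)) => //; exact: chart_map_continuous.
Qed.

Lemma continuous_pull i u x : chart_cod i x ->
  {for chart_inv i x, continuous u} -> {for x, continuous (pull i u)}.
Proof. by move=> ix cu; apply: continuous_comp => //; exact: chart_inv_continuous. Qed.

Lemma rsmooth_continuous u : rsmooth u -> continuous u.
Proof.
move=> su m; have [i im] := chart_cover A m.
apply: (continuous_unpull im).
exact: (smooth_continuous (su i) (chart_mapP im)).
Qed.

Lemma msup_continuous i F : msup i F ->
  (forall x, chart_cod i x -> {for x, continuous (pull i F)}) -> continuous F.
Proof.
move=> [K [cK KD FK]] cF m; have [im|im] := pselect (chart_dom i m).
  by apply: (continuous_unpull im); apply: cF; exact: chart_mapP.
have oK : open (~` K) by rewrite openC; exact: compact_closed.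
have nK : (~` K) m by move=> /KD.
have e : \forall m' \near m, cst 0 m' = F m'.
  by apply: filterS (open_nbhs_nbhs (conj oK nK)) => m' /FK ->.
rewrite /prop_for /continuous_at -(nbhs_singleton e).
apply: cvg_trans (@near_eq_cvg _ _ _ (nbhs_filter m) _ _ e) _.
exact: cst_continuous.
Qed.

Lemma csup_pull i F : msup i F -> csup (chart_cod i) (pull i F).
Proof.
move=> [K [cK KD FK]]; exists (chart_map i @` K); split.
- apply: continuous_compact => //; apply: continuous_in_subspaceT => m /set_mem Km.
  exact: chart_map_continuous (KD _ Km).
- by move=> _ [m /KD im <-]; exact: chart_mapP.
- move=> x ix Kx; apply: FK => Kx'; apply: Kx; exists (chart_inv i x) => //.
  exact: chart_invK.
Qed.

Definition rlap u m : R := laplacian_chart g (chart_at A m) (pull (chart_at A m) u)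
   (chart_map (chart_at A m) m).

Lemma chart_atP m : chart_dom (chart_at A m) m.
Proof. exact: (projT2 (cid (chart_cover A m))). Qed.

Definition mbump i (q : 'rV[R]_d) (l : R) (m : M) : R :=
  if `[< chart_dom i m >] then sbump q l (chart_map i m) else 0.

Lemma open_overlap (j k : chart A) : open (chart_cod j `&` chart_inv j @^-1` chart_dom k).
Proof.
rewrite openE => x [jx kx]; apply: filterI; first exact: open_nbhs_nbhs.
apply: (chart_inv_continuous jx); exact: open_nbhs_nbhs.
Qed.

Section MBump.
Variables (i : chart A) (q : 'rV[R]_d) (l : R).
Hypotheses (l0 : 0 < l) (qC : box q l^-1 `<=` chart_cod i).

Lemma mbump_dom m : chart_dom i m -> mbump i q l m = sbump q l (chart_map i m).
Proof. by rewrite /mbump; case: asboolP. Qed.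

Lemma mbump_ge0 m : 0 <= mbump i q l m.
Proof. by rewrite /mbump; case: ifP => // _; exact: sbump_ge0. Qed.

Lemma mbump_pull x : chart_cod i x -> pull i (mbump i q l) x = sbump q l x.
Proof. by move=> ix; rewrite /pull mbump_dom ?chart_invK//; exact: chart_invP. Qed.

Lemma compact_inv_box K : compact K -> K `<=` chart_cod i -> compact (chart_inv i @` K).
Proof.
move=> cK KC; apply: continuous_compact => //.
apply: continuous_in_subspaceT => x /set_mem Kx.
exact: chart_inv_continuous (KC _ Kx).
Qed.

Lemma mbump_supp m : ~ (chart_inv i @` box q l^-1) m -> mbump i q l m = 0.
Proof.
move=> H; rewrite /mbump; case: asboolP => // im; apply: sbump_out => // mb.
by apply: H; exists (chart_map i m) => //; exact: chart_mapK.
Qed.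

Lemma mbump_msup_in j : chart_inv i @` box q l^-1 `<=` chart_dom j -> msup j (mbump i q l).
Proof.
move=> H; exists (chart_inv i @` box q l^-1); split => //; last exact: mbump_supp.
by apply: compact_inv_box => //; exact: compact_box.
Qed.

Lemma mbump_msup : msup i (mbump i q l).
Proof. by apply: mbump_msup_in => _ [x /qC ix <-]; exact: chart_invP. Qed.

(** In another chart, near the domain of [i] the bump is a smooth function of the transition map.
    Elsewhere it vanishes in a neighbourhood, because its compact support is closed in a Hausdorff
    space. *)
Lemma mbump_smooth : rsmooth (mbump i q l).
Proof.
move=> j; apply: smooth_on_local => x jx.
have [ix|ix] := pselect (chart_dom i (chart_inv j x)).
  exists (chart_cod j `&` chart_inv j @^-1` chart_dom i) => //.
  have : smooth_on (chart_cod j `&` chart_inv j @^-1` chart_dom i)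
      (fun x => sbump q l (chart_map i (chart_inv j x))).
    apply: (smooth_on_sbump _ _ (@open_overlap j i)) => k; exact: chart_smooth.
  by apply: (eq_smooth_on (@open_overlap j i)) => y /set_mem [jy iy]; rewrite /pull mbump_dom.
pose K := chart_inv i @` box q l^-1.
have oK : open (~` K).
  by rewrite openC; apply: compact_closed => //; apply: compact_inv_box => //; exact: compact_box.
have oW : open (chart_cod j `&` chart_inv j @^-1` (~` K)).
  rewrite openE => y [jy ky]; apply: filterI; first exact: open_nbhs_nbhs.
  by apply: (chart_inv_continuous jy); exact: open_nbhs_nbhs.
exists (chart_cod j `&` chart_inv j @^-1` (~` K)).
  by split => // -[y /qC iy E]; apply: ix; rewrite -E; exact: chart_invP.
apply: (eq_smooth_on oW) (smooth_on_cst 0 oW).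
by move=> y /set_mem [jy ky]; rewrite /pull mbump_supp.
Qed.

End MBump.

Lemma Gam_mx i (p w : 'rV[R]_d -> R) x :
  Gam (g i) p w x = ((grad p x)^T *m invmx (g i x) *m grad w x) 0 0.
Proof.
rewrite /Gam exchange_big/= mxE; apply: eq_bigr => b _.
rewrite mxE mulr_suml; apply: eq_bigr => a _; rewrite !mxE; ring.
Qed.

Lemma grad_transition i j u x : rsmooth u -> chart_cod i x ->
  chart_dom j (chart_inv i x) ->
  grad (pull i u) x = 'J (chart_map j \o chart_inv i) x *m
    grad (pull j u) (chart_map j (chart_inv i x)).
Proof.
move=> su ix jx; pose tau := chart_map j \o chart_inv i.
apply/colP => a; rewrite mxE [RHS]mxE.
have -> : partial a (pull i u) x = partial a (pull j u \o tau) x.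
  apply: near_eq_derive.
  have : nbhs x (chart_cod i `&` chart_inv i @^-1` chart_dom j).
    by apply: open_nbhs_nbhs; split => //; exact: open_overlap.
  by apply: filterS => y [iy jy]; rewrite /tau /= pullK.
have := @chain_rule R d d _ (chart_cod j) tau (pull j u) x a (@open_overlap i j)
   (@oC j) (fun c => @chart_smooth _ _ _ A i j c) (su j) (conj ix jx) (chart_mapP jx).
by move=> ->; apply: eq_bigr => c _; rewrite [grad _ _ c 0]mxE.
Qed.

(** Gradients are multiplied by the Jacobian J and the metric becomes J g J^T, so the two effects
    cancel in the inverse metric. Only first derivatives are transformed. *)
Lemma Gam_transition i j u v x : rsmooth u -> rsmooth v -> chart_cod i x ->
  chart_dom j (chart_inv i x) ->
  Gam (g i) (pull i u) (pull i v) x =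
  Gam (g j) (pull j u) (pull j v) (chart_map j (chart_inv i x)).
Proof.
move=> su sv ix jx; set y := chart_map j (chart_inv i x).
have jy : chart_cod j y by exact: chart_mapP.
rewrite !Gam_mx !(@grad_transition i j)//; set J := 'J _ x.
have gE : g i x = J *m g j y *m J^T by exact: metric_compat.
have giu : g i x \in unitmx by apply: posdef_unit; [exact: symG|exact: posG].
have gju : g j y \in unitmx by apply: posdef_unit; [exact: symG|exact: posG].
have Ju : J \in unitmx by move: giu; rewrite gE !unitmx_mul => /andP[/andP[]].
set p := grad _ _; set w := grad _ _.
(* Solving [g i x *m z = J *m w] avoids inverting the triple product: cancelling J leaves
   [J^T *m z = invmx (g j y) *m w]. *)
pose z := invmx (g i x) *m (J *m w).
have gz : g i x *m z = J *m w by rewrite /z mulKVmx.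
have zE : J^T *m z = invmx (g j y) *m w.
  apply: (can_inj (mulKmx gju)); rewrite mulKVmx//.
  apply: (can_inj (mulKmx Ju)); by rewrite 2!mulmxA -gE gz.
by rewrite trmx_mul -!mulmxA -/z zE.
Qed.

Variable vol : {measure set (borel M) -> \bar R}.
Hypothesis volP : is_riemannian_volume g vol.

Lemma continuous_measurable_borel F : continuous F ->
  measurable_fun [set: borel M] (F : borel M -> R).
Proof.
move=> /continuousP cF; apply: (measurability _ (RGenOpens.measurableE R)).
move=> _ [_ [a [b ->] <-]]; rewrite setTI; apply: sub_sigma_algebra.
exact/cF/interval_open.
Qed.

Lemma open_measurable_borel (O : set M) : open O -> measurable (O : set (borel M)).
Proof. by move=> oO; exact: sub_sigma_algebra. Qed.

Definition density i (F : M -> R) : 'rV[R]_d -> R :=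
  ext (chart_cod i) (fun x => pull i F x * dens (g i) x).

Lemma ccont_density i F : msup i F ->
  (forall x, chart_cod i x -> {for x, continuous (pull i F)}) -> ccont (density i F).
Proof.
move=> sF cF; apply: (ext_ccont (@oC i)).
  by apply: csupMl; exact: csup_pull.
move=> x ix; apply: (@continuousM _ _ (pull i F) (dens (g i))); first exact: cF.
exact: (smooth_continuous (smooth_dens (@oC i) (@sG i) (@symG i) (@posG i)) ix).
Qed.

(** The bridge from the abstract volume to coordinates. The support lies in one chart, so the
    condition on sets inside the chart domain determines the integral. *)
Lemma vol_transfer i F : msup i F ->
  (forall x, chart_cod i x -> {for x, continuous (pull i F)}) ->
  vol.-integrable setT (EFin \o (F : borel M -> R)) /\
  (\int[vol]_m F m)%R = Jint (density i F).
Proof.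
move=> sF cF.
have cT := msup_continuous sF cF.
have mF := continuous_measurable_borel cT.
pose P := @rowt R d @^-1` chart_cod i.
have mP : measurable P by exact: measurable_rowt.
have mD : measurable (chart_dom i : set (borel M)) by exact: open_measurable_borel.
pose k (t : d.-tuple R) : borel M := chart_inv i (rowt t).
have mk : measurable_fun P k.
  apply: (@measurability _ _ _ (borel M) _ _ open) => // _ [W oW <-].
  apply: (@measurable_rowt R d (chart_cod i `&` chart_inv i @^-1` W)).
  rewrite openE => x [ix Wx]; apply: filterI; first exact: open_nbhs_nbhs.
  by apply: (chart_inv_continuous ix); exact: open_nbhs_nbhs.
have mw : measurable_fun P (dens (g i) \o @rowt R d).
  apply: (measurability _ (RGenOpens.measurableE R)).
  move=> _ [_ [a [b ->] <-]].
  apply: (@measurable_rowt R d (chart_cod i `&` dens (g i) @^-1` `]a, b[%classic)).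
  rewrite openE => x [ix Ox]; apply: filterI; first exact: open_nbhs_nbhs.
  apply: (smooth_continuous (smooth_dens (@oC i) (@sG i) (@symG i) (@posG i)) ix).
  by apply: open_nbhs_nbhs; split => //; exact: interval_open.
have w0 t : 0 <= dens (g i) (rowt t) by exact: dens_ge0.
have PD t : P t -> chart_dom i (k t) by move=> Pt; exact: chart_invP.
have nuE (S : set (borel M)) : measurable S -> S `<=` chart_dom i ->
    vol S = (\int[lebesgue_tuple R d]_(t in P `&` k @^-1` S) (dens (g i) (rowt t))%:E)%E.
  by move=> mS SD; exact: volP.
have T := ge0_integral_density mP mD mk mw w0 PD nuE.
have F0 m : ~ chart_dom i m -> F m = 0.
  by move=> im; have [K [_ KD FK]] := sF; apply: FK => /KD.
have cd := ccont_density sF cF.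
have id := ccont_integrable cd.
(* This is applied to the absolute value and to the positive and negative parts. They are positively
   homogeneous, so the density may be moved inside [f]. *)
have TT (f : R -> R) : measurable_fun setT f -> f 0 = 0 -> (forall x, 0 <= f x) ->
    (forall x y, 0 <= y -> f (x * y) = f x * y) ->
    (\int[vol]_m (f (F m))%:E = \int[lebesgue_tuple R d]_t (f (density i F (rowt t)))%:E)%E.
  move=> mf f0 fp fM.
  transitivity (\int[vol]_(m in chart_dom i) (f (F m))%:E)%E.
    rewrite [RHS]integral_mkcond; apply: eq_integral => m _; rewrite patchE.
    by case: ifPn => // /negP im; rewrite F0 ?f0// => im'; apply: im; rewrite inE.
  rewrite (T (fun m => (f (F m))%:E)); last 2 first.
  - by apply/measurable_EFinP; exact: measurableT_comp.
  - by move=> m; rewrite lee_fin.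
  rewrite integral_mkcond; apply: eq_integral => t _; rewrite patchE /density.
  case: ifPn => [/set_mem Pt|/negP Pt]; first by rewrite extE// fM// EFinM.
  by rewrite ext_out ?f0// => Pt'; apply: Pt; rewrite inE.
have iF : vol.-integrable setT (EFin \o (F : borel M -> R)).
  apply/integrableP; split; first exact/measurable_EFinP.
  have := TT (fun x => `|x|) _ (normr0 _) (fun x => normr_ge0 x) _.
  move=> /(_ (@normr_measurable _ _)) E.
  have [_] := integrableP _ _ _ id; apply: le_lt_trans.
  rewrite /= E// => x y y0; by rewrite normrM (ger0_norm y0).
split => //.
rewrite /Jint /Rintegral; congr fine.
rewrite [LHS]integralE [RHS]integralE; congr (_ - _)%E.
- have := TT (fun x => Num.max x 0) _ (maxxx _) _ _.
  move=> E; under eq_integral do rewrite funeposE /= -EFin_max.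
  under [RHS]eq_integral do rewrite funeposE /= -EFin_max.
  apply: E.
  + by apply: measurable_funrpos; exact: measurable_id.
  + by move=> x; rewrite le_max lexx orbT.
  + by move=> x y y0; rewrite maxr_pMl// mul0r.
- have := TT (fun x => Num.max (- x) 0) _ _ _ _.
  move=> E; under eq_integral do rewrite funenegE /= -EFin_max.
  under [RHS]eq_integral do rewrite funenegE /= -EFin_max.
  apply: E.
  + by apply: measurable_funrneg; exact: measurable_id.
  + by rewrite oppr0 maxxx.
  + by move=> x; rewrite le_max lexx orbT.
  + by move=> x y y0; rewrite maxr_pMl// mul0r mulNr.
Qed.

End RealManifold.

Section LaplaceBeltrami.
Variables (R : realType) (M : ptopologicalType) (d : nat).
Variables (A : smooth_atlas R M d) (g : riemannian_metric A).
Hypothesis hM : hausdorff_space M.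
Variable vol : {measure set (borel M) -> \bar R}.
Hypothesis volP : is_riemannian_volume g vol.
Implicit Types (i j : chart A) (u v p F : M -> R) (m : M).

Let oD (i : chart A) : open (chart_dom i) := @chart_dom_open R M d A i.
Let oC (i : chart A) : open (chart_cod i) := @chart_cod_open R M d A i.
Let sG (i : chart A) := @metric_smooth R M d A g i.
Let symG (i : chart A) := @metric_symmetric R M d A g i.
Let posG (i : chart A) := @metric_pos R M d A g i.

Definition mint F : R := (\int[vol]_m F m)%R.

(** Every function whose integral is manipulated has compact support in a single chart, so no
    partition of unity is involved. *)
Definition cint i F := msup i F /\
  forall x, chart_cod i x -> {for x, continuous (pull i F)}.

Lemma cint_int i F : cint i F -> vol.-integrable setT (EFin \o (F : borel M -> R)).
Proof. by move=> [sF cF]; have [] := vol_transfer hM volP sF cF. Qed.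

Lemma mintE i F : cint i F -> mint F = Jint (density g i F).
Proof. by move=> [sF cF]; have [] := vol_transfer hM volP sF cF. Qed.

Lemma mintD i j F F' : cint i F -> cint j F' ->
  mint (fun m => F m + F' m) = mint F + mint F'.
Proof. by move=> /cint_int iF /cint_int iF'; exact: RintegralD. Qed.

Lemma mintB i j F F' : cint i F -> cint j F' ->
  mint (fun m => F m - F' m) = mint F - mint F'.
Proof. by move=> /cint_int iF /cint_int iF'; exact: RintegralB. Qed.

Lemma mintZ i (c : R) F : cint i F -> mint (fun m => c * F m) = c * mint F.
Proof. by move=> /cint_int iF; exact: RintegralZl. Qed.

Lemma cintD i F F' : cint i F -> cint i F' -> cint i (fun m => F m + F' m).
Proof.
move=> [sF cF] [sF' cF']; split; first exact: msupD.
by move=> x ix; exact: (@continuousD _ _ _ (pull i F) (pull i F') x (cF x ix) (cF' x ix)).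
Qed.

Lemma cintM i F F' : cint i F ->
  (forall x, chart_cod i x -> {for x, continuous (pull i F')}) ->
  cint i (fun m => F m * F' m).
Proof.
move=> [sF cF] cF'; split; first exact: msupMl.
by move=> x ix; exact: (@continuousM _ _ (pull i F) (pull i F') x (cF x ix) (cF' x ix)).
Qed.

Lemma cintZ i (c : R) F : cint i F -> cint i (fun m => c * F m).
Proof.
move=> cF; have : cint i (fun m => F m * c).
  by apply: (cintM cF) => x _; exact: cst_continuous.
by under eq_fun do rewrite mulrC.
Qed.

Lemma cint_smooth i F : msup i F -> rsmooth A F -> cint i F.
Proof. by move=> sF rF; split => // x; exact: (smooth_continuous (rF i)). Qed.

Lemma cint_continuous i F : msup i F -> continuous F -> cint i F.
Proof. by move=> sF cF; split => // x ix; apply: continuous_pull => //; exact: cF. Qed.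

Lemma mint_gt0 i F m : cint i F -> (forall m, 0 <= F m) -> 0 < F m -> 0 < mint F.
Proof.
move=> cF F0 Fm; rewrite (mintE cF).
have im : chart_dom i m.
  apply: contrapT => im; have [[K [_ KD FK]] _] := cF.
  by move: Fm; rewrite FK ?ltxx// => /KD.
apply: (@Jint_gt0 _ _ _ (chart_map i m)).
- by have [sF cF'] := cF; exact: ccont_density.
- move=> x; rewrite /density /ext; case: ifP => // _.
  by apply: mulr_ge0; [exact: F0|exact: dens_ge0].
- rewrite /density extE ?pullK ?mulr_gt0//; last exact: chart_mapP.
  by apply: (@dens_gt0 _ _ _ _ (@symG i) (@posG i)); exact: chart_mapP.
Qed.

(** The Laplacian read in one fixed chart, in contrast to [rlap], whose chart varies with the
    point. *)
Definition lapc i u m : R :=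
  if `[< chart_dom i m >] then lap (g i) (pull i u) (chart_map i m) else 0.

Definition rgam i u v m : R :=
  if `[< chart_dom i m >] then Gam (g i) (pull i u) (pull i v) (chart_map i m) else 0.

Lemma lapc_pull i u x : chart_cod i x -> pull i (lapc i u) x = lap (g i) (pull i u) x.
Proof.
move=> ix; rewrite /pull /lapc; case: asboolP => [_|].
  by rewrite chart_invK.
by case; exact: chart_invP.
Qed.

Lemma rgam_pull i u v x : chart_cod i x ->
  pull i (rgam i u v) x = Gam (g i) (pull i u) (pull i v) x.
Proof.
move=> ix; rewrite /pull /rgam; case: asboolP => [_|].
  by rewrite chart_invK.
by case; exact: chart_invP.
Qed.

Lemma partial_pull_out i p K m : compact K ->
  (forall m, ~ K m -> p m = 0) -> chart_dom i m -> ~ K m ->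
  \forall x \near chart_map i m, pull i p x = 0.
Proof.
move=> cK pK im nK; have oK : open (~` K) by rewrite openC; exact: compact_closed.
have ic := chart_mapP im.
have : nbhs (chart_inv i (chart_map i m)) (~` K) by rewrite chart_mapK//; exact: open_nbhs_nbhs.
move=> H; have {}H : \forall x \near chart_map i m, (~` K) (chart_inv i x).
  exact: (chart_inv_continuous ic H).
by apply: filterS H => x; exact: pK.
Qed.

Lemma msup_rgam i p u : msup i p -> msup i (rgam i p u).
Proof.
move=> [K [cK KD pK]]; exists K; split => // m nK.
rewrite /rgam; case: asboolP => // im.
rewrite /Gam big1// => a _; rewrite big1// => b _.
suff -> : partial a (pull i p) (chart_map i m) = 0 by rewrite mulr0 mul0r.
rewrite -(derive_cst (0 : R) (chart_map i m) (basis_vec R a)).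
by apply: near_eq_derive; exact: (partial_pull_out cK pK im nK).
Qed.

Lemma lapc_out i p K m : compact K -> (forall m, ~ K m -> p m = 0) -> ~ K m ->
  lapc i p m = 0.
Proof.
move=> cK pK nK; rewrite /lapc; case: asboolP => // im.
rewrite /lap big1 ?mulr0 ?oppr0// => a _.
(* The flux is differentiated once more, so it has to vanish on a neighbourhood and not just at the
   point. *)
have e0 : \forall x \near chart_map i m, flux (g i) (pull i p) a x = 0.
  have H : \forall x \near chart_map i m, \forall y \near x, pull i p y = 0.
    by apply: nbhs_interior; exact: (partial_pull_out cK pK im nK).
  apply: filterS H => x Hx; rewrite /flux big1 ?mulr0// => b _.
  suff -> : partial b (pull i p) x = 0 by rewrite mulr0.
  rewrite -(derive_cst (0 : R) x (basis_vec R b)); exact: near_eq_derive.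
rewrite -(derive_cst (0 : R) (chart_map i m) (basis_vec R a)).
exact: near_eq_derive.
Qed.

Lemma msup_lapc i p : msup i p -> msup i (lapc i p).
Proof.
by move=> [K [cK KD pK]]; exists K; split => // m nK; exact: (lapc_out i cK pK nK).
Qed.

Lemma continuous_pull_eq i F (f : 'rV[R]_d -> R) : smooth_on (chart_cod i) f ->
  (forall x, chart_cod i x -> pull i F x = f x) ->
  forall x, chart_cod i x -> {for x, continuous (pull i F)}.
Proof.
move=> sf E x ix; apply: near_continuous (smooth_continuous sf ix).
by apply: filterS (near_open (@oC i) ix) => y /E ->.
Qed.

Lemma continuous_lapc i u : rsmooth A u ->
  forall x, chart_cod i x -> {for x, continuous (pull i (lapc i u))}.
Proof.
move=> su; apply: (continuous_pull_eq (smooth_lap (@oC i) (@sG i) (@symG i) (@posG i) (su i))).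
by move=> x; exact: lapc_pull.
Qed.

Lemma cint_rgam i p u : rsmooth A p -> rsmooth A u -> msup i p -> cint i (rgam i p u).
Proof.
move=> sp su mp; split; first exact: msup_rgam.
apply: (continuous_pull_eq (smooth_Gam (@oC i) (@sG i) (@symG i) (@posG i) (sp i) (su i))).
by move=> x; exact: rgam_pull.
Qed.

Lemma cint_lapc i p u : rsmooth A p -> rsmooth A u -> msup i p ->
  cint i (fun m => p m * lapc i u m).
Proof.
by move=> sp su mp; apply: cintM; [exact: cint_smooth|exact: continuous_lapc].
Qed.

Lemma cint_lapc' i p u : rsmooth A p -> rsmooth A u -> msup i p ->
  cint i (fun m => u m * lapc i p m).
Proof.
move=> sp su mp; have : cint i (fun m => lapc i p m * u m).
  apply: cintM; last by move=> x; exact: (smooth_continuous (su i)).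
  by split; [exact: msup_lapc|exact: continuous_lapc].
by under eq_fun do rewrite mulrC.
Qed.

Lemma ext_eq (U : set 'rV[R]_d) (f f' : 'rV[R]_d -> R) :
  (forall x, U x -> f x = f' x) -> ext U f = ext U f'.
Proof. by move=> E; apply/funext => x; rewrite /ext; case: asboolP => // /E. Qed.

Lemma green_lapc i p u : rsmooth A p -> rsmooth A u -> msup i p ->
  mint (fun m => p m * lapc i u m) = mint (rgam i p u) /\
  mint (fun m => u m * lapc i p m) = mint (rgam i p u).
Proof.
move=> sp su mp.
have E1 := mintE (cint_lapc sp su mp).
have E2 := mintE (cint_lapc' sp su mp).
have E3 := mintE (cint_rgam sp su mp).
have cp := csup_pull mp.
have G1 := green (@oC i) (@sG i) (@symG i) (@posG i) (sp i) (su i) (or_introl cp).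
have G2 := green (@oC i) (@sG i) (@symG i) (@posG i) (su i) (sp i) (or_intror cp).
have e1 : density g i (fun m => p m * lapc i u m) =
    ext (chart_cod i) (fun x => pull i p x * lap (g i) (pull i u) x * dens (g i) x).
  by apply: ext_eq => x ix; congr (_ * _ * _); rewrite -lapc_pull.
have e2 : density g i (fun m => u m * lapc i p m) =
    ext (chart_cod i) (fun x => pull i u x * lap (g i) (pull i p) x * dens (g i) x).
  by apply: ext_eq => x ix; congr (_ * _ * _); rewrite -lapc_pull.
have e3 : density g i (rgam i p u) =
    ext (chart_cod i) (fun x => Gam (g i) (pull i p) (pull i u) x * dens (g i) x).
  by apply: ext_eq => x ix; congr (_ * _); rewrite -rgam_pull.
have e4 : ext (chart_cod i) (fun x => Gam (g i) (pull i u) (pull i p) x * dens (g i) x) =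
    ext (chart_cod i) (fun x => Gam (g i) (pull i p) (pull i u) x * dens (g i) x).
  by apply: ext_eq => x ix; rewrite (Gam_sym (@symG i)).
pose J := @Jint R d.
split.
  exact: (etrans E1 (etrans (congr1 J e1) (etrans G1 (etrans (congr1 J (esym e3)) (esym E3))))).
exact: (etrans E2 (etrans (congr1 J e2) (etrans G2 (etrans (congr1 J e4)
  (etrans (congr1 J (esym e3)) (esym E3)))))).
Qed.

(* The volume and the inner product of gradients do not depend on the chart, so
   by Green's formula both sides have the same integral against every bump
   supported in the overlap; second derivatives need not be transformed. *)
Lemma lapc_indep i j u m : rsmooth A u -> chart_dom i m -> chart_dom j m ->
  lapc i u m = lapc j u m.
Proof.
move=> su; wlog H : i j / lapc i u m < lapc j u m.
  move=> W im jm; have [H|H|//] := ltgtP (lapc i u m) (lapc j u m).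
    exact: W.
  by apply/esym; exact: W.
move=> im jm; exfalso.
pose F m' := lapc j u m' - lapc i u m'.
have cl k m' : chart_dom k m' -> {for m', continuous (lapc k u)}.
  move=> km; apply: (continuous_unpull km).
  by apply: continuous_lapc => //; exact: chart_mapP.
have nF : \forall m' \near m, (chart_dom i m' /\ chart_dom j m') /\ 0 < F m'.
  apply: filterI.
    by apply: filterI; exact: open_nbhs_nbhs.
  have cF : {for m, continuous F}.
    exact: (@continuousB _ _ _ (lapc j u) (lapc i u) m (cl j m jm) (cl i m im)).
  by apply: (cvgr_gt _ cF); rewrite subr_gt0.
pose q := chart_map i m.
have iq : chart_cod i q by exact: chart_mapP.
have : \forall x \near q, chart_cod i x /\
   ((chart_dom i (chart_inv i x) /\ chart_dom j (chart_inv i x)) /\ 0 < F (chart_inv i x)).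
  apply: filterI; first exact: open_nbhs_nbhs.
  rewrite -(chart_mapK im) in nF; exact: (chart_inv_continuous iq nF).
move=> /nbhs_interior/nbhs_singleton /(open_box (@open_interior _ _)) [r r0 rP].
have rP' x : box q r x -> chart_cod i x /\
   ((chart_dom i (chart_inv i x) /\ chart_dom j (chart_inv i x)) /\ 0 < F (chart_inv i x)).
  by move=> /rP /interior_subset.
pose l := r^-1; have l0 : 0 < l by rewrite invr_gt0.
have lr : l^-1 = r by rewrite invrK.
have qC : box q l^-1 `<=` chart_cod i by rewrite lr => x /rP'[].
pose b := mbump i q l.
have sb : rsmooth A b by exact: mbump_smooth.
have bi : msup i b by exact: mbump_msup.
have bj : msup j b.
  by apply: mbump_msup_in => // _ [x xb <-]; rewrite lr in xb; have [_ [[]]] := rP' x xb.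
have [Gi _] := green_lapc sb su bi.
have [Gj _] := green_lapc sb su bj.
have cB : compact (chart_inv i @` box q l^-1) by apply: (compact_inv_box (i:=i)) => //; exact: compact_box.
have E : rgam i b u = rgam j b u.
  apply/funext => m'; have [[x xb xm]|nb] := pselect ((chart_inv i @` box q l^-1) m').
    rewrite lr in xb; have [ix [[ix' jx'] _]] := rP' x xb.
    rewrite -xm /rgam; case: asboolP => // _; case: asboolP => // _.
    by rewrite chart_invK// (@Gam_transition _ _ _ _ _ i j).
  have Z k : rgam k b u m' = 0.
    rewrite /rgam; case: asboolP => // km'.
    rewrite /Gam big1// => a _; rewrite big1// => c _.
    suff -> : partial a (pull k b) (chart_map k m') = 0 by rewrite mulr0 mul0r.
    rewrite -(derive_cst (0 : R) (chart_map k m') (basis_vec R a)).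
    apply: near_eq_derive.
    apply: (partial_pull_out cB _ km' nb); exact: mbump_supp.
  by rewrite !Z.
have ci := cint_lapc sb su bi; have cj := cint_lapc sb su bj.
have I0 : mint (fun m' => b m' * F m') = 0.
  transitivity (mint (fun m' => b m' * lapc j u m' - b m' * lapc i u m')).
    by congr mint; apply/funext => m'; rewrite mulrBr.
  apply: (etrans (mintB cj ci)).
  by apply/eqP; rewrite subr_eq0; apply/eqP/(etrans Gj)/esym; rewrite -E.
have cF : cint i (fun m' => b m' * F m').
  apply: cint_continuous; first exact: msupMl.
  have -> : (fun m' => b m' * F m') = (fun m' => b m' * lapc j u m' - b m' * lapc i u m').
    by apply/funext => m'; rewrite mulrBr.
  have [mj kj] := cj; have [mi ki] := ci => m'.
  apply: (@continuousB _ _ _ (fun m' => b m' * lapc j u m')).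
    exact: (msup_continuous hM mj kj).
  exact: (msup_continuous hM mi ki).
suff : 0 < mint (fun m' => b m' * F m') by rewrite I0 ltxx.
apply: (@mint_gt0 i _ m cF) => [m'|].
  have [[x xb xm]|nb] := pselect ((chart_inv i @` box q l^-1) m').
    rewrite lr in xb; have [_ [_ F0]] := rP' x xb.
    by rewrite -xm; apply: mulr_ge0; [exact: mbump_ge0|exact: ltW].
  by rewrite /b mbump_supp// mul0r.
rewrite /b mbump_dom// sbump_center mul1r.
by have [_] := nbhs_singleton nF.
Qed.

Lemma rlap_at u m : rlap g u m = lapc (chart_at A m) u m.
Proof. by rewrite /lapc asboolT//; exact: chart_atP. Qed.

Lemma rlapE i u m : rsmooth A u -> chart_dom i m -> rlap g u m = lapc i u m.
Proof.
move=> su im; rewrite rlap_at; apply: lapc_indep => //; exact: chart_atP.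
Qed.

Lemma rlap_pull i u x : rsmooth A u -> chart_cod i x ->
  pull i (rlap g u) x = lap (g i) (pull i u) x.
Proof.
move=> su ix; rewrite -lapc_pull//; apply: rlapE => //; exact: chart_invP.
Qed.

(** The chart chosen by [chart_at] may jump from point to point. Independence of the chart shows
    that on each codomain the result is the smooth function [lap]. *)
Lemma rsmooth_rlap u : rsmooth A u -> rsmooth A (rlap g u).
Proof.
move=> su i.
apply: (eq_smooth_on (@oC i)) (smooth_lap (@oC i) (@sG i) (@symG i) (@posG i) (su i)).
by move=> x /set_mem ix; rewrite rlap_pull.
Qed.

Lemma rlap_linear (c : R) u p m : rsmooth A u -> rsmooth A p ->
  rlap g (fun m => c * u m + p m) m = c * rlap g u m + rlap g p m.
Proof.
move=> su sp.
exact: (lap_linear (@oC _) (@sG _) (@symG _) (@posG _) c (su _) (sp _) (chart_mapP (chart_atP A m))).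
Qed.

Lemma rlap_out p K m : compact K -> (forall m, ~ K m -> p m = 0) -> ~ K m ->
  rlap g p m = 0.
Proof. by move=> cK pK nK; rewrite rlap_at; exact: (lapc_out _ cK pK nK). Qed.

Lemma msup_rlap i p : msup i p -> msup i (rlap g p).
Proof.
by move=> [K [cK KD pK]]; exists K; split => // m nK; exact: (rlap_out cK pK nK).
Qed.

Lemma green_rlap i p u : rsmooth A p -> rsmooth A u -> msup i p ->
  mint (fun m => p m * rlap g u m) = mint (rgam i p u) /\
  mint (fun m => u m * rlap g p m) = mint (rgam i p u).
Proof.
move=> sp su mp; have [G1 G2] := green_lapc sp su mp.
have [K [cK KD pK]] := mp.
split; [rewrite -G1|rewrite -G2]; congr mint; apply/funext => m.
  have [Km|nK] := pselect (K m); last by rewrite pK// !mul0r.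
  by congr (_ * _); exact: (rlapE su (KD _ Km)).
congr (_ * _).
have [Km|nK] := pselect (K m); first exact: (rlapE sp (KD _ Km)).
by rewrite (rlap_out cK pK nK) (lapc_out i cK pK nK).
Qed.

Lemma rgam_ge0 i p m : rsmooth A p -> 0 <= rgam i p p m.
Proof.
move=> sp; rewrite /rgam; case: asboolP => // im.
exact: (Gam_ge0 (@symG i) (@posG i) _ (chart_mapP im)).
Qed.

Lemma mint_ge0 F : (forall m, 0 <= F m) -> 0 <= mint F.
Proof. by move=> F0; apply: Rintegral_ge0. Qed.

(** At a maximum [c] of a solution [p] the Laplacian is nonnegative, so [p c] is nonpositive and [p]
    is nonpositive everywhere. The same holds for [- u]. *)
Lemma resolvent_unique u : compact [set: M] -> rsmooth A u ->
  (forall m, u m + rlap g u m = 0) -> forall m, u m = 0.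
Proof.
move=> cM su u0.
suff key p : rsmooth A p -> (forall m, p m + rlap g p m = 0) -> forall m, p m <= 0.
  move=> m; apply/eqP; rewrite eq_le; apply/andP; split; first exact: key.
  rewrite -oppr_le0 -mulN1r; apply: (key (fun m => -1 * u m)); first exact: rsmoothZ.
  move=> m'; have s0 : rsmooth A (fun=> (0 : R)) by exact: rsmooth_cst.
  have -> : (fun m => -1 * u m) = (fun m => -1 * u m + 0).
    by apply/funext => ?; rewrite addr0.
  rewrite (rlap_linear _ _ su s0).
  suff -> : rlap g (fun=> 0) m' = 0 by rewrite addr0 -mulrDr u0 mulr0.
  exact: (@rlap_out _ set0 _ compact0).
move=> sp p0 m.
have [c _ cP] : exists2 c, c \in [set: M] & forall t, t \in [set: M] -> p t <= p c.
  apply: compact_EVT_max => //; first by exists point.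
  by apply: continuous_subspaceT; exact: rsmooth_continuous.
apply: (le_trans (cP m (mem_set I))).
suff H : 0 <= rlap g p c by rewrite -(p0 c) lerDl.
have ic := chart_atP A c.
apply: (lap_max (@oC _) (@sG _) (@symG _) (@posG _) (sp _) (chart_mapP ic)) => y iy.
by rewrite (pullK p ic); exact: cP (mem_set I).
Qed.

End LaplaceBeltrami.

(** * Points have zero capacity *)

Section Dyadic.
Variable R : realType.

(** The partial sum S stays below the next term l = 2^N L. Thus S^2 + 2 S l + l^2 <= S^2 + 3 l^2,
    and the cross terms cost a factor 3 instead of a factor N. *)
Lemma dyadic_sum_sqr (L : R) (c : nat -> bool) N : 0 <= L ->
  (\sum_(n < N) 2 ^+ n * L * (c n)%:R) ^+ 2 <= 3 * \sum_(n < N) (2 ^+ n * L) ^+ 2 * (c n)%:R.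
Proof.
move=> L0.
suff [H1 H2 H3] : [/\ 0 <= \sum_(n < N) 2 ^+ n * L * (c n)%:R,
  \sum_(n < N) 2 ^+ n * L * (c n)%:R <= 2 ^+ N * L &
  (\sum_(n < N) 2 ^+ n * L * (c n)%:R) ^+ 2 <= 3 * \sum_(n < N) (2 ^+ n * L) ^+ 2 * (c n)%:R].
  exact: H3.
elim: N => [|N [IH0 IH1 IH2]].
  by rewrite !big_ord0 expr0n/= mulr0 mul1r; split.
rewrite !big_ord_recr/= exprS; set S := \sum_(i < N) _ in IH0 IH1 IH2 *.
set T := \sum_(i < N) _ in IH2 *.
have l0 : 0 <= 2 ^+ N * L by rewrite mulr_ge0// exprn_ge0.
set l := 2 ^+ N * L in l0 IH1 *.
rewrite -mulrA -/l; case: (c N); rewrite ?mulr1 ?mulr0 ?addr0.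
  split; [lra|lra|].
  have : S * l <= l * l by exact: ler_wpM2r.
  rewrite sqrrD mulrDr; move: IH2; rewrite !expr2 -mulr_natl.
  by move: (S * S) (S * l) (l * l) T => a b c' d'; lra.
by split => //; lra.
Qed.

End Dyadic.

Section Capacity.
Variables (R : realType) (M : ptopologicalType) (d : nat).
Variables (A : smooth_atlas R M d) (g : riemannian_metric A).
Hypothesis hM : hausdorff_space M.
Variable vol : {measure set (borel M) -> \bar R}.
Hypothesis volP : is_riemannian_volume g vol.
Variable i : chart A.

Let oC : open (chart_cod i) := @chart_cod_open R M d A i.
Let sG := @metric_smooth R M d A g i.
Let symG := @metric_symmetric R M d A g i.
Let posG := @metric_pos R M d A g i.

Lemma smooth_bounded (U K : set 'rV[R]_d) f : smooth_on U f -> compact K -> K `<=` U ->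
  exists C, 0 <= C /\ forall x, K x -> `|f x| <= C.
Proof.
move=> sf cK KU; have [|C C0 HC] := @continuous_bounded R _ K f cK; last by exists C.
by apply: continuous_in_subspaceT => x /set_mem /KU Ux; exact: (smooth_continuous sf Ux).
Qed.

(* A logarithmic cutoff: an average of bumps on N.+1 successive dyadic scales, so
   that the energy is of order 1 / N. *)
Definition dyadic_bump (q : 'rV[R]_d) (L : R) N : M -> R :=
  fun m => N.+1%:R^-1 * \sum_(n < N.+1) mbump i q (2 ^+ n * L) m.

Section Dyadic_bump.
Variables (q : 'rV[R]_d) (L : R).
Hypotheses (L1 : 1 <= L) (qC : box q L^-1 `<=` chart_cod i).

Let l (n : nat) : R := 2 ^+ n * L.

Lemma dyadic_ge n : L <= l n.
Proof. by rewrite ler_peMl ?exprn_ege1// ?ler1n// (le_trans ler01). Qed.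

Let l0 n : 0 < l n.
Proof. by apply: lt_le_trans (dyadic_ge n); exact: lt_le_trans L1. Qed.

Let bqC n : box q (l n)^-1 `<=` box q L^-1.
Proof.
move=> x xb k; apply: le_trans (xb k) _.
by rewrite lef_pV2 ?posrE ?dyadic_ge//; exact: lt_le_trans L1.
Qed.

Let qCn n : box q (l n)^-1 `<=` chart_cod i.
Proof. by move=> x /bqC /qC. Qed.

Lemma dyadic_bump_smooth N : rsmooth A (dyadic_bump q L N).
Proof.
apply: rsmoothZ; apply: rsmooth_sum => n.
exact: (mbump_smooth hM (l0 n) (@qCn n)).
Qed.

Lemma dyadic_bump_msup N : msup i (dyadic_bump q L N).
Proof.
apply: msupMr; apply: msup_sum => n.
exact: (mbump_msup (l0 n) (@qCn n)).
Qed.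

Lemma dyadic_bump_pull N x : chart_cod i x ->
  pull i (dyadic_bump q L N) x = N.+1%:R^-1 * \sum_(n < N.+1) sbump q (l n) x.
Proof.
move=> ix; rewrite /pull /dyadic_bump; congr (_ * _); apply: eq_bigr => n _.
exact: (mbump_pull q (l n) ix).
Qed.

Lemma dyadic_bump_partial N x a : chart_cod i x ->
  partial a (pull i (dyadic_bump q L N)) x =
  N.+1%:R^-1 * \sum_(n < N.+1) partial a (sbump q (l n)) x.
Proof.
move=> ix.
have ss n : smooth_on (chart_cod i) (sbump q (l n)).
  by apply: (smooth_on_sbump _ _ oC) => k; exact: (smooth_on_coord k oC).
have sS : smooth_on (chart_cod i) (fun x => \sum_(n < N.+1) sbump q (l n) x).
  by apply: (smooth_on_bigsum oC) => n; exact: ss.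
transitivity (partial a (fun x => N.+1%:R^-1 * \sum_(n < N.+1) sbump q (l n) x) x).
  apply: near_eq_derive; apply: filterS (near_open oC ix) => y iy.
  exact: dyadic_bump_pull.
rewrite (partialM a (smooth_on_cst _ oC) sS ix) {2}/partial derive_cst mulr0 addr0.
by rewrite (partial_bigsum oC _ a (fun n : 'I_N.+1 => ss n) ix).
Qed.

(** The prefactor [N.+1%:R^-1] is squared, while [dyadic_sum_sqr] replaces the square of the sum
    over scales by a sum of squares. The constant collects the bounds of the metric on the largest
    box. *)
Lemma dyadic_bump_energy_le : exists2 C, 0 <= C & forall N x,
  density g i (fun m => dyadic_bump q L N m ^+ 2 +
     rgam g i (dyadic_bump q L N) (dyadic_bump q L N) m) x <=
  \sum_(n < N.+1) (C / N.+1%:R ^+ 2 * l n ^+ 2) * \1_(box q (l n)^-1) x.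
Proof.
have cK := @compact_box R d q L^-1.
have [D [D0 HD]] := smooth_bounded (smooth_dens oC sG symG posG) cK qC.
have /choice[H HP] : forall ab : 'I_d * 'I_d, exists h : R, 0 <= h /\
    forall x, box q L^-1 x -> `|invmx (g i x) ab.1 ab.2| <= h.
  move=> [a b].
  exact: (smooth_bounded (smooth_metric_inv oC sG symG posG a b) cK qC).
have [C C0 HC] := sbump_bounds R d.
pose W := 1 + \sum_a \sum_b H (a, b).
have W0 : 0 <= W.
  by rewrite addr_ge0// sumr_ge0// => a _; rewrite sumr_ge0// => b _; have [] := HP (a, b).
exists (3 * C ^+ 2 * W * D) => [|N x]; first by rewrite !mulr_ge0 ?exprn_ge0.
set p := dyadic_bump q L N.
have rhs0 : 0 <= \sum_(n < N.+1) (3 * C ^+ 2 * W * D / N.+1%:R ^+ 2 * l n ^+ 2) * \1_(box q (l n)^-1) x.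
  apply: sumr_ge0 => n _; rewrite mulr_ge0// mulr_ge0 ?exprn_ge0 ?(ltW (l0 n))//.
  by rewrite divr_ge0 ?exprn_ge0// !mulr_ge0 ?exprn_ge0.
have [ix|ix] := pselect (chart_cod i x); last by rewrite /density ext_out.
rewrite /density extE//.
have -> : pull i (fun m => p m ^+ 2 + rgam g i p p m) x =
    pull i p x ^+ 2 + Gam (g i) (pull i p) (pull i p) x.
  by rewrite -rgam_pull.
(* A common bound for the value and for the partial derivatives; the value does not grow with the
   scale, but [1 <= l n] allows the same factor. *)
pose S := N.+1%:R^-1 * (C * \sum_(n < N.+1) 2 ^+ n * L * (x \in box q (l n)^-1)%:R).
have N0 : 0 <= N.+1%:R^-1 :> R by rewrite invr_ge0.
have p1 : `|pull i p x| <= S.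
  rewrite dyadic_bump_pull// normrM (ger0_norm N0); apply: ler_wpM2l => //.
  rewrite mulr_sumr; apply: le_trans (ler_norm_sum _ _ _) _; apply: ler_sum => n _.
  have [h _] := HC q (l n) x (l0 n); apply: (le_trans h); rewrite indicE.
  rewrite ler_wpM2l// ler_peMl//; apply: le_trans (dyadic_ge n); exact: L1.
have p2 a : `|partial a (pull i p) x| <= S.
  rewrite dyadic_bump_partial// normrM (ger0_norm N0); apply: ler_wpM2l => //.
  rewrite mulr_sumr; apply: le_trans (ler_norm_sum _ _ _) _; apply: ler_sum => n _.
  have [_ h] := HC q (l n) x (l0 n); apply: (le_trans (h a)); rewrite indicE.
  by rewrite -[leLHS]mulrA.
have S0 : 0 <= S by apply: le_trans p1.
have Sb : S ^+ 2 <= 3 * C ^+ 2 / N.+1%:R ^+ 2 * \sum_(n < N.+1) l n ^+ 2 * \1_(box q (l n)^-1) x.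
  rewrite /S 2!exprMn exprVn.
  have L0 : 0 <= L by exact: le_trans L1.
  have := @dyadic_sum_sqr R L (fun n => x \in box q (l n)^-1) N.+1 L0.
  under [in leRHS]eq_bigr do rewrite -indicE -/(l _).
  set s := (\sum_(n < N.+1) 2 ^+ n * L * _) ^+ 2; set t := \sum_(n < N.+1) _ => st.
  have k0 : 0 <= C ^+ 2 / N.+1%:R ^+ 2 by rewrite divr_ge0 ?exprn_ge0.
  have := ler_wpM2l k0 st; congr (_ <= _); ring.
(* The bounds [H] and [D] hold only on the largest box. Outside of it no scale is active, and
   everything vanishes. *)
have [xb|xb] := pselect (box q L^-1 x); last first.
  have z n : (x \in box q (l n)^-1) = false.
    by apply/negbTE/negP => /set_mem /bqC.
  have SZ : S = 0.
    by rewrite /S big1 ?mulr0// => n _; rewrite z mulr0.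
  have e1 : pull i p x = 0 by apply/eqP; rewrite -normr_le0 -SZ.
  have e2 a : partial a (pull i p) x = 0 by apply/eqP; rewrite -normr_le0 -SZ.
  suff -> : Gam (g i) (pull i p) (pull i p) x = 0 by rewrite e1 expr0n/= addr0 mul0r.
  by rewrite /Gam big1// => a _; rewrite big1// => b _; rewrite (e2 b) mulr0.
have G1 : pull i p x ^+ 2 + Gam (g i) (pull i p) (pull i p) x <= S ^+ 2 * W.
  rewrite mulrDr mulr1; apply: lerD.
    by rewrite -real_normK ?num_real// ler_pXn2r// nnegrE.
  rewrite mulr_sumr; apply: ler_sum => a _; rewrite mulr_sumr; apply: ler_sum => b _.
  apply: le_trans (ler_norm _) _; rewrite 2!normrM -mulrA mulrC.
  have [h0 /(_ x xb) h] := HP (a, b).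
  apply: ler_pM; rewrite ?mulr_ge0//.
  by rewrite expr2; apply: ler_pM.
apply: (@le_trans _ _ (S ^+ 2 * W * D)).
  apply: (@le_trans _ _ (S ^+ 2 * W * dens (g i) x)).
    by apply: ler_wpM2r => //; exact: dens_ge0.
  apply: ler_wpM2l; first by rewrite mulr_ge0// exprn_ge0.
  exact: le_trans (ler_norm _) (HD x xb).
rewrite -[leLHS]mulrA; have WD : 0 <= W * D by exact: mulr_ge0.
apply: (le_trans (ler_wpM2r WD Sb)).
rewrite le_eqVlt; apply/orP; left; apply/eqP.
rewrite [LHS]mulrAC mulr_sumr; apply: eq_bigr => n _.
clearbody W l; move: (l n) (\1_(box q (l n)^-1) x) (N.+1%:R ^+ 2 : R) => t u v; ring.
Qed.

(** Here the dimension enters. A box of scale l has coordinate volume (2/l)^d, so with l >= 1 and d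
    >= 2 it contributes l^2 (2/l)^d <= 2^d. The N + 1 scales then give at most 2^d C / (N + 1). *)
Lemma dyadic_bump_energy : (2 <= d)%N -> exists2 C, 0 <= C & forall N,
  mint vol (fun m => dyadic_bump q L N m *
     (dyadic_bump q L N m + rlap g (dyadic_bump q L N) m)) <= C / N.+1%:R.
Proof.
move=> d2; have [C C0 HC] := dyadic_bump_energy_le.
exists (C * 2 ^+ d) => [|N]; first by rewrite mulr_ge0// exprn_ge0.
set p := dyadic_bump q L N.
have sp : rsmooth A p by exact: dyadic_bump_smooth.
have mp : msup i p by exact: dyadic_bump_msup.
have c1 : cint i (fun m => p m ^+ 2) by apply: cint_smooth; [exact: msupMl|exact: rsmoothM].
have cr := cint_rgam g hM sp sp mp.
have cl : cint i (fun m => p m * rlap g p m).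
  by apply: cint_smooth; [exact: msupMl|apply: (rsmoothM sp); exact: (rsmooth_rlap hM volP sp)].
have -> : mint vol (fun m => p m * (p m + rlap g p m)) =
    Jint (density g i (fun m => p m ^+ 2 + rgam g i p p m)).
  rewrite -(mintE hM volP (cintD c1 cr)) (mintD hM volP c1 cr).
  have [<- _] := green_rlap hM volP sp sp mp.
  rewrite -(mintD hM volP c1 cl); congr mint; apply/funext => m.
  by rewrite mulrDr -expr2.
have cd : ccont (density g i (fun m => p m ^+ 2 + rgam g i p p m)).
  by have [s1 s2] := cintD c1 cr; exact: (ccont_density g s1 s2).
have r0 (n : 'I_N.+1) : 0 <= (l n)^-1 by rewrite invr_ge0 ltW// l0.
apply: (le_trans (Jint_le_boxes r0 cd (HC N))).
apply: (@le_trans _ _ (\sum_(n < N.+1) C / N.+1%:R ^+ 2 * 2 ^+ d)).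
  apply: ler_sum => n _; rewrite -[leLHS]mulrA; apply: ler_wpM2l.
    by rewrite divr_ge0 ?exprn_ge0.
  have l1 : 1 <= l n by apply: le_trans L1 (dyadic_ge n).
  have t0 := l0 n; move: (l n) l1 t0 => t t1 t0.
  rewrite exprMn mulrCA ler_piMr ?exprn_ge0// exprVn ler_pdivrMr ?exprn_gt0// mul1r.
  exact: ler_weXn2l.
rewrite sumr_const card_ord -[leLHS]mulr_natr.
rewrite le_eqVlt; apply/orP; left; apply/eqP.
have : N.+1%:R != 0 :> R by rewrite pnatr_eq0.
move: (N.+1%:R : R) (2 ^+ d : R) => x y x0; field; exact: x0.
Qed.

End Dyadic_bump.

Lemma point_capacity q r e : (2 <= d)%N -> 0 < r -> box q r `<=` chart_cod i -> 0 < e ->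
  exists p w, [/\ rsmooth A p, forall m, 0 <= p m,
    forall m, ~ (chart_inv i @` box q r) m -> p m = 0,
    mint vol p = 1 & [/\ rsmooth A w, msup i w, 2^-1 <= mint vol (fun m => p m * w m) &
    mint vol (fun m => w m * (w m + rlap g w m)) <= e]].
Proof.
move=> d2 r0 rC e0.
(* Large enough both for the dyadic estimates, which ask for [1 <= L], and for the support to lie in
   the given box. *)
pose L := Num.max 1 r^-1.
have L1 : 1 <= L by rewrite le_max lexx.
have L0 : 0 < L by exact: lt_le_trans L1.
have Lr : L^-1 <= r by rewrite -[r]invrK lef_pV2 ?posrE ?invr_gt0// le_max lexx orbT.
have qL : box q L^-1 `<=` chart_cod i.
  by move=> x xb; apply: rC => k; exact: le_trans (xb k) Lr.
have [C C0 HC] := dyadic_bump_energy L1 qL d2.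
have [N NC] : exists N : nat, C / N.+1%:R <= e.
  have := near_infty_natSinv_lt (PosNum (divr_gt0 e0 (ltr_wpDl C0 (@ltr01 R)))).
  move=> [N _ /(_ N (leqnn N)) /= H]; exists N.
  apply: (@le_trans _ _ ((C + 1) / N.+1%:R)).
    by apply: ler_wpM2r; rewrite ?invr_ge0// lerDl.
  by rewrite mulrC -ler_pdivlMr ?ltr_wpDl// ltW.
pose w := dyadic_bump q L N.
have sw : rsmooth A w by exact: dyadic_bump_smooth.
have mw : msup i w by exact: dyadic_bump_msup.
have iq : chart_cod i q by apply: rC; apply: box_center; exact: ltW.
have wq : pull i w q = 1.
  rewrite dyadic_bump_pull// (eq_bigr (fun=> 1)) => [|n _]; last exact: sbump_center.
  by rewrite sumr_const card_ord mulVf// pnatr_eq0.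
(* The cutoff [w] is 1 at [q], so it exceeds 1/2 on a smaller box. A bump there, normalised to mass
   one, is the required [p]. *)
have : \forall x \near q, box q r x /\ 2^-1 < pull i w x.
  apply: filterI; first exact: box_nbhs.
  apply: (cvgr_gt _ (smooth_continuous (sw i) iq)).
  by rewrite wq invf_lt1// ltr1n.
move=> /nbhs_interior/nbhs_singleton /(open_box (@open_interior _ _)) [s s0 sP].
have sP' x : box q s x -> box q r x /\ 2^-1 < pull i w x by move=> /sP /interior_subset.
pose b := mbump i q s^-1; have si0 : 0 < s^-1 by rewrite invr_gt0.
have sC : box q s^-1^-1 `<=` chart_cod i by rewrite invrK => x /sP'[/rC].
have sb : rsmooth A b by exact: (mbump_smooth hM si0 sC).
have mb : msup i b by exact: (mbump_msup si0 sC).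
have cb := cint_smooth mb sb.
have b0 m : 0 <= b m by exact: mbump_ge0.
have iq' : chart_dom i (chart_inv i q) by exact: chart_invP.
have I0 : 0 < mint vol b.
  apply: (mint_gt0 hM volP (m := chart_inv i q) cb b0).
  by rewrite /b mbump_dom// chart_invK// sbump_center ltr01.
pose c := (mint vol b)^-1; have c0 : 0 < c by rewrite invr_gt0.
have bout m : ~ (chart_inv i @` box q s) m -> b m = 0.
  by move=> H; apply: (mbump_supp si0); rewrite invrK.
exists (fun m => c * b m), w; split.
- exact: rsmoothZ.
- by move=> m; rewrite mulr_ge0// ltW.
- move=> m H; rewrite bout ?mulr0// => -[x /sP'[xr _] E]; apply: H; by exists x.
- by rewrite (mintZ hM volP _ cb) mulVf// gt_eqF.
split => //; last exact: le_trans (HC N) NC.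
have cb' : cint i (fun m => c * b m) by exact: cintZ.
have cb2 : cint i (fun m => 2^-1 * (c * b m)) by exact: cintZ.
have cw : cint i (fun m => c * b m * w m).
  by apply: cintM => // x; exact: (smooth_continuous (sw i)).
have -> : 2^-1 = mint vol (fun m => 2^-1 * (c * b m)).
  by rewrite (mintZ hM volP _ cb') (mintZ hM volP _ cb) mulVf ?mulr1// gt_eqF.
rewrite -subr_ge0 -(mintB hM volP cw cb2); apply: mint_ge0 => m.
rewrite subr_ge0 [leRHS]mulrC.
have [[x /sP'[_ wx] E]|H] := pselect ((chart_inv i @` box q s) m); last by rewrite bout// !mulr0.
apply: ler_wpM2r; first by rewrite mulr_ge0// ltW.
by rewrite -E ltW.
Qed.

End Capacity.

(** * The Gaussian field *)

Section ComplexParts.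
Variable R : realType.
Local Notation C := R[i]^o.

Lemma Re_continuous : continuous (fun z : C => complex.Re z : R).
Proof.
move=> z U /nbhs_ballP[e /= e0 eU]; apply/nbhs_ballP.
exists (e%:C%C : C) => /=; first by rewrite ltcR.
move=> y; rewrite -ball_normE /= => yz; apply: eU; rewrite -ball_normE /=.
have -> : complex.Re z - complex.Re y = complex.Re (z - y) by case: z y {yz} => ? ? [].
rewrite -ltcR; apply: le_lt_trans yz; exact: normc_ge_Re.
Qed.

Lemma Im_continuous : continuous (fun z : C => complex.Im z : R).
Proof.
move=> z U /nbhs_ballP[e /= e0 eU]; apply/nbhs_ballP.
exists (e%:C%C : C) => /=; first by rewrite ltcR.
move=> y; rewrite -ball_normE /= => yz; apply: eU; rewrite -ball_normE /=.
have -> : complex.Im z - complex.Im y = - complex.Re ('i%C * (z - y)).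
  by case: z y {yz} => a b [] c d' /=; rewrite mul0r mul1r sub0r opprK.
rewrite normrN -ltcR; apply: le_lt_trans yz; apply: le_trans (normc_ge_Re _) _.
by rewrite normrM normCi mul1r.
Qed.

Lemma Re_linear (c : R) (z w : C) :
  complex.Re ((c%:C%C : C) *: z + w) = c * complex.Re z + complex.Re w.
Proof. by case: z w => a b [e f] /=; rewrite mul0r subr0. Qed.

Lemma Re_cexp_i (z : R[i]) :
  complex.Re (cexp ('i%C * z)) = expR (- complex.Im z) * cos (complex.Re z).
Proof. by case: z => a b; rewrite /cexp /= !mul0r !mul1r ?sub0r ?add0r ?subr0. Qed.

(** As 1 - cos t is |1 - e^(it)|^2 / 2, this is the triangle inequality between the points 1, e^(ix)
    and e^(i(x+y)), squared. It shows that two trivial characteristic functions force a third one to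
    be trivial. *)
Lemma one_sub_cos_le (x y : R) : 1 - cos y <= 2 * (1 - cos x) + 2 * (1 - cos (x + y)).
Proof.
have h (t : R) : 1 - cos t = 2 * sin (t / 2) ^+ 2.
  rewrite [in LHS](splitr t) -mulr2n cos_mulr2n; have := cos2Dsin2 (t / 2).
  move: (cos _ ^+ 2) (sin _ ^+ 2) => a b; lra.
rewrite !h; have -> : y / 2 = (x + y) / 2 - x / 2 by lra.
rewrite sinB; have := cos2Dsin2 ((x + y) / 2); have := cos2Dsin2 (x / 2).
move: (sin ((x + y) / 2)) (cos ((x + y) / 2)) (sin (x / 2)) (cos (x / 2)) => a b c e H1 H2.
have : 0 <= (a * e + b * c) ^+ 2 by exact: sqr_ge0.
have -> : 2 * c ^+ 2 = 2 * c ^+ 2 * (b ^+ 2 + a ^+ 2) by rewrite H2 mulr1.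
have -> : 2 * a ^+ 2 = 2 * a ^+ 2 * (e ^+ 2 + c ^+ 2) by rewrite H1 mulr1.
nra.
Qed.

Lemma pinv_out (T U : Type) (dflt : U -> T) (X : set T) (f : T -> U) y :
  ~ (f @` X) y -> 'pinv_dflt X f y = dflt y.
Proof.
by move=> H; rewrite /pinv_ splitV (oinv_surj (fun _ => id)); case: pselect.
Qed.

End ComplexParts.

Section GaussianField.
Variables (R : realType) (M : ptopologicalType) (d : nat).
Variables (A : smooth_atlas R M d) (g : riemannian_metric A).
Hypothesis hM : hausdorff_space M.
Hypothesis cM : compact [set: M].
Variable vol : {measure set (borel M) -> \bar R}.
Hypothesis volP : is_riemannian_volume g vol.
Variable Gamma : probability (borel (schwartz_dist A)) R.
Hypothesis GFF : is_gaussian_free_field g vol Gamma.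
Implicit Types (u v p w : M -> R) (B : schwartz_dist A).
Local Notation C := R[i]^o.

Let oC (i : chart A) : open (chart_cod i) := @chart_cod_open R M d A i.

Fact real_smooth u : rsmooth A u -> (fun m => (u m)%:C%C : C) \in smooth_pred A.
Proof.
move=> su; apply/smoothP => i; split; first exact: (su i).
exact: (smooth_on_cst 0 (@oC i)).
Qed.

(* The junk value 0 is taken when u is not smooth. *)
Definition rtest u : testfun A :=
  if pselect (rsmooth A u) is left su then Testfun (real_smooth su) else 0.

Lemma rtestE u m : rsmooth A u -> rtest u m = (u m)%:C%C.
Proof. by move=> su; rewrite /rtest; case: pselect. Qed.

Lemma rsmooth_Re (v : testfun A) : rsmooth A (fun m => complex.Re (v m)).
Proof. by have /smoothP s := testfun_smooth v; move=> i; case: (s i) => h _; exact: h. Qed.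

Lemma rsmooth_Im (v : testfun A) : rsmooth A (fun m => complex.Im (v m)).
Proof. by have /smoothP s := testfun_smooth v; move=> i; case: (s i) => _ h; exact: h. Qed.

Lemma one_plus_laplacianE (v : testfun A) m : one_plus_laplacian g v m =
  ((complex.Re (v m) + rlap g (fun m => complex.Re (v m)) m) +i*
   (complex.Im (v m) + rlap g (fun m => complex.Im (v m)) m))%C.
Proof. by rewrite /one_plus_laplacian fctE; case: (v m). Qed.

(** The real relation behind [covariance]: it has no default value, so being in the range of 1 + L
    becomes an explicit existence statement. *)
Definition resolves w p := rsmooth A w /\ forall m, w m + rlap g w m = p m.

Lemma resolves_linear (c : R) w p w' p' : resolves w p -> resolves w' p' ->
  resolves (fun m => c * w m + w' m) (fun m => c * p m + p' m).
Proof.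
move=> [sw wp] [sw' wp']; split; first exact: (rsmoothD (rsmoothZ c sw) sw').
move=> m; rewrite (rlap_linear _ _ _ sw sw') -wp -wp' mulrDr; exact: addrACA.
Qed.

Lemma resolves_inj w w' p : resolves w p -> resolves w' p -> w = w'.
Proof.
move=> rw rw'; have [s0 H] := resolves_linear (-1) rw rw'.
apply/funext => m; apply/esym/eqP; rewrite -subr_eq0 -mulN1r addrC; apply/eqP.
have H0 m' : -1 * w m' + w' m' + rlap g (fun m => -1 * w m + w' m) m' = 0.
  by rewrite H mulN1r addNr.
exact: (resolvent_unique hM cM s0 H0 m).
Qed.

Lemma resolves_smooth w p : resolves w p -> rsmooth A p.
Proof.
move=> [sw wp]; have -> : p = (fun m => w m + rlap g w m) by apply/funext => m; rewrite wp.
exact: (rsmoothD sw (rsmooth_rlap hM volP sw)).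
Qed.

Lemma resolves0 : resolves (fun=> 0) (fun=> 0).
Proof.
split; first exact: rsmooth_cst.
by move=> m; rewrite add0r; exact: (rlap_out g hM compact0).
Qed.

(** The pseudo-inverse returns some complex solution. Its real and imaginary parts solve the
    equation with right-hand sides [p] and 0, and uniqueness identifies them. *)
Lemma covarianceE p w : resolves w p -> forall m, Defs.covariance g (rtest p) m = (w m)%:C%C.
Proof.
move=> rw; have sp := resolves_smooth rw; have [sw wp] := rw.
pose v := Defs.covariance g (rtest p).
have H : one_plus_laplacian g v = rtest p.
  apply: pinvK; apply/mem_set; exists (rtest w) => //.
  apply/funext => m; apply: (etrans (one_plus_laplacianE _ m)).
  apply/esym/(etrans (rtestE m sp))/esym.
  have -> : (fun m => complex.Re (rtest w m)) = w by apply/funext => m'; rewrite (rtestE _ sw).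
  have -> : (fun m => complex.Im (rtest w m)) = (fun=> 0) by apply/funext => m'; rewrite (rtestE _ sw).
  have [_ /(_ m)] := resolves0; rewrite add0r => ->; rewrite addr0 -wp.
  by have -> : rtest w m = (w m)%:C%C by exact: rtestE.
have Hm m : one_plus_laplacian g v m = (p m)%:C%C by rewrite H (rtestE m sp).
have r1 : resolves (fun m => complex.Re (v m)) p.
  split; first exact: rsmooth_Re.
  by move=> m; have := Hm m; rewrite one_plus_laplacianE => -[].
have r2 : resolves (fun m => complex.Im (v m)) (fun=> 0).
  split; first exact: rsmooth_Im.
  by move=> m; have := Hm m; rewrite one_plus_laplacianE => -[].
move=> m; have := congr1 (@^~ m) (resolves_inj r1 rw).
have := congr1 (@^~ m) (resolves_inj r2 resolves0).
by rewrite -/v /=; case: (v m) => a b /= -> ->.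
Qed.

Lemma covariance_out p : rsmooth A p -> ~ (exists w, resolves w p) ->
  Defs.covariance g (rtest p) = 0.
Proof.
move=> sp H; rewrite /Defs.covariance pinv_out// => -[v _ vp]; apply: H.
exists (fun m => complex.Re (v m)); split; first exact: rsmooth_Re.
move=> m; have := congr1 (fun f => complex.Re (f m)) vp.
by rewrite one_plus_laplacianE (rtestE m sp).
Qed.

(** The real part makes this a real random variable for every [B]; for almost every [B] it discards
    nothing. *)
Definition phase u B : R := complex.Re (B (rtest u)).

Lemma eval_continuous_dist (f : testfun A) : continuous (fun B : schwartz_dist A => B f : C).
Proof.
move=> B; apply: (@continuous_comp _ _ _ (fun B : schwartz_dist A => (B : testfun A -> C) : {ptws testfun A -> C}) (fun h => h f)).
  exact: initial_continuous.
exact: (@proj_continuous (testfun A) (fun=> C) f).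
Qed.

Lemma phase_continuous u : continuous (phase u).
Proof.
move=> B; apply: (continuous_comp (@eval_continuous_dist _ B)); exact: Re_continuous.
Qed.

Lemma measurable_phase u : measurable_fun [set: borel (schwartz_dist A)] (phase u).
Proof. by apply: continuous_measurable_borel; exact: phase_continuous. Qed.

Lemma phaseD (c : R) u v B : rsmooth A u -> rsmooth A v ->
  phase (fun m => c * u m + v m) B = c * phase u B + phase v B.
Proof.
move=> su sv; rewrite /phase.
have -> : rtest (fun m => c * u m + v m) = (c%:C%C : C) *: rtest u + rtest v.
  apply/val_inj/funext => m /=; rewrite rtestE; last exact: (rsmoothD (rsmoothZ c su) sv).
  transitivity ((c%:C%C : C) * rtest u m + rtest v m) => //.
  transitivity ((c%:C%C : C) * (u m)%:C%C + (v m)%:C%C); first by rewrite rmorphD rmorphM.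
  by congr (_ * _ + _); apply/esym/rtestE.
rewrite linearP; exact: Re_linear.
Qed.

Definition chf u : R := (\int[Gamma]_B cos (phase u B))%R.

Lemma integrable_prob (f : borel (schwartz_dist A) -> R) (b : R) :
  measurable_fun setT f -> (forall B, `|f B| <= b) -> Gamma.-integrable setT (EFin \o f).
Proof.
move=> mf fb; apply: measurable_bounded_integrable => //.
  by apply: fin_num_fun_lty; exact: fin_num_measure.
exists b; split; first exact: num_real.
by move=> x bx y _; apply: le_trans (fb y) _; exact: ltW.
Qed.

Lemma measurable_cos_phase u : measurable_fun [set: borel (schwartz_dist A)] (fun B => cos (phase u B)).
Proof.
apply: measurableT_comp; last exact: measurable_phase.
apply: continuous_measurable_fun; exact: continuous_cos.
Qed.

Lemma integrable_cos u : Gamma.-integrable setT (EFin \o (fun B => cos (phase u B))).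
Proof.
apply: (@integrable_prob _ 1); first exact: measurable_cos_phase.
by move=> B; rewrite ler_norml cos_geN1 cos_le1.
Qed.

Lemma chf_le1 u : chf u <= 1.
Proof.
have -> : 1 = (\int[Gamma]_B (cst 1 B : R))%R :> R.
  rewrite (@Rintegral_cst _ _ _ Gamma)// mul1r.
  exact: (congr1 fine (esym (probability_setT Gamma))).
apply: le_Rintegral => //; first exact: integrable_cos.
  by apply: (@integrable_prob _ 1) => // B; rewrite normr1.
by move=> B _; exact: cos_le1.
Qed.

Lemma chfE u : rsmooth A u ->
  chf u = complex.Re (cexp (- (2^-1 * l2_inner vol (rtest u) (Defs.covariance g (rtest u))))).
Proof.
move=> su; have [aeR H] := GFF.
have ru : real_testfun (rtest u) by move=> m; rewrite rtestE.
rewrite -(H _ ru) /= /chf /Rintegral; congr fine.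
have ReE B : complex.Re (cexp ('i%C * B (rtest u))) =
    expR (- complex.Im (B (rtest u))) * cos (phase u B).
  exact: Re_cexp_i.
(* Values are real only almost surely; for other [B] a factor exp(- Im) remains, so the two
   integrands agree just almost everywhere. *)
apply: ae_eq_integral => //.
- apply/measurable_EFinP; exact: measurable_cos_phase.
- apply/measurable_EFinP; rewrite (eq_fun ReE).
  apply: measurable_funM; last exact: measurable_cos_phase.
  apply: measurableT_comp; first exact: measurable_expR.
  apply: measurableT_comp; first exact: oppr_measurable.
  apply: continuous_measurable_borel => B.
  by apply: (continuous_comp (@eval_continuous_dist _ B)); exact: Im_continuous.
- apply: negligibleS aeR => B /= nB /(_ _ ru) IB; apply: nB => _.
  by congr EFin; apply/esym/(etrans (ReE B)); rewrite IB oppr0 expR0 mul1r.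
Qed.

Lemma chf_resolved w p : resolves w p ->
  chf p = expR (- (2^-1 * mint vol (fun m => p m * w m))).
Proof.
move=> rw; have sp := resolves_smooth rw; rewrite chfE//.
have cE := covarianceE rw.
have E m : rtest p m * conjc (Defs.covariance g (rtest p) m) = (p m * w m)%:C%C.
  by rewrite rtestE// cE /conjc /= /(_%:C)%C; simpc.
rewrite /l2_inner /cintegral.
have -> : (\int[vol]_x complex.Re (rtest p x * conjc (Defs.covariance g (rtest p) x)))%R
   = mint vol (fun m => p m * w m).
  by apply: eq_Rintegral => m _; rewrite E.
have -> : (\int[vol]_x complex.Im (rtest p x * conjc (Defs.covariance g (rtest p) x)))%R = 0.
  transitivity ((\int[vol]_x (cst 0 x : R))%R); last by rewrite /Rintegral integral0.
  by apply: eq_Rintegral => m _; rewrite E.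
rewrite /cexp; move: (mint _ _) => V.
have -> : 2^-1%C = (2^-1 : R)%:C%C by rewrite rmorphV//= ?rmorphMn//= unitfE pnatr_eq0.
by simpc => /=; rewrite cos0 mulr1.
Qed.

Lemma chf_unresolved p : rsmooth A p -> ~ (exists w, resolves w p) -> chf p = 1.
Proof.
move=> sp H; rewrite chfE// covariance_out//.
have E m : rtest p m * conjc ((0 : testfun A) m) = 0 by rewrite conjc0 mulr0.
have -> : l2_inner vol (rtest p) (0 : testfun A) = 0.
  rewrite /l2_inner /cintegral.
  have Z : (\int[vol]_x (cst 0 x : R))%R = 0 by rewrite /Rintegral integral0.
  by congr (_ +i* _)%C; rewrite -[RHS]Z; apply: eq_Rintegral => m _; rewrite E.
by rewrite mulr0 oppr0 /cexp /= expR0 cos0 mulr1 mul0r subr0.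
Qed.

End GaussianField.

(** * Lower bounds for variances and small ball probabilities *)

Section SmallBall.
Variables (R : realType) (M : ptopologicalType) (d : nat).
Variables (A : smooth_atlas R M d) (g : riemannian_metric A).
Hypothesis hM : hausdorff_space M.
Hypothesis cM : compact [set: M].
Variable vol : {measure set (borel M) -> \bar R}.
Hypothesis volP : is_riemannian_volume g vol.
Variable Gamma : probability (borel (schwartz_dist A)) R.
Hypothesis GFF : is_gaussian_free_field g vol Gamma.
Implicit Types (u v p w : M -> R) (B : schwartz_dist A).

Local Notation chf := (chf Gamma).
Local Notation mint := (mint vol).

Definition helmholtz w : M -> R := fun m => w m + rlap g w m.

Lemma helmholtz_resolves w : rsmooth A w -> resolves g w (helmholtz w).
Proof. by []. Qed.

(** The integrated form of [one_sub_cos_le]. It assumes nothing on resolvents, so it applies to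
    functions that might lie outside the range of 1 + L. *)
Lemma chf_sub (x y : M -> R) : rsmooth A x -> rsmooth A y ->
  1 - chf y <= 2 * (1 - chf x) + 2 * (1 - chf (fun m => 1 * x m + y m)).
Proof.
move=> sx sy.
have I1 : Gamma.-integrable setT (EFin \o (fun _ : borel (schwartz_dist A) => 1 : R)).
  by apply: (@integrable_prob _ _ _ _ _ _ 1) => // B; rewrite normr1.
have E1 : (\int[Gamma]_B (cst 1 B : R))%R = 1.
  rewrite (@Rintegral_cst _ _ _ Gamma)// mul1r.
  exact: (congr1 fine (probability_setT Gamma)).
have IB u : Gamma.-integrable setT (EFin \o (fun B => 1 - cos (phase u B))).
  by have := integrableB measurableT I1 (integrable_cos Gamma u).
have EB u : (\int[Gamma]_B (1 - cos (phase u B)))%R = 1 - chf u.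
  by rewrite RintegralB//; [congr (_ - _)|exact: integrable_cos].
have I2 u : Gamma.-integrable setT (EFin \o (fun B => 2 * (1 - cos (phase u B)))).
  by have := integrableZl measurableT 2 (IB u).
have E2 u : (\int[Gamma]_B (2 * (1 - cos (phase u B))))%R = 2 * (1 - chf u).
  exact: (etrans (RintegralZl 2 measurableT (IB u)) (congr1 (fun z => 2 * z) (EB u))).
pose z m := 1 * x m + y m.
have E3 := RintegralD measurableT (I2 x) (I2 z).
have I3 : Gamma.-integrable setT
    (EFin \o (fun B => 2 * (1 - cos (phase x B)) + 2 * (1 - cos (phase z B)))).
  exact: (integrableD measurableT (I2 x) (I2 z)).
have L : (\int[Gamma]_B (1 - cos (phase y B)) <=
    \int[Gamma]_B (2 * (1 - cos (phase x B)) + 2 * (1 - cos (phase z B))))%R.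
  apply: (le_Rintegral measurableT (IB y) I3) => B _.
  rewrite (phaseD 1 B sx sy) mul1r; exact: one_sub_cos_le.
have E4 : 2 * (1 - chf x) + 2 * (1 - chf z) = _ := esym (etrans E3 (congr2 _ (E2 x) (E2 z))).
rewrite -/z E4 -(EB y); exact: L.
Qed.

(** Any bump works: by Green's formula its energy is the integral of its square plus a nonnegative
    gradient term. *)
Lemma positive_energy : exists2 w, rsmooth A w & 0 < mint (fun m => helmholtz w m * w m).
Proof.
have i0 := chart_atP A (point : M); set i := chart_at A _ in i0.
have [r r0 rC] := open_box (@chart_cod_open R M d A i) (chart_mapP i0).
set q := chart_map i _ in rC.
have ri0 : 0 < r^-1 by rewrite invr_gt0.
have rC' : box q r^-1^-1 `<=` chart_cod i by rewrite invrK.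
pose w := mbump i q r^-1.
have sw : rsmooth A w by exact: (mbump_smooth hM ri0 rC').
have mw : msup i w by exact: (mbump_msup ri0 rC').
exists w => //.
have c1 : cint i (fun m => w m * w m) by apply: cint_smooth; [exact: msupMl|exact: (rsmoothM sw sw)].
have c2 : cint i (fun m => w m * rlap g w m).
  by apply: cint_smooth; [exact: msupMl|exact: (rsmoothM sw (rsmooth_rlap hM volP sw))].
have -> : (fun m => helmholtz w m * w m) = (fun m => w m * w m + w m * rlap g w m).
  by apply/funext => m; rewrite mulrDl; congr (_ + _); exact: mulrC.
rewrite (mintD hM volP c1 c2).
have [-> _] := green_rlap hM volP sw sw mw.
apply: ltr_wpDr; first by apply: mint_ge0 => m; exact: rgam_ge0.
apply: (mint_gt0 hM volP (m := point) c1) => [m|].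
  by rewrite -expr2; exact: sqr_ge0.
have -> : w point = 1 by rewrite /w mbump_dom// sbump_center.
by rewrite mulr1.
Qed.

(* The variance of the field would vanish at p and at p + (1 + L)w, hence at
   (1 + L)w, if p was not in the range of 1 + L. *)
Lemma helmholtz_surjective p : rsmooth A p -> exists w, resolves g w p.
Proof.
move=> sp; apply: contrapT => H.
have [w sw E0] := positive_energy.
have rw := helmholtz_resolves sw; have st := resolves_smooth hM volP rw.
have H1 : ~ exists v, resolves g v (fun m => 1 * p m + helmholtz w m).
  move=> [v rv]; apply: H; exists (fun m => (-1) * w m + v m).
  have := resolves_linear (-1) rw rv.
  by congr resolves; apply/funext => m; rewrite mul1r mulN1r addrC addrK.
have s1 : rsmooth A (fun m => 1 * p m + helmholtz w m) by exact: (rsmoothD (rsmoothZ 1 sp) st).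
have := chf_sub sp st.
rewrite (chf_unresolved GFF sp H) (chf_unresolved GFF s1 H1).
rewrite (chf_resolved hM cM volP GFF rw) subrr mulr0 addr0 leNgt => /negP; apply.
by rewrite subr_gt0 expR_lt1 oppr_lt0 mulr_gt0// invr_gt0.
Qed.

(* The quadratic polynomial in t giving the variance at p + t(1 + L)w is
   nonnegative; it is evaluated at t = - (2e)^-1. *)
Lemma variance_lower (i : chart A) p u w (e : R) : rsmooth A p -> msup i p -> resolves g u p ->
  rsmooth A w -> msup i w -> 0 < e -> 2^-1 <= mint (fun m => p m * w m) ->
  mint (fun m => w m * helmholtz w m) <= e ->
  (4 * e)^-1 <= mint (fun m => p m * u m).
Proof.
move=> sp mp ru sw mw e0 pw Ew.
pose t : R := - (2 * e)^-1.
have rw := helmholtz_resolves sw; have sh := resolves_smooth hM volP rw.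
have mh : msup i (helmholtz w) by apply: msupD => //; exact: (msup_rlap g hM mw).
have su : rsmooth A u by case: ru.
have rl := resolves_linear t rw ru.
have := chf_le1 Gamma (fun m => t * helmholtz w m + p m).
rewrite (chf_resolved hM cM volP GFF rl) expR_le1 oppr_le0 pmulr_rge0 ?invr_gt0//.
have c1 : cint i (fun m => w m * helmholtz w m) by apply: cint_smooth; [exact: msupMl|exact: (rsmoothM sw sh)].
have c2 : cint i (fun m => p m * w m) by apply: cint_smooth; [exact: msupMl|exact: (rsmoothM sp sw)].
have c3 : cint i (fun m => helmholtz w m * u m) by apply: cint_smooth; [exact: msupMl|exact: (rsmoothM sh su)].
have c4 : cint i (fun m => p m * u m) by apply: cint_smooth; [exact: msupMl|exact: (rsmoothM sp su)].
(* Symmetry of 1 + L: applied to [w] and tested on [u], it equals [w] tested on (1 + L)u, which is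
   [p]. *)
have E3 : mint (fun m => helmholtz w m * u m) = mint (fun m => p m * w m).
  have ca : cint i (fun m => w m * u m) by apply: cint_smooth; [exact: msupMl|exact: (rsmoothM sw su)].
  have cb : cint i (fun m => w m * rlap g u m).
    by apply: cint_smooth; [exact: msupMl|exact: (rsmoothM sw (rsmooth_rlap hM volP su))].
  have cc : cint i (fun m => u m * rlap g w m).
    apply: cint_smooth; first by apply: msupMr; exact: (msup_rlap g hM mw).
    exact: (rsmoothM su (rsmooth_rlap hM volP sw)).
  transitivity (mint (fun m => w m * u m + u m * rlap g w m)).
    by congr mint; apply/funext => m; rewrite mulrDl; congr (_ + _); exact: mulrC.
  transitivity (mint (fun m => w m * u m + w m * rlap g u m)); last first.
    by congr mint; apply/funext => m; have [_ <-] := ru; rewrite -mulrDr mulrC.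
  have [G1 G2] := green_rlap hM volP sw su mw.
  apply: (etrans (mintD hM volP ca cc)); apply/esym/(etrans (mintD hM volP ca cb)).
  exact: (congr1 (fun z => mint (fun m => w m * u m) + z) (etrans G1 (esym G2))).
have -> : mint (fun m => (t * helmholtz w m + p m) * (t * w m + u m)) =
    t ^+ 2 * mint (fun m => w m * helmholtz w m) + 2 * t * mint (fun m => p m * w m)
    + mint (fun m => p m * u m).
  transitivity (mint (fun m => t ^+ 2 * (w m * helmholtz w m) +
     (t * (helmholtz w m * u m) + (t * (p m * w m) + p m * u m)))).
    by congr mint; apply/funext => m; move: (helmholtz w m) (w m) (u m) (p m) => a b x y; ring.
  apply: (etrans (mintD hM volP (cintZ _ c1) (cintD (cintZ _ c3) (cintD (cintZ _ c2) c4)))).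
  apply: (etrans (congr2 +%R (mintZ hM volP _ c1)
    (etrans (mintD hM volP (cintZ _ c3) (cintD (cintZ _ c2) c4))
    (congr2 +%R (mintZ hM volP _ c3) (etrans (mintD hM volP (cintZ _ c2) c4)
    (congr1 (fun z => z + mint (fun m => p m * u m)) (mintZ hM volP _ c2))))))).
  rewrite E3; set a := mint _; set b := mint _; set x := mint _; ring.
move: Ew pw; move: (mint _) (mint _) (mint _) => V I E Ew pw H.
(* From V + 2tI + t^2 E >= 0 with I >= 1/2, E <= e and t <= 0 follows V >= - t - t^2 e, whose
   maximum over t is 1/(4e), at the chosen t. *)
have H1 : t ^+ 2 * E <= t ^+ 2 * e by apply: ler_wpM2l => //; exact: sqr_ge0.
have H2 : - (2 * t * I) >= - t.
  have t0 : t <= 0 by rewrite oppr_le0 invr_ge0 mulr_ge0// ltW.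
  by rewrite -[leRHS]opprK; nra.
have -> : (4 * e)^-1 = - t - t ^+ 2 * e.
  by rewrite /t; field; rewrite gt_eqF.
lra.
Qed.

Lemma phaseZ (s : R) u B : rsmooth A u -> phase (fun m => s * u m) B = s * phase u B.
Proof.
move=> su; have -> : (fun m => s * u m) = (fun m => (s - 1) * u m + u m).
  by apply/funext => m; rewrite mulrBl mul1r subrK.
by rewrite (phaseD _ _ su su) mulrBl mul1r subrK.
Qed.

Lemma resolvesZ (s : R) w p : resolves g w p ->
  resolves g (fun m => s * w m) (fun m => s * p m).
Proof.
move=> rw; have := resolves_linear s rw (resolves0 g hM).
have E f : (fun m => s * f m + 0) = (fun m : M => s * f m) by apply/funext => m; rewrite addr0.
by rewrite !E.
Qed.

Lemma cos_phase_scale (i : chart A) p u (s : R) : rsmooth A p -> msup i p -> resolves g u p ->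
  (\int[Gamma]_B cos (s * phase p B))%R =
  expR (- (2^-1 * (s ^+ 2 * mint (fun m => p m * u m)))).
Proof.
move=> sp mp ru; have su : rsmooth A u by case: ru.
have -> : (fun B => cos (s * phase p B)) = (fun B => cos (phase (fun m => s * p m) B)).
  by apply/funext => B; rewrite phaseZ.
apply: (etrans (chf_resolved hM cM volP GFF (resolvesZ s ru))).
congr (expR (- (_ * _))).
have c4 : cint i (fun m => p m * u m) by apply: cint_smooth; [exact: msupMl|exact: (rsmoothM sp su)].
rewrite -(mintZ hM volP _ c4); congr mint; apply/funext => m.
by move: (p m) (u m) => a b; ring.
Qed.

Lemma integrable_cos_scale p (s : R) : rsmooth A p ->
  Gamma.-integrable setT (EFin \o (fun B => cos (s * phase p B))).
Proof.
move=> sp; have -> : (fun B => cos (s * phase p B)) = (fun B => cos (phase (fun m => s * p m) B)).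
  by apply/funext => B; rewrite phaseZ.
exact: integrable_cos.
Qed.

Lemma Rintegral_bigsum (I : Type) (r : seq I) (f : I -> borel (schwartz_dist A) -> R) :
  (forall k, Gamma.-integrable setT (EFin \o f k)) ->
  Gamma.-integrable setT (EFin \o (fun B => \sum_(k <- r) f k B)) /\
  (\int[Gamma]_B \sum_(k <- r) f k B)%R = \sum_(k <- r) (\int[Gamma]_B f k B)%R.
Proof.
move=> fi; elim: r => [|k r [IH1 IH2]].
  have -> : (fun B => \sum_(k <- [::]) f k B) = cst 0 by apply/funext => B; rewrite big_nil.
  split; first exact: integrable0.
  by rewrite big_nil /Rintegral integral0.
have -> : (fun B => \sum_(j <- k :: r) f j B) = (fun B => f k B + \sum_(j <- r) f j B).
  by apply/funext => B; rewrite big_cons.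
split; first exact: (integrableD measurableT (fi k) IH1).
by rewrite big_cons (RintegralD measurableT (fi k) IH1) IH2.
Qed.

Lemma cosM (x y : R) : cos x * cos y = 2^-1 * (cos (x - y) + cos (x + y)).
Proof. by rewrite cosB cosD; move: (cos x) (cos y) (sin x) (sin y) => a b c e; lra. Qed.

Lemma cos_ge_half : exists2 e : R, 0 < e & forall x, `|x| <= e -> 2^-1 <= cos x.
Proof.
have : \forall x \near (0 : R), 2^-1 < cos x.
  by apply: (cvgr_gt _ (@continuous_cos R 0)); rewrite cos0 invf_lt1// ltr1n.
move=> /nbhs_ballP[e /= e0 H]; exists (e / 2); first by rewrite divr_gt0.
move=> x xe; apply/ltW/H; rewrite -ball_normE /= sub0r normrN.
by apply: le_lt_trans xe _; rewrite ltr_pdivrMr// ltr_pMr// ltr1n.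
Qed.

(* The mean of cos(k t X) over 1 <= k <= N.+1 is at least 1/2 when |X| <= c and
   t = e / (N.+1 c), while its second moment is small when X has large variance. *)
Lemma small_ball : exists2 e : R, 0 < e & forall (i : chart A) p u c N,
  rsmooth A p -> msup i p -> resolves g u p -> 0 < c ->
  0 <= mint (fun m => p m * u m) ->
  (Gamma [set B | (`|phase p B| <= c)%R] <=
   (4 * ((2 * N.+1%:R)^-1 +
     expR (- (2^-1 * ((e / (N.+1%:R * c)) ^+ 2 * mint (fun m => (p m * u m)%R))))))%:E)%E.
Proof.
have [e e0 He] := cos_ge_half; exists e => // i p u c N sp mp ru c0.
move V : (mint (fun m => p m * u m)) => v v0.
set t := e / (N.+1%:R * c); set S := [set B | _].
have N0 : 0 < N.+1%:R :> R by rewrite ltr0n.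
have t0 : 0 < t by rewrite divr_gt0// mulr_gt0.
pose eta := expR (- (2^-1 * (t ^+ 2 * v))).
have mS : measurable (S : set (borel (schwartz_dist A))).
  have -> : S = setT `&` phase p @^-1` `[- c, c]%classic.
    by rewrite setTI; apply/seteqP; split => B; rewrite /S /= in_itv /= ler_norml.
  by apply: (measurable_phase p).
pose f (kl : 'I_N.+1 * 'I_N.+1) (B : borel (schwartz_dist A)) :=
  cos (kl.1.+1%:R * t * phase p B) * cos (kl.2.+1%:R * t * phase p B).
pose D (kl : 'I_N.+1 * 'I_N.+1) : R := (kl.1.+1%:R - kl.2.+1%:R) * t.
pose P (kl : 'I_N.+1 * 'I_N.+1) : R := (kl.1.+1%:R + kl.2.+1%:R) * t.
have fE kl : f kl = (fun B => 2^-1 * (cos (D kl * phase p B) + cos (P kl * phase p B))).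
  by apply/funext => B; rewrite /f cosM /D /P !mulrBl !mulrDl.
have fi0 kl : Gamma.-integrable setT (EFin \o (fun B => cos (D kl * phase p B) + cos (P kl * phase p B))).
  exact: (integrableD measurableT (integrable_cos_scale _ sp) (integrable_cos_scale _ sp)).
have fi kl : Gamma.-integrable setT (EFin \o f kl).
  by rewrite fE; exact: (integrableZl measurableT 2^-1 (fi0 kl)).
have scale (s : R) : 1 <= s ^+ 2 -> expR (- (2^-1 * ((s * t) ^+ 2 * v))) <= eta.
  move=> s1; rewrite /eta [(s * t) ^+ 2]exprMn; have := sqr_ge0 t.
  move: (t ^+ 2) (s ^+ 2) s1 => a b b1 a0.
  by rewrite ler_expR lerN2 ler_pM2l ?invr_gt0// ler_wpM2r// ler_peMl.
(* Off the diagonal, both the difference and the sum of the frequencies are nonzero integer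
   multiples of t, so [scale] applies. On the diagonal the difference vanishes and leaves 1/2, but
   only N + 1 of the (N + 1)^2 pairs are diagonal. *)
have fI kl : (\int[Gamma]_B f kl B)%R <= 2^-1 * (kl.1 == kl.2)%:R + eta.
  rewrite fE (RintegralZl _ measurableT (fi0 kl)).
  rewrite (RintegralD measurableT (integrable_cos_scale _ sp) (integrable_cos_scale _ sp)).
  rewrite !(cos_phase_scale _ sp mp ru) V.
  have h1 : expR (- (2^-1 * (P kl ^+ 2 * v))) <= eta.
    by apply: scale; rewrite exprn_ege1// -natrD ler1n addnS.
  have h2 : expR (- (2^-1 * (D kl ^+ 2 * v))) <= (kl.1 == kl.2)%:R + eta.
    have [E|E] := eqVneq kl.1 kl.2.
      apply: (@le_trans _ _ 1); last by rewrite lerDl expR_ge0.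
      have := sqr_ge0 (D kl); move: (D kl ^+ 2) => a a0.
      by rewrite expR_le1 oppr_le0; do 2 apply: mulr_ge0 => //; rewrite ?invr_ge0.
    rewrite add0r; apply: scale; rewrite -real_normK ?num_real// exprn_ege1//.
    have [kl'|kl'] := leqP kl.1.+1 kl.2.+1.
      rewrite distrC ger0_norm ?subr_ge0 ?ler_nat// -natrB// ler1n subn_gt0.
      by rewrite ltn_neqAle kl' andbT eqSS.
    by rewrite ger0_norm ?subr_ge0 ?ler_nat 1?ltnW// -natrB 1?ltnW// ler1n subn_gt0.
  rewrite mulrDr; move: h1 h2; rewrite -/eta; move: (_ == _)%:R => b; lra.
have [Fi FE] := Rintegral_bigsum (index_enum _) fi.
(* Chebyshev's inequality before integration: on [S] each of the N + 1 cosines is at least 1/2, and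
   the double sum is the square of their sum. *)
have SF B : \1_S B * (4^-1 * N.+1%:R ^+ 2) <= \sum_kl f kl B.
  have -> : \sum_kl f kl B = (\sum_(k < N.+1) cos (k.+1%:R * t * phase p B)) ^+ 2.
    rewrite -(pair_bigA _ (fun k l => f (k, l) B)) expr2 mulr_suml /=.
    by apply: eq_bigr => k _; rewrite mulr_sumr.
  rewrite indicE; have [/set_mem SB|_] := boolP (B \in S); last by rewrite mul0r sqr_ge0.
  rewrite mul1r; have -> : 4^-1 * N.+1%:R ^+ 2 = (2^-1 * N.+1%:R) ^+ 2 :> R.
    by rewrite exprMn; congr (_ * _); lra.
  have H : 2^-1 * N.+1%:R <= \sum_(k < N.+1) cos (k.+1%:R * t * phase p B).
    have -> : 2^-1 * N.+1%:R = \sum_(k < N.+1) (2^-1 : R).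
      by rewrite sumr_const card_ord mulr_natr.
    apply: ler_sum => k _; apply: He; rewrite normrM ger0_norm; last by rewrite mulr_ge0// ltW.
    apply: (@le_trans _ _ (N.+1%:R * t * c)).
      have kt : k.+1%:R * t <= N.+1%:R * t by apply: ler_wpM2r; [exact: ltW|rewrite ler_nat].
      have kt0 : 0 <= k.+1%:R * t by apply: mulr_ge0 => //; exact: ltW.
      exact: (ler_pM kt0 (normr_ge0 _) kt SB).
    rewrite le_eqVlt; apply/orP; left; apply/eqP; rewrite /t.
    by move: (N.+1%:R : R) N0 => n n0; field; rewrite !gt_eqF.
  by rewrite ler_pXn2r// nnegrE ?mulr_ge0 ?invr_ge0//; apply: le_trans H; rewrite ?mulr_ge0 ?invr_ge0.
have Si : Gamma.-integrable setT (EFin \o (\1_S : borel (schwartz_dist A) -> R)).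
  by apply: (@integrable_prob _ _ _ _ _ _ 1) => // B; rewrite indicE; case: (_ \in _); rewrite ?normr1 ?normr0.
have SI : (\int[Gamma]_B (\1_S B : R))%R = fine (Gamma S).
  by rewrite /Rintegral integral_indic// setIT.
have GS : (Gamma S) = (fine (Gamma S))%:E by rewrite fineK// fin_num_measure.
rewrite GS lee_fin.
have L : fine (Gamma S) * (4^-1 * N.+1%:R ^+ 2) <=
    \sum_(kl : 'I_N.+1 * 'I_N.+1) (2^-1 * (kl.1 == kl.2)%:R + eta).
  rewrite -SI -(RintegralZr _ measurableT Si).
  apply: (@le_trans _ _ (\int[Gamma]_B \sum_kl f kl B)%R); last by rewrite FE; apply: ler_sum => kl _; exact: fI.
  apply: (le_Rintegral measurableT _ Fi) => //.
  exact: (integrableZr measurableT _ Si).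
have SE : \sum_(kl : 'I_N.+1 * 'I_N.+1) (2^-1 * (kl.1 == kl.2)%:R + eta) =
    2^-1 * N.+1%:R + N.+1%:R ^+ 2 * eta.
  rewrite big_split /= sumr_const card_prod card_ord -[eta *+ _]mulr_natr natrM expr2 [eta * _]mulrC.
  congr (_ + _); rewrite -mulr_sumr -(pair_bigA _ (fun k l : 'I_N.+1 => (k == l)%:R)) /=.
  rewrite (eq_bigr (fun=> 1)) ?sumr_const ?card_ord// => k _.
  by rewrite (bigD1 k)//= eqxx big1 ?addr0// => l; rewrite eq_sym => /negbTE ->.
move: L; rewrite SE; move: (fine _) N0 => q; move: (N.+1%:R : R) => n n0 L.
have -> : 4 * ((2 * n)^-1 + eta) = (2^-1 * n + n ^+ 2 * eta) / (4^-1 * n ^+ 2).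
  by field; rewrite gt_eqF.
by rewrite ler_pdivlMr// mulr_gt0 ?exprn_gt0 ?invr_gt0.
Qed.

(** The order of the choices matters: first N, which makes the diagonal term of [small_ball] at most
    t/2, then k, whose variance makes the exponential term at most t/2. The intersection lies in the
    k-th event. *)
Lemma bounded_phases_null (i : chart A) (p u : nat -> M -> R) c : 0 < c ->
  (forall k, [/\ rsmooth A (p k), msup i (p k), resolves g (u k) (p k) &
    k%:R <= mint (fun m => p k m * u k m)]) ->
  Gamma.-negligible (\bigcap_k [set B | (`|phase (p k) B| <= c)%R]).
Proof.
move=> c0 H; have [e e0 He] := small_ball.
pose S k : set (borel (schwartz_dist A)) := [set B | (`|phase (p k) B| <= c)%R].
have mS k : measurable (S k).
  have -> : S k = setT `&` phase (p k) @^-1` `[- c, c]%classic.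
    by rewrite setTI; apply/seteqP; split => B; rewrite /S /= in_itv /= ler_norml.
  by apply: (measurable_phase (p k)).
have mI : measurable (\bigcap_k S k) by exact: bigcapT_measurable.
exists (\bigcap_k S k); split => //.
apply/eqP; rewrite eq_le measure_ge0 andbT; apply/lee_addgt0Pr => /= t t0; rewrite add0e.
have [N HN] : exists N : nat, 2 * N.+1%:R^-1 <= t / 2.
  have t4 : 0 < t / 4 by rewrite divr_gt0.
  have [N _ /(_ N (leqnn N)) /= HN] := near_infty_natSinv_lt (PosNum t4).
  exists N; move: HN; move: (N.+1%:R^-1 : R) (t : R) => z t'; lra.
pose a : R := 2^-1 * (e / (N.+1%:R * c)) ^+ 2.
have a0 : 0 < a by rewrite mulr_gt0 ?invr_gt0// exprn_gt0// divr_gt0// mulr_gt0.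
(* This makes the exponent x = a v at least 8/t, and exp(-x) <= 1/x then gives at most t/8, to be
   multiplied by 4. *)
have [k Hk] : exists k : nat, 8 / (a * t) <= k%:R.
  exists (Num.bound (8 / (a * t))); apply/ltW/archi_boundP.
  by rewrite divr_ge0// mulr_ge0// ltW.
have [sp mp ru V] := H k.
have V0 : 0 <= mint (fun m => p k m * u k m) by apply: le_trans V.
apply: (@le_trans _ _ (Gamma (S k))).
  by apply: le_measure; rewrite ?inE//; apply: bigcap_inf.
apply: (le_trans (He i (p k) (u k) c N sp mp ru c0 V0)).
rewrite lee_fin; move: V; set v := mint _ => V.
have -> : 2^-1 * ((e / (N.+1%:R * c)) ^+ 2 * v) = a * v by rewrite mulrA.
have av : 8 / t <= a * v.
  have : 8 / (a * t) <= v by exact: le_trans V.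
  rewrite (ler_pdivrMr _ _ (mulr_gt0 a0 t0)) (ler_pdivrMr _ _ t0).
  by rewrite mulrA (mulrC v).
have av0 : 0 < a * v by apply: lt_le_trans av; rewrite divr_gt0.
have : expR (- (a * v)) <= t / 8.
  rewrite expRN -[t / 8]invrK lef_pV2 ?posrE ?expR_gt0 ?invr_gt0 ?divr_gt0//.
  rewrite invf_div; apply: (le_trans av); apply: le_trans (expR_ge1Dx _).
  by rewrite lerDr.
by rewrite invfM; move: HN (expR _); move: (N.+1%:R^-1 : R) (t : R) => z t' z1 y y1; lra.
Qed.

End SmallBall.

(** * Almost sure roughness *)

Section NowhereContinuous.
Variables (R : realType) (M : ptopologicalType) (d : nat).
Variables (A : smooth_atlas R M d) (g : riemannian_metric A).
Hypothesis hM : hausdorff_space M.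
Hypothesis cM : compact [set: M].
Variable vol : {measure set (borel M) -> \bar R}.
Hypothesis volP : is_riemannian_volume g vol.
Variable Gamma : probability (borel (schwartz_dist A)) R.
Hypothesis GFF : is_gaussian_free_field g vol Gamma.
Hypothesis d2 : (2 <= d)%N.
Implicit Types (i : chart A) (p w : M -> R) (B : schwartz_dist A).
Local Notation C := R[i]^o.

Let oC i : open (chart_cod i) := @chart_cod_open R M d A i.
Let oD i : open (chart_dom i) := @chart_dom_open R M d A i.

(** Division by zero returns a junk value, so two cases are glued: near a point of [K] the divisor
    does not vanish, and off the closed set [K] the numerator is zero in a neighbourhood. *)
Lemma rsmooth_div p w K : compact K -> (forall m, ~ K m -> p m = 0) ->
  (forall m, K m -> w m != 0) -> rsmooth A p -> rsmooth A w ->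
  rsmooth A (fun m => p m / w m).
Proof.
move=> cK pK wK sp sw j; apply: smooth_on_local => x jx.
have op (X : set M) : open X -> open (chart_cod j `&` chart_inv j @^-1` X).
  move=> oX; rewrite openE => y [jy Xy]; apply: filterI; first exact: open_nbhs_nbhs (conj (@oC j) jy).
  exact: (chart_inv_continuous jy (open_nbhs_nbhs (conj oX Xy))).
have [Kx|Kx] := pselect (K (chart_inv j x)).
  pose U := chart_cod j `&` chart_inv j @^-1` (w @^-1` [set y | y != 0]).
  have oU : open U.
    apply: op; apply: open_comp; first by move=> y _; exact: rsmooth_continuous.
    exact: open_neq.
  exists U; first by split; [exact: jx|exact: wK].
  have sub := @smooth_on_sub R d (chart_cod j) U.
  apply: (smooth_on_mul oU); first exact: (sub _ (@subIsetl _ _ _) (sp j)).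
  have nz y : U y -> pull j w y != 0 by case.
  exact: (smooth_on_inv oU nz (sub _ (@subIsetl _ _ _) (sw j))).
pose U := chart_cod j `&` chart_inv j @^-1` (~` K).
have oU : open U by apply: op; rewrite openC; exact: compact_closed.
exists U => //; apply: (eq_smooth_on oU) (smooth_on_cst 0 oU).
by move=> y /set_mem [_ ky]; rewrite /pull pK// mul0r.
Qed.

Lemma rough_family i q r : 0 < r -> box q r `<=` chart_cod i ->
  exists pu : nat -> (M -> R) * (M -> R), forall k,
  [/\ rsmooth A (pu k).1, forall m, 0 <= (pu k).1 m,
    forall m, ~ (chart_inv i @` box q r) m -> (pu k).1 m = 0,
    mint vol (pu k).1 = 1 &
    resolves g (pu k).2 (pu k).1 /\ k%:R <= mint vol (fun m => (pu k).1 m * (pu k).2 m)].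
Proof.
move=> r0 rC.
have ex k : exists pu : (M -> R) * (M -> R),
  [/\ rsmooth A pu.1, forall m, 0 <= pu.1 m,
    forall m, ~ (chart_inv i @` box q r) m -> pu.1 m = 0,
    mint vol pu.1 = 1 &
    resolves g pu.2 pu.1 /\ k%:R <= mint vol (fun m => pu.1 m * pu.2 m)].
  (* With this energy the lower bound (4e)^-1 of the variance is k + 1. *)
  have e0 : 0 < (4 * k.+1%:R)^-1 :> R by rewrite invr_gt0 mulr_gt0.
  have [p [w [sp p0 pK p1 [sw mw pw Ew]]]] := point_capacity hM volP d2 r0 rC e0.
  have [u ru] := helmholtz_surjective hM cM volP GFF sp.
  exists (p, u); split => //=; split => //.
  have mp : msup i p.
    exists (chart_inv i @` box q r); split => //.
      by apply: compact_inv_box => //; exact: compact_box.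
    by move=> _ [x /rC ix <-]; exact: chart_invP.
  apply: le_trans (variance_lower hM cM volP GFF sp mp ru sw mw e0 pw Ew).
  by rewrite [leRHS]invfM invrK mulrA mulVf// mul1r ler_nat.
by have [f fP] := choice ex; exists f.
Qed.

(** Write p = chi phi with phi = p conj(chi) / |chi|^2, so that B(p) is the integral of h phi. Since
    p is a probability density on [K], a bound on [K] for the real part of h / chi bounds B(p),
    uniformly in p. *)
Lemma phase_multiple (i : chart A) K B (chi : testfun A) h :
  compact K -> K `<=` chart_dom i -> (forall m, K m -> chi m != 0) ->
  continuous (h : M -> C) -> is_function vol (dist_scale chi B) h ->
  exists c, forall p, rsmooth A p -> (forall m, 0 <= p m) ->
    (forall m, ~ K m -> p m = 0) -> mint vol p = 1 -> `|phase p B| <= c.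
Proof.
move=> cK KD chi0 ch hB.
pose a m := complex.Re (chi m); pose b m := complex.Im (chi m).
pose e m := complex.Re (h m); pose f m := complex.Im (h m).
pose D m := a m ^+ 2 + b m ^+ 2.
have sa : rsmooth A a by exact: rsmooth_Re.
have sb : rsmooth A b by exact: rsmooth_Im.
have sD : rsmooth A D by exact: (rsmoothD (rsmoothM sa sa) (rsmoothM sb sb)).
have D0 m : K m -> D m != 0.
  move=> /chi0; apply: contra; rewrite paddr_eq0 ?sqr_ge0// !sqrf_eq0 /a /b.
  by rewrite eq_complex.
have ce : continuous e by move=> m; apply: (continuous_comp (ch m)); exact: Re_continuous.
have cf : continuous f by move=> m; apply: (continuous_comp (ch m)); exact: Im_continuous.
have ca := rsmooth_continuous sa; have cb := rsmooth_continuous sb.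
have cD := rsmooth_continuous sD.
(* The real part of h / chi, with denominator |chi|^2. *)
pose G m := (e m * a m + f m * b m) / D m.
have [c c0 HC] : exists2 c, 0 <= c & forall m, K m -> `|G m| <= c.
  apply: (@continuous_bounded R M K G cK).
  apply: continuous_in_subspaceT => m /set_mem Km.
  apply: (@continuousM _ M (fun m => e m * a m + f m * b m) (fun m => (D m)^-1)).
    apply: (@continuousD _ _ M (fun m => e m * a m) (fun m => f m * b m)).
      exact: (@continuousM _ M e a m (ce m) (ca m)).
    exact: (@continuousM _ M f b m (cf m) (cb m)).
  exact: (@continuousV _ M D m (D0 _ Km) (cD m)).
exists c => p sp p0 pK p1.
pose x m : R := p m * a m / D m; pose y m : R := - 1 * (p m * b m / D m).
have pK' (z : M -> R) m : ~ K m -> p m * z m = 0 by move=> /pK ->; rewrite mul0r.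
have sx : rsmooth A x.
  exact: (rsmooth_div cK (pK' a) D0 (rsmoothM sp sa) sD).
have sy : rsmooth A y.
  exact: (rsmoothZ (-1) (rsmooth_div cK (pK' b) D0 (rsmoothM sp sb) sD)).
have cx : continuous x by exact: rsmooth_continuous.
have cy : continuous y by exact: rsmooth_continuous.
have [phi phiE] : exists phi : testfun A, forall m, phi m = (x m +i* y m)%C.
  exists (rtest A x + ('i%C : C) *: rtest A y) => m.
  transitivity (rtest A x m + ('i%C : C) * rtest A y m) => //.
  transitivity ((x m)%:C%C + ('i%C : C) * (y m)%:C%C); last by simpc.
  by congr (_ + _ * _); exact: rtestE.
have chiE m : chi m = (a m +i* b m)%C by rewrite /a /b; case: (chi m).
have hE m : h m = (e m +i* f m)%C by rewrite /e /f; case: (h m).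
have pE : rtest A p = chi * phi.
  apply/val_inj/funext => m; apply: (etrans (rtestE m sp)).
  have -> : val (chi * phi) m = chi m * phi m by [].
  rewrite phiE chiE /x /y; have [Km|Km] := pselect (K m); last first.
    by rewrite pK// !mul0r mulr0; simpc.
  have := D0 m Km; rewrite /D; move: (a m) (b m) (p m) => a' b' p' h0.
  by apply/eqP; rewrite eq_complex /=; apply/andP; split; apply/eqP; field.
pose F m := e m * x m - f m * y m.
have FE : phase p B = mint vol F.
  rewrite /phase pE; have -> : B (chi * phi) = dist_scale chi B phi by [].
  rewrite hB /cintegral /=; apply: eq_Rintegral => m _.
  by rewrite hE phiE.
have mp : msup i p by exists K.
have mx : msup i x by exists K; split => // m /pK E; rewrite /x E !mul0r.
have my : msup i y by exists K; split => // m /pK E; rewrite /y E !mul0r mulr0.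
have cF : cint i F.
  have c1 : cint i (fun m => e m * x m).
    apply: cint_continuous; first exact: msupMr.
    by move=> m; exact: (@continuousM R M e x m (ce m) (cx m)).
  have c2 : cint i (fun m => -1 * (f m * y m)).
    apply: cintZ; apply: cint_continuous; first exact: msupMr.
    by move=> m; exact: (@continuousM R M f y m (cf m) (cy m)).
  have := cintD c1 c2; congr cint; apply/funext => m.
  by rewrite mulN1r.
have cp : cint i (fun m => c * p m) by apply: cintZ; exact: cint_smooth.
have I1 : mint vol (fun m => c * p m) = c.
  by rewrite (mintZ hM volP _ (cint_smooth mp sp)) p1 mulr1.
have FC m : `|F m| <= c * p m.
  have [Km|Km] := pselect (K m); last first.
    have -> : F m = 0 by rewrite /F /x /y pK// !mul0r !mulr0 subr0.
    by rewrite normr0 mulr_ge0.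
  have -> : F m = G m * p m.
    rewrite /F /G /x /y; have := D0 m Km.
    by move: (D m) (e m) (f m) (a m) (b m) (p m) => *; field.
  by rewrite normrM (ger0_norm (p0 m)) ler_wpM2r// HC.
rewrite FE ler_norml; apply/andP; split.
  rewrite -subr_ge0 opprK -I1 -(mintD hM volP cF cp); apply: mint_ge0 => m.
  by have := FC m; rewrite ler_norml => /andP[]; lra.
rewrite -subr_ge0 -{1}I1 -(mintB hM volP cp cF); apply: mint_ge0 => m.
by have := FC m; rewrite ler_norml => /andP[]; lra.
Qed.

(** The type of charts may be uncountable; compactness leaves finitely many charts, indexed by
    integers, so that the exceptional events can be enumerated. *)
Lemma finite_chart_cover : exists s : seq M, forall m,
  exists l : nat, chart_dom (chart_at A (nth point s l)) m.
Proof.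
have cC : cover_compact [set: M] by rewrite -compact_cover.
have [|m _|D _ DC] := cC M setT (fun m => chart_dom (chart_at A m)).
- by move=> m _; exact: oD.
- by exists m => //; exact: chart_atP.
exists (finmap.enum_fset D) => m; have [m' mD mm'] := DC m I.
exists (index m' (finmap.enum_fset D)); rewrite nth_index//.
Qed.

Lemma ae_nowhere_continuous : {ae Gamma, forall B : schwartz_dist A,
  forall chi : testfun A, is_continuous_function vol (dist_scale chi B) -> chi = 0}.
Proof.
have [s sP] := finite_chart_cover.
pose ch l := chart_at A (nth point s l).
pose bx (q : 'rV[rat]_d) (n : nat) : set 'rV[R]_d := box (map_mx ratr q) n.+1%:R^-1.
have /choice[F FP] : forall x : nat * 'rV[rat]_d * nat,
    exists pu : nat -> (M -> R) * (M -> R), bx x.1.2 x.2 `<=` chart_cod (ch x.1.1) ->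
    forall k, [/\ rsmooth A (pu k).1, forall m, 0 <= (pu k).1 m,
      forall m, ~ (chart_inv (ch x.1.1) @` bx x.1.2 x.2) m -> (pu k).1 m = 0,
      mint vol (pu k).1 = 1 &
      resolves g (pu k).2 (pu k).1 /\
      k%:R <= mint vol (fun m => (pu k).1 m * (pu k).2 m)].
  move=> [[l q] n] /=.
  have [bC|nC] := pselect (bx q n `<=` chart_cod (ch l)); last first.
    by exists (fun=> (fun=> 0, fun=> 0)).
  have [|pu puP] := @rough_family (ch l) (map_mx ratr q) n.+1%:R^-1 _ bC.
    by rewrite invr_gt0.
  by exists pu.
(* Indices are a chart, the centre and size of a box, and a bound. Neither [B] nor [chi] occurs;
   boxes that leave the chart have no rough family and get the empty set. *)
pose bad (x : nat * 'rV[rat]_d * nat * nat) : set (borel (schwartz_dist A)) :=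
  if `[< bx x.1.1.2 x.1.2 `<=` chart_cod (ch x.1.1.1) >] then
    \bigcap_k [set B | (`|phase (F x.1 k).1 B| <= x.2.+1%:R)%R] else set0.
have bad0 x : Gamma.-negligible (bad x).
  rewrite /bad; case: asboolP => [bC|_]; last exact: negligible_set0.
  apply: (bounded_phases_null hM cM volP GFF (i := ch x.1.1.1) (u := fun k => (F x.1 k).2)) => // k.
  have [sp p0 pK _ [ru V]] := FP x.1 bC k; split => //.
  exists (chart_inv (ch x.1.1.1) @` bx x.1.1.2 x.1.2); split => //.
    by apply: compact_inv_box => //; exact: compact_box.
  by move=> _ [y /bC iy <-]; exact: chart_invP.
(* Countable subadditivity is available for sequences, so the index type is enumerated by
   [unpickle], codes of nothing giving the empty set. *)
have N0 : Gamma.-negligible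
    (\bigcup_j (if @unpickle (nat * 'rV[rat]_d * nat * nat)%type j is Some x then bad x else set0)).
  by apply: negligible_bigcup => j; case: unpickle => [x|]; [exact: bad0|exact: negligible_set0].
apply: negligibleS N0 => B /= /existsNP[chi /not_implyP[[h hc hB] chi0]].
have [m0 m00] : exists m0, chi m0 != 0.
  apply: contrapT => H; apply: chi0; apply/val_inj/funext => m.
  by apply/eqP; apply: contrapT => cm; apply: H; exists m; apply/negP.
have [l lm] := sP m0.
(* The squared modulus is a smooth real function with the same zeros as [chi], so a rational box can
   be found where [chi] does not vanish. *)
pose w m := complex.Re (chi m) ^+ 2 + complex.Im (chi m) ^+ 2.
have sw : rsmooth A w.
  exact: (rsmoothD (rsmoothM (rsmooth_Re chi) (rsmooth_Re chi)) (rsmoothM (rsmooth_Im chi) (rsmooth_Im chi))).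
have w0 m : (w m == 0) = (chi m == 0).
  by rewrite paddr_eq0 ?sqr_ge0// !sqrf_eq0 eq_complex.
pose O := chart_cod (ch l) `&` pull (ch l) w @^-1` [set y | y != 0].
have oO : open O.
  rewrite openE => x [ix wx]; apply: filterI; first exact: open_nbhs_nbhs (conj (@oC (ch l)) ix).
  apply: (smooth_continuous (sw (ch l)) ix); apply: open_nbhs_nbhs.
  by split; [exact: open_neq|exact: wx].
have Om : O (chart_map (ch l) m0).
  by split; [exact: chart_mapP|rewrite /= pullK// w0].
have [q [n [_ bO]]] := rat_box oO Om.
have bC : bx q n `<=` chart_cod (ch l) by move=> x /bO[].
pose K := chart_inv (ch l) @` bx q n.
have cK : compact K by apply: compact_inv_box => //; exact: compact_box.
have KD : K `<=` chart_dom (ch l) by move=> _ [x /bC ix <-]; exact: chart_invP.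
have chiK m : K m -> chi m != 0 by move=> [x /bO[_ /= wx] <-]; rewrite -w0.
have [c cP] := phase_multiple cK KD chiK hc hB.
(* An integer above the bound [c], so that this [B] lies in one of the enumerated bad events. *)
exists (pickle (l, q, n, Num.bound `|c|)); first exact: I.
rewrite pickleK /bad /=; case: asboolP => // _ k _ /=.
have [sp p0 pK p1 _] := FP (l, q, n) bC k.
apply: (le_trans (cP _ sp p0 pK p1)); apply: (le_trans (ler_norm c)).
apply: (@le_trans _ _ (Num.bound `|c|)%:R); last by rewrite ler_nat.
by apply/ltW/archi_boundP.
Qed.

End NowhereContinuous.

Theorem corollary1p2 (R : realType) (M : ptopologicalType) (d : nat)
  (A : smooth_atlas R M d) (g : riemannian_metric A)
  (vol : {measure set (borel M) -> \bar R})
  (Gamma : probability (borel (schwartz_dist A)) R) :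
  (1 <= d)%N ->
  hausdorff_space M -> compact [set: M] -> connected [set: M] ->
  is_riemannian_volume g vol ->
  is_gaussian_free_field g vol Gamma ->
  (2 <= d)%N ->
  {ae Gamma, forall B : schwartz_dist A, forall chi : testfun A,
     is_continuous_function vol (dist_scale chi B) -> chi = 0}.
Proof. by move=> _ hM cM _ volP GFF d2; exact: (ae_nowhere_continuous hM cM volP GFF d2). Qed.
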